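(* Let $d\in\{1,2,3\}$, let $\Omega\subset\mathbb{R}^d$ be a bounded open domain with smooth boundary, let $\beta_1\in\mathbb{R}$ and $\beta_2,\beta_3,\beta_4,\beta_5>0$. Let $T>0$ and let $\boldsymbol{u}$ be the unique strong solution of the LLBar problem (defined in the context) with initial data $\boldsymbol{u}_0\in \mathbb{H}^2$. Then $$\boldsymbol{u} \in C^{0,\alpha}(0,T; \mathbb{L}^2) \cap C^{0,\beta}(0,T; \mathbb{L}^\infty),$$ where $\alpha \in \left(0, \frac{1}{2}\right]$ and $\beta \in \left(0, \frac{1}{2} - \frac{d}{8} \right]$.
   Context: Notation: $\mathbb{L}^p:=L^p(\Omega;\mathbb{R}^3)$, $\mathbb{H}^k:=W^{k,2}(\Omega;\mathbb{R}^3)$; $\langle\cdot,\cdot\rangle_{\mathbb{L}^2}$ denotes the $\mathbb L^2$ scalar product both for $\mathbb{R}^3$-valued functions and for matrix-valued functions (with the Frobenius product). For $\boldsymbol v:\Omega\to\mathbb{R}^3$, $\nabla\boldsymbol v=[\partial_1\boldsymbol v\ \cdots\ \partial_d\boldsymbol v]\in\mathbb{R}^{3\times d}$, $\Delta \boldsymbol v$ is the componentwise Laplacian, $\partial\boldsymbol v/\partial\boldsymbol n=(\nabla\boldsymbol v)\boldsymbol n$ with $\boldsymbol n$ the exterior unit normal, and $\boldsymbol u\times\nabla\boldsymbol v=[\boldsymbol u\times\partial_1\boldsymbol v\ \cdots\ \boldsymbol u\times\partial_d\boldsymbol v]$. $C^{0,\alpha}(0,T;X)$ is the space of $X$-valued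 functions of time that are Hölder continuous with exponent $\alpha$. LLBar problem: find $\boldsymbol u:[0,T]\times\Omega\to\mathbb{R}^3$ with $$\partial_t\boldsymbol{u} - \beta_1 \Delta \boldsymbol{u} + \beta_2 \Delta^2 \boldsymbol{u} = \beta_3 (1-|\boldsymbol{u}|^2)\boldsymbol{u}-\beta_4 \boldsymbol{u}\times \Delta \boldsymbol{u} + \beta_5 \Delta(|\boldsymbol{u}|^2 \boldsymbol{u}) \ \text{in } (0,T)\times\Omega,$$ $\boldsymbol u(0,\cdot)=\boldsymbol u_0$ in $\Omega$, and $\partial\boldsymbol u/\partial\boldsymbol n=\partial(\Delta\boldsymbol u)/\partial\boldsymbol n=\boldsymbol 0$ on $(0,T)\times\partial\Omega$. Weak solution: given $T>0$ and $\boldsymbol u_0\in\mathbb{L}^2$, a function $\boldsymbol u:[0,T]\to\mathbb{H}^2$ is a weak solution if $\boldsymbol u\in C([0,T];\mathbb{L}^2)\cap L^2(0,T;\mathbb{H}^2)$ and, for all $\boldsymbol\phi\in\mathbb{H}^2$ and $t\in[0,T]$, $$\langle \boldsymbol{u}(t),\boldsymbol{\phi}\rangle_{\mathbb{L}^2} + \beta_1 \int_0^t \langle\nabla\boldsymbol{u}(s),\nabla\boldsymbol{\phi}\rangle_{\mathbb{L}^2} \mathrm{d}s + \beta_2 \int_0^t \langle\Delta \boldsymbol{u}(s),\Delta \boldsymbol{\phi}\rangle_{\mathbb{L}^2} \mathrm{d}s = \langle\boldsymbol{u}_0, \boldsymbol{\phi}\rangle_{\mathbb{L}^2} + \beta_3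 \int_0^t \langle (1-|\boldsymbol{u}(s)|^2) \boldsymbol{u}(s),\boldsymbol{\phi} \rangle_{\mathbb{L}^2} \mathrm{d}s$$ $$+ \beta_4 \int_0^t \langle \boldsymbol{u}(s)\times \nabla \boldsymbol{u}(s), \nabla\boldsymbol{\phi} \rangle_{\mathbb{L}^2} \mathrm{d}s - \beta_5 \int_0^t \langle \nabla(|\boldsymbol{u}(s)|^2 \boldsymbol{u}(s)),\nabla\boldsymbol{\phi} \rangle_{\mathbb{L}^2} \mathrm{d}s.$$ Strong solution: a weak solution that belongs to $C([0,T];\mathbb{H}^2)\cap L^2(0,T;\mathbb{H}^4)$; in this case it satisfies the LLBar problem almost everywhere in $[0,T]\times\Omega$. *)

(* Defs.v *)
From HB Require Import structures.
From mathcomp Require Import all_boot all_order all_algebra.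
From mathcomp Require Import all_classical all_reals all_analysis.

Set Implicit Arguments.
Unset Strict Implicit.
Unset Printing Implicit Defensive.

Import Order.TTheory GRing.Theory Num.Theory.
Import numFieldNormedType.Exports.

Local Open Scope classical_set_scope.
Local Open Scope ring_scope.

Definition measure_row_display : measure_display -> measure_display.
Proof. exact. Qed.

Section measurable_row.
Context {d} {T : sigmaRingType d}.
Variable n : nat.

Let coors : 'I_n -> 'rV[T]_n -> T := fun i x => x ord0 i.

Let row_set0 : g_sigma_preimage coors set0.
Proof. exact: sigma_algebra0. Qed.

Let row_setC A : g_sigma_preimage coors A -> g_sigma_preimage coors (~` A).
Proof. exact: sigma_algebraC. Qed.

Let row_bigcup (F : _^nat) : (forall i, g_sigma_preimage coors (F i)) ->
  g_sigma_preimage coors (\bigcup_i (F i)).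
Proof. exact: sigma_algebra_bigcup. Qed.

HB.instance Definition _ := @isMeasurable.Build (measure_row_display d)
  ('rV[T]_n) (g_sigma_preimage coors) row_set0 row_setC row_bigcup.

End measurable_row.

Section lebesgue_row.
Context {R : realType}.

Definition row_cons n (p : R * 'rV[R]_n) : 'rV[R]_n.+1 :=
  \row_(i < n.+1) if unlift ord0 i is Some j then p.2 ord0 j else p.1.

Lemma row_cons0 n (p : R * 'rV[R]_n) : row_cons p ord0 ord0 = p.1.
Proof. by rewrite mxE unlift_none. Qed.

Lemma row_cons_lift n (p : R * 'rV[R]_n) i :
  row_cons p ord0 (lift ord0 i) = p.2 ord0 i.
Proof. by rewrite mxE liftK. Qed.

Lemma measurable_coor n (i : 'I_n) :
  measurable_fun [set: 'rV[R]_n] (fun x => x ord0 i).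
Proof.
move=> _ Y mY; rewrite setTI; apply: sub_sigma_algebra => /=.
rewrite -bigcup_seq/=; exists i => /=; first by rewrite mem_index_enum.
by exists Y => //; rewrite setTI.
Qed.

Lemma measurable_rowP d (T : measurableType d) n (f : T -> 'rV[R]_n) :
  (forall i, measurable_fun setT (fun t => f t ord0 i)) -> measurable_fun setT f.
Proof.
move=> mf _ A mA; rewrite setTI; move: A mA.
apply: smallest_sub.
  split => [|A mA|F mF].
  - by rewrite preimage_set0.
  - by rewrite setTD preimage_setC; exact: measurableC.
  - by rewrite preimage_bigcup; exact: bigcup_measurable.
rewrite -bigcup_seq => A [i _ [B mB <-]]; rewrite setTI.
by rewrite -[X in measurable X]setTI; exact: mf.
Qed.

Lemma measurable_row_cons n : measurable_fun setT (@row_cons n).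
Proof.
apply: measurable_rowP => i; case: (unliftP ord0 i) => [j|] ->.
  under eq_fun do rewrite row_cons_lift.
  exact: (measurableT_comp (measurable_coor j) measurable_snd).
by under eq_fun do rewrite row_cons0; exact: measurable_fst.
Qed.

Lemma measurable_row_tail n :
  measurable_fun setT (fun x : 'rV[R]_n.+1 => \row_j x ord0 (lift ord0 j)).
Proof.
apply: measurable_rowP => i.
by under eq_fun do rewrite mxE; exact: measurable_coor.
Qed.

Section row_prod.
Variables (n : nat) (mu : {sigma_finite_measure set 'rV[R]_n -> \bar R}).

Definition row_prod : set 'rV[R]_n.+1 -> \bar R :=
  pushforward (@lebesgue_measure R \x mu)%E (@row_cons n).

Let pf0 : row_prod set0 = 0%E.
Proof. by rewrite /row_prod /pushforward preimage_set0 measure0. Qed.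
Let pf_ge0 A : (0 <= row_prod A)%E.
Proof. by rewrite /row_prod /pushforward; exact: measure_ge0. Qed.
Let pf_sigma : semi_sigma_additive row_prod.
Proof.
exact: (@measure_semi_sigma_additive _ _ _
  (measure_function_pushforward__canonical__measure_function_Measure
     (@lebesgue_measure R \x mu)%E (@measurable_row_cons n))).
Qed.

HB.instance Definition _ := isMeasure.Build _ _ _ row_prod pf0 pf_ge0 pf_sigma.

Let row_prod_sigma_finite : sigma_finite setT row_prod.
Proof.
have /sigma_finiteP[F [TF ndF Foo]] := sigma_finiteT (@lebesgue_measure R).
have /sigma_finiteP[G [TG ndG Goo]] := sigma_finiteT mu.
pose hd (x : 'rV[R]_n.+1) : R := x ord0 ord0.
pose tl (x : 'rV[R]_n.+1) : 'rV[R]_n := \row_j x ord0 (lift ord0 j).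
exists (fun k => hd @^-1` F k `&` tl @^-1` G k).
  apply/seteqP; split => // x _.
  have [i _ Fi] : (\bigcup_i F i) (hd x) by rewrite -TF.
  have [j _ Gj] : (\bigcup_i G i) (tl x) by rewrite -TG.
  exists (maxn i j) => //; split.
    by have /subsetPset := ndF _ _ (leq_maxl i j); exact.
  by have /subsetPset := ndG _ _ (leq_maxr i j); exact.
move=> k; have [mF Fk] := Foo k; have [mG Gk] := Goo k; split.
  apply: measurableI.
    by rewrite -[X in measurable X]setTI; exact: (measurable_coor ord0).
  rewrite -[X in measurable X]setTI; exact: measurable_row_tail.
rewrite /row_prod /pushforward.
rewrite (_ : _ @^-1` _ = F k `*` G k).
  by rewrite product_measure1E// lte_mul_pinfty// ge0_fin_numE.
apply/seteqP; split => -[a y] /=; rewrite /hd /tl row_cons0;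
  (rewrite (_ : \row_j _ = y); last by apply/rowP => j; rewrite mxE row_cons_lift);
  by [].
Qed.

HB.instance Definition _ :=
  Measure_isSigmaFinite.Build _ _ _ row_prod row_prod_sigma_finite.

End row_prod.
End lebesgue_row.

(* Lebesgue measure on the Borel sets of R^n, by iterated product measures. *)
Fixpoint lebesgue_row {R : realType} (n : nat) :
    {sigma_finite_measure set 'rV[R]_n -> \bar R} :=
  match n with
  | 0%N => (\d_(0 : 'rV[R]_0) : {sigma_finite_measure set 'rV[R]_0 -> \bar R})
  | m.+1 =>
      (row_prod (lebesgue_row m)
        : {sigma_finite_measure set 'rV[R]_m.+1 -> \bar R})
  end.

Section smooth.
Context {R : realType} {n : nat}.
Implicit Types (f : 'rV[R]_n -> R) (s : seq 'I_n).

(* The multi-index of a partial derivative of order k is given by the sequence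
   of the k directions of differentiation: s = [:: i; j] stands for d_i d_j. *)
Definition partial s f : 'rV[R]_n -> R :=
  foldr (fun i g => 'D_(delta_mx ord0 i) g) f s.

Definition smooth f := forall s,
  continuous (partial s f) /\
  forall i x, derivable (partial s f) x (delta_mx ord0 i).

End smooth.

(* Near each boundary point, up to relabelling and reorienting the coordinate
   axes, Omega is the strict epigraph of a smooth function of n - 1
   variables. *)
Definition smooth_boundary (R : realType) (n : nat) (Omega : set 'rV[R]_n) :=
  forall x0, (closure Omega `\` Omega°) x0 ->
  exists (r : R) (i : 'I_n) (b : bool) (g : 'rV[R]_n.-1 -> R),
    [/\ 0 < r, smooth g & forall x, ball x0 r x ->
      (Omega x <-> g (col' i x) < (-1) ^+ b * x ord0 i)].

Definition smooth_bounded_domain (R : realType) (n : nat)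
    (Omega : set 'rV[R]_n) :=
  [/\ Omega !=set0, open Omega, connected Omega, bounded_set Omega
    & smooth_boundary Omega].

Section euclidean.
Context {R : realType}.

Definition frob m n (A B : 'M[R]_(m, n)) : R := \sum_i \sum_j A i j * B i j.

Definition frob_norm m n (A : 'M[R]_(m, n)) : R := Num.sqrt (frob A A).

(* The indices k + 1 and k + 2 are taken modulo 3. *)
Definition cross (a b : 'cV[R]_3) : 'cV[R]_3 :=
  \col_k (a (k + 1) ord0 * b (k + 2) ord0 - a (k + 2) ord0 * b (k + 1) ord0).

Definition cross_cols n (a : 'cV[R]_3) (B : 'M[R]_(3, n)) : 'M[R]_(3, n) :=
  \matrix_(k, i) cross a (col i B) k ord0.

End euclidean.

(* Functions on Omega are total functions on R^n of which only the values on
   Omega matter; L^p classes are represented by Borel functions. *)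
Section function_spaces.
Context {R : realType} {n : nat}.
Variable Omega : set 'rV[R]_n.
Local Notation mu := (lebesgue_row n).
Local Notation field := ('rV[R]_n -> 'cV[R]_3).

Definition Lp (p : \bar R) : set field := [set v | forall i,
  (fun x => v x i ord0) \_ Omega \in Lfun mu p].

Definition Lp_norm (p : \bar R) (v : field) : \bar R :=
  'N[mu]_p[EFin \o ((fun x => frob_norm (v x)) \_ Omega)]%E.

Definition L2_dot k l (v w : 'rV[R]_n -> 'M[R]_(k, l)) : R :=
  \int[mu]_(x in Omega) frob (v x) (w x).

Definition test_function (phi : 'rV[R]_n -> R) :=
  [/\ smooth phi, compact (closure [set x | phi x != 0])
    & closure [set x | phi x != 0] `<=` Omega].

Definition loc_integrable (f : 'rV[R]_n -> R) := forall K,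
  compact K -> K `<=` Omega -> mu.-integrable K (EFin \o f).

Definition weak_derivative (s : seq 'I_n) (f g : 'rV[R]_n -> R) :=
  [/\ loc_integrable f, loc_integrable g & forall phi, test_function phi ->
    \int[mu]_(x in Omega) (f x * partial s phi x) =
    (-1) ^+ size s * \int[mu]_(x in Omega) (g x * phi x)].

(* A representative of the weak derivative; it is unique up to null sets, and
   has no meaning when there is no weak derivative. *)
Definition weak_partial (s : seq 'I_n) (f : 'rV[R]_n -> R) : 'rV[R]_n -> R :=
  xget (cst 0) [set g | weak_derivative s f g].

Definition wD (s : seq 'I_n) (v : field) : field :=
  fun x => \col_j weak_partial s (fun y => v y j ord0) x.

Definition wgrad (v : field) : 'rV[R]_n -> 'M[R]_(3, n) :=
  fun x => \matrix_(j, i) wD [:: i] v x j ord0.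

Definition wlap (v : field) : field := fun x => \sum_i wD [:: i; i] v x.

Definition Hk (k : nat) : set field := [set v | Lp 2%:E v /\
  forall s : seq 'I_n, (size s <= k)%N ->
    exists2 g, Lp 2%:E g &
      forall j, weak_derivative s (fun x => v x j ord0) (fun x => g x j ord0)].

(* A derivative of multi-index a is counted |a|!/a! times, once for each order
   of differentiation; this norm is equivalent to the one over multi-indices. *)
Definition Hk_norm (k : nat) (v : field) : \bar R :=
  ((\sum_(j < k.+1) \sum_(s : j.-tuple 'I_n) Lp_norm 2%:E (wD s v) ^+ 2)
     `^ 2^-1)%E.

End function_spaces.

(* The pair of a set X and a functional N stands for a normed space. As above,
   u is total and only its values on [0, T] matter. *)
Section time_dependent.
Context {R : realType} {n : nat}.
Local Notation field := ('rV[R]_n -> 'cV[R]_3).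
Variables (T : R) (X : set field) (N : field -> \bar R).
Local Notation mu := (@lebesgue_measure R).
Implicit Type u : R -> field.

Definition continuous_in_time u :=
  forall t0, t0 \in `[0, T] -> X (u t0) /\
    N (u t \- u t0) @[t --> within `[0, T]%classic (nbhs t0)] --> 0%E.

Definition simple_in_time u :=
  [/\ finite_set (u @` `[0, T]%classic),
      forall v, measurable (`[0, T]%classic `&` u @^-1` [set v])
    & u @` `[0, T]%classic `<=` X].

Definition strongly_measurable u := exists g : nat -> R -> field,
  (forall k, simple_in_time (g k)) /\
  {ae mu, forall t, t \in `[0, T] -> N (g k t \- u t) @[k --> \oo] --> 0%E}.

Definition square_integrable_in_time u :=
  [/\ {ae mu, forall t, t \in `[0, T] -> X (u t)},
      strongly_measurable u
    & (\int[mu]_(t in `[0%R, T]) (N (u t) ^+ 2) < +oo)%E].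

Definition holder_in_time (alpha : R) u :=
  (forall t, t \in `[0, T] -> X (u t)) /\
  exists C : R, forall s t, s \in `[0, T] -> t \in `[0, T] ->
    (N (u t \- u s)%R <= (C * `|t - s| `^ alpha)%:E)%E.

End time_dependent.

Section llbar.
Context {R : realType} {n : nat}.
Variables (Omega : set 'rV[R]_n) (b1 b2 b3 b4 b5 T : R).
Local Notation field := ('rV[R]_n -> 'cV[R]_3).
Local Notation mu := (@lebesgue_measure R).
Local Notation "<< v , w >>" := (L2_dot Omega v w).
Implicit Type u : R -> field.

Definition cubic (v : field) : field := fun x => frob_norm (v x) ^+ 2 *: v x.

Definition weak_solution (u0 : field) u :=
  [/\ forall t, t \in `[0, T] -> Hk Omega 2 (u t),
      continuous_in_time T (Lp Omega 2%:E) (Lp_norm Omega 2%:E) u,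
      square_integrable_in_time T (Hk Omega 2) (Hk_norm Omega 2) u
    & forall phi, Hk Omega 2 phi -> forall t, t \in `[0, T] ->
      << u t, phi >>
      + b1 * (\int[mu]_(s in `[0, t]) << wgrad Omega (u s), wgrad Omega phi >>)
      + b2 * (\int[mu]_(s in `[0, t]) << wlap Omega (u s), wlap Omega phi >>)
      = << u0, phi >>
      + b3 * (\int[mu]_(s in `[0, t])
          << (fun x => (1 - frob_norm (u s x) ^+ 2) *: u s x), phi >>)
      + b4 * (\int[mu]_(s in `[0, t])
          << (fun x => cross_cols (u s x) (wgrad Omega (u s) x)),
             wgrad Omega phi >>)
      - b5 * (\int[mu]_(s in `[0, t])
          << wgrad Omega (cubic (u s)), wgrad Omega phi >>)].

Definition strong_solution (u0 : field) u :=
  [/\ weak_solution u0 u,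
      continuous_in_time T (Hk Omega 2) (Hk_norm Omega 2) u
    & square_integrable_in_time T (Hk Omega 4) (Hk_norm Omega 4) u].

End llbar.

(* Main.v *)
(** The weak formulation is tested with the increment phi = u t - u s. All the
    terms under the time integrals are then bounded uniformly in time, because u
    is continuous from the compact interval [0, T] into H^2, and H^2 embeds into
    L^oo; hence |u t - u s|^2 <= K |t - s| in L^2, which is the exponent 1 / 2.
    For L^oo one interpolates with the inequality, valid for 0 < rho <= 1,
      |v|_oo <= C rho^(- n / 2) (|v|_2 + rho^2 |D^2 v|_2),
    at rho = (|t - s| / T)^(1 / 4). Only the continuity in H^2 is used.

    The interpolation inequality comes from averages of v against kernels
    supported in a cone with vertex x: between two dyadic scales these kernels
    differ by second derivatives of functions with compact support. The cone
    condition is local, and the closure of Omega is compact. The kernels and all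
    the test functions are products of functions of one coordinate, and
    inequalities almost everywhere are read off from integrals over boxes. *)

Require Import Defs.
From mathcomp Require Import finmap all_boot all_order all_algebra.
From mathcomp Require Import all_classical all_reals all_analysis.
(* [measurable_realfun] is imported again because [ring] and [lra] hide its
   canonical structures on the extended reals. *)
From mathcomp Require Import ring lra ess_sup_inf measurable_realfun.
Import Order.TTheory GRing.Theory Num.Theory.
Import numFieldNormedType.Exports HBNNSimple.
Set Implicit Arguments.
Unset Strict Implicit.
Unset Printing Implicit Defensive.
Local Open Scope classical_set_scope.
Local Open Scope ring_scope.

(** * Integrals of functions that need not be measurable *)

(** Measurability in time of the pairings under the integrals is never established, nor is it shown
    that [cubic (u s)] has a weak gradient. The argument asks of these terms only a bound uniform in
    time. An integral of an arbitrary function is a difference of two suprema over simple functions,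
    and for these both domination and the splitting of [0, t] at s survive.

    For the cubic term an inequality replaces the chain rule: on a bounded set of values the
    increments of the cubic are controlled by those of the components, and this passes to the weak
    derivative whenever there is one.

    In the interpolation, passing from scale rho to rho / 2 costs rho^(2 - n / 2) times the pure
    second derivatives, a geometric series as long as n <= 3. The exponent 1 / 4 in the choice of
    rho balances the two terms: |v|_2 is of order |t - s|^(1 / 2) while the second derivatives are
    merely bounded, so rho^2 should be of order |t - s|^(1 / 2) as well; the factor rho^(- n / 2)
    then leaves |t - s|^(1 / 2 - n / 8). *)

Section integral_bounds.
Context {d : measure_display} {T : measurableType d} {R : realType}.
Variable mu : {measure set T -> \bar R}.
Implicit Types (D : set T) (f g F G : T -> R).

Local Notation integrable D f := (mu.-integrable D (EFin \o f)).

Lemma ae_imp (P Q : T -> Prop) : {ae mu, forall x, P x} ->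
  (forall x, P x -> Q x) -> {ae mu, forall x, Q x}.
Proof. by move=> aeP PQ; apply: filterS aeP. Qed.

Lemma ae_imp2 (P Q S : T -> Prop) : {ae mu, forall x, P x} ->
  {ae mu, forall x, Q x} -> (forall x, P x -> Q x -> S x) ->
  {ae mu, forall x, S x}.
Proof. by move=> aeP aeQ PQS; apply: filterS2 aeP aeQ. Qed.

(* The integral of a nonnegative function is a supremum over the simple
   functions below it, so the dominated function need not be measurable. *)
Lemma ge0_ae_le_integral_nonmeasurable D (F : T -> \bar R) (G : T -> \bar R) :
  measurable D -> (forall x, 0 <= F x)%E -> (forall x, 0 <= G x)%E ->
  measurable_fun D G -> {ae mu, forall x, D x -> (F x <= G x)%E} ->
  (\int[mu]_(x in D) F x <= \int[mu]_(x in D) G x)%E.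
Proof.
move=> mD F0 G0 mG FG.
rewrite integral_mkcond ge0_integralTE; last by move=> x; exact: erestrict_ge0.
apply: ge_ereal_sup => _ [h /= hF <-].
rewrite -integralT_nnsfun [X in (_ <= X)%E]integral_mkcond.
apply: ae_ge0_le_integral => //.
- by move=> x _; rewrite lee_fin.
- exact: measurableT_comp.
- by move=> x _; exact: erestrict_ge0.
- exact/(measurable_restrictT _ mD).1.
apply: filterS FG => x FG _; apply: (le_trans (hF x)).
by rewrite /patch; case: ifPn => // /set_mem /FG.
Qed.

(** The positive and the negative part of [F] both have an integral between 0 and that of [G], and
    two numbers of [0, g] differ by at most g. This is where arbitrary functions enter all later
    estimates. *)
Lemma ae_le_normr_Rintegral D F G : measurable D -> integrable D G ->
  {ae mu, forall x, D x -> `|F x| <= G x} ->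
  `|\int[mu]_(x in D) F x| <= \int[mu]_(x in D) G x.
Proof.
move=> mD iG FG.
have mG : measurable_fun D (EFin \o G) by exact: measurable_int iG.
have G'fin : (\int[mu]_(x in D) `|(G x)%:E| < +oo)%E by case/integrableP : iG.
(* Almost everywhere on [D] one has 0 <= |F| <= G, so the absolute value changes nothing; it
   provides a majorant that is nonnegative everywhere. *)
have iG' : (\int[mu]_(x in D) (G x)%:E = \int[mu]_(x in D) `|(G x)%:E|)%E.
  apply: ae_eq_integral => //; first exact: measurableT_comp.
  apply: filterS FG => x FG Dx /=; rewrite ger0_norm//.
  exact: le_trans (FG Dx).
have bound (P : T -> \bar R) : (forall x, 0 <= P x)%E ->
    (forall x, P x <= `|(F x)%:E|)%E ->
    (0 <= \int[mu]_(x in D) P x <= \int[mu]_(x in D) `|(G x)%:E|)%E.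
  move=> P0 PF; apply/andP; split; first exact: integral_ge0.
  apply: ge0_ae_le_integral_nonmeasurable => //; first exact: measurableT_comp.
  apply: filterS FG => x FG Dx; apply: (le_trans (PF x)).
  by rewrite lee_fin (le_trans (FG Dx))// ler_norm.
rewrite /Rintegral (integralE _ _ (EFin \o F)) iG'.
have := bound (EFin \o F)^\+%E (funepos_ge0 _) (fun x => _).
have := bound (EFin \o F)^\-%E (funeneg_ge0 _) (fun x => _).
have h1 x : ((EFin \o F)^\+ x <= `|(F x)%:E|)%E.
  by rewrite funeposE ge_max /= lee_fin ler_norm/= lee_fin.
have h2 x : ((EFin \o F)^\- x <= `|(F x)%:E|)%E.
  by rewrite funenegE ge_max /= !lee_fin -normrN ler_norm normr_ge0.
move=> /(_ h2) B2 /(_ h1) B1.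
move: (\int[mu]_(x in D) `|(G x)%:E|)%E G'fin B1 B2 => [g| |] // _; last first.
  by move=> /andP[/le_trans /[apply]].
case: (\int[mu]_(x in D) _^\+ x)%E => [a| |] //; last by rewrite leye_eq andbF.
case: (\int[mu]_(x in D) _^\- x)%E => [b| |] //; last by rewrite leye_eq andbF.
rewrite /= !lee_fin ler_norml => /andP[a0 ag] /andP[b0 bg].
by apply/andP; split; lra.
Qed.

(** A simple function below [F] on the union restricts to simple functions below [F] on [A] and on
    [B]; hence the supremum over the union is at most the sum of the two suprema. *)
Lemma ge0_integral_setU_nonmeasurable (A B : set T) (F : T -> \bar R) (K : \bar R) :
  measurable A -> measurable B -> [disjoint A & B] -> (forall x, 0 <= F x)%E ->
  (\int[mu]_(x in B) F x <= K)%E ->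
  (\int[mu]_(x in A `|` B) F x <= \int[mu]_(x in A) F x + K)%E /\
  (\int[mu]_(x in A) F x <= \int[mu]_(x in A `|` B) F x)%E.
Proof.
move=> mA mB AB F0 FK; split.
- rewrite integral_mkcond ge0_integralTE; last by move=> x; exact: erestrict_ge0.
  apply: ge_ereal_sup => _ [h /= hF <-].
  (* Outside the union [h] is squeezed between 0 and 0. *)
  have h0 : (\int[mu]_x (h x)%:E = \int[mu]_(x in A `|` B) (h x)%:E)%E.
    rewrite [RHS]integral_mkcond; apply: eq_integral => x _.
    rewrite /patch; case: ifPn => // nx; apply/eqP; rewrite eq_le lee_fin.
    by have := hF x; rewrite /patch (negbTE nx) lee_fin => -> /=; rewrite lee_fin.
  have below (C : set T) : measurable C -> C `<=` A `|` B ->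
      (\int[mu]_(x in C) (h x)%:E <= \int[mu]_(x in C) F x)%E.
    move=> mC CAB; rewrite integral_mkcond [X in (_ <= X)%E]integral_mkcond.
    have -> : ((fun x => (h x)%:E) \_ C)%E = EFin \o proj_nnsfun h mC.
      apply/funext => x /=; rewrite /patch mindicE.
      by case: ifPn => _; rewrite ?mulr1 ?mulr0.
    rewrite integralT_nnsfun [X in (_ <= X)%E]ge0_integralTE; last first.
      by move=> x; exact: erestrict_ge0.
    apply: ereal_sup_ubound; exists (proj_nnsfun h mC) => //= x.
    rewrite /patch mindicE; case: ifPn => xC; rewrite ?mulr1 ?mulr0//.
    apply: (le_trans (hF x)); rewrite /patch ifT//.
    by rewrite inE; apply: CAB; exact: set_mem.
  rewrite -integralT_nnsfun h0 ge0_integral_setU//.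
  + apply: leeD; first by apply: below => // x; left.
    by apply: (le_trans _ FK); apply: below => // x; right.
  + by apply: measurable_funTS; exact/measurable_EFinP.
  + by move=> x _; rewrite lee_fin.
- rewrite integral_mkcond [X in (_ <= X)%E]integral_mkcond.
  rewrite !ge0_integralTE; [|by move=> x; exact: erestrict_ge0..].
  apply: le_ereal_sup => _ [h /= hF <-]; exists h => // x /=.
  apply: (le_trans (hF x)); rewrite /patch; case: ifPn => xA.
    by rewrite ifT// inE; left; exact: set_mem.
  by case: ifPn.
Qed.

(** Passing from [A] to the union increases the integral of each of the two parts of [F] by an
    amount in [0, K mu(B)], and the two increases are subtracted. It is meant for A = [0, s] and B =
    ]s, t]. *)
Lemma Rintegral_setU_bound (A B : set T) F (K : R) :
  measurable A -> measurable B -> [disjoint A & B] ->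
  (mu A < +oo)%E -> (mu B < +oo)%E ->
  (forall x, (A `|` B) x -> `|F x| <= K) ->
  `|\int[mu]_(x in A `|` B) F x - \int[mu]_(x in A) F x| <= K * fine (mu B).
Proof.
move=> mA mB AB Afin Bfin FK.
have [K0|K0] := ltP K 0.
  have e0 : A `|` B = set0.
    by apply/seteqP; split=> // x /FK Fx; have := normr_ge0 (F x); lra.
  move: e0; rewrite setU_eq0 => -[-> ->].
  by rewrite setU0 !Rintegral_set0 subrr normr0 measure0 mulr0.
have mF (C : set T) : measurable C -> C `<=` A `|` B ->
    forall P : T -> \bar R, (forall x, 0 <= P x)%E ->
    (forall x, P x <= `|(F x)%:E|)%E ->
    (0 <= \int[mu]_(x in C) P x <= K%:E * mu C)%E.
  move=> mC CAB P P0 PF; apply/andP; split; first exact: integral_ge0.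
  rewrite -integral_cst//; apply: ge0_ae_le_integral_nonmeasurable => //.
  apply/nearW => x Cx; apply: (le_trans (PF x)); rewrite lee_fin.
  by apply: FK; exact: CAB.
have P0 := funepos_ge0 (EFin \o F); have N0 := funeneg_ge0 (EFin \o F).
have h1 x : ((EFin \o F)^\+ x <= `|(F x)%:E|)%E.
  by rewrite funeposE ge_max /= lee_fin ler_norm/= lee_fin.
have h2 x : ((EFin \o F)^\- x <= `|(F x)%:E|)%E.
  by rewrite funenegE ge_max /= !lee_fin -normrN ler_norm normr_ge0.
have AsU : A `<=` A `|` B by move=> x; left.
have BsU : B `<=` A `|` B by move=> x; right.
have /andP[_ PB] := mF B mB BsU _ P0 h1.
have /andP[_ NB] := mF B mB BsU _ N0 h2.
have [P1 P2] := @ge0_integral_setU_nonmeasurable A B _ _ mA mB AB P0 PB.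
have [N1 N2] := @ge0_integral_setU_nonmeasurable A B _ _ mA mB AB N0 NB.
have /andP[PA0 PA] := mF A mA AsU _ P0 h1.
have /andP[NA0 NA] := mF A mA AsU _ N0 h2.
rewrite /Rintegral !(integralE _ _ (EFin \o F)).
move: P1 P2 N1 N2 PA0 PA NA0 NA.
have [a ->] : exists a, mu A = a%:E.
  by exists (fine (mu A)); rewrite fineK// ge0_fin_numE.
have [b ->] : exists b, mu B = b%:E.
  by exists (fine (mu B)); rewrite fineK// ge0_fin_numE.
case: (\int[mu]_(x in A) (_^\+ x))%E => [pa| |] //.
case: (\int[mu]_(x in A) (_^\- x))%E => [na| |] //.
case: (\int[mu]_(x in A `|` B) (_^\+ x))%E => [pu| |] //.
case: (\int[mu]_(x in A `|` B) (_^\- x))%E => [nu| |] //=.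
rewrite -!EFinM -!EFinD !lee_fin => *.
by rewrite ler_norml; apply/andP; split; lra.
Qed.

Lemma Rintegral_dominated_cvg D (f_ : nat -> T -> R) (f g : T -> R) :
  measurable D -> (forall n, measurable_fun D (f_ n)) -> measurable_fun D f ->
  {ae mu, forall x, D x -> f_ n x @[n --> \oo] --> f x} ->
  integrable D g ->
  {ae mu, forall x, D x -> forall n, `|f_ n x| <= g x} ->
  integrable D f /\
  \int[mu]_(x in D) f_ n x @[n --> \oo] --> \int[mu]_(x in D) f x.
Proof.
move=> mD mf_ mf ff ig fg.
have [] := @dominated_convergence _ _ _ mu D mD (fun n => EFin \o f_ n)
  (EFin \o f) (EFin \o g).
- by move=> n; exact/measurable_EFinP.
- exact/measurable_EFinP.
- apply: filterS ff => x ff Dx; apply: cvg_EFin; first exact: nearW.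
  exact: ff.
- exact: ig.
- by apply: filterS fg => x fg n Dx /=; rewrite lee_fin; exact: fg.
move=> intf _ cv; split => //.
have fn : (\int[mu]_(x in D) (EFin \o f) x)%E \is a fin_num.
  exact: integrable_fin_num.
by apply: fine_cvg; rewrite fineK.
Qed.

End integral_bounds.

(** * Lebesgue measure on row vectors *)

Section lebesgue_row_theory.
Context {R : realType}.
Local Notation leb := (@lebesgue_measure R).
Local Notation lebS n := ((leb \x lebesgue_row n)%E :
  {measure set (measurableTypeR R * 'rV[R]_n)%type -> \bar R}).

Lemma measurable_row_consT n :
  measurable_fun (setT : set (measurableTypeR R * 'rV[R]_n)%type) (@row_cons R n).
Proof. exact: measurable_row_cons. Qed.

Lemma ge0_integral_rowS n (f : 'rV[R]_n.+1 -> \bar R) :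
  measurable_fun setT f -> (forall x, 0 <= f x)%E ->
  (\int[lebesgue_row n.+1]_x f x =
   \int[leb]_t \int[lebesgue_row n]_y f (row_cons (t, y)))%E.
Proof.
move=> mf f0.
transitivity (\int[leb \x lebesgue_row n]_z f (row_cons z))%E.
  apply: (@ge0_integral_pushforward _ _ _ _ _ _ (@measurable_row_consT n)
    (lebS n) setT f measurableT mf).
  by move=> y _; exact: f0.
rewrite fubini_tonelli1//.
by apply: measurableT_comp => //; exact: measurable_row_consT.
Qed.

Lemma integrable_rowS n (f : 'rV[R]_n.+1 -> \bar R) :
  (lebesgue_row n.+1).-integrable setT f ->
  (leb \x lebesgue_row n)%E.-integrable setT (f \o @row_cons R n).
Proof.
move=> /integrableP[mf fi]; apply/integrableP; split.
  by apply: measurableT_comp => //; exact: measurable_row_consT.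
rewrite -(@ge0_integral_pushforward _ _ _ _ _ _ (@measurable_row_consT n)
    (lebS n) setT (abse \o f) measurableT)//.
  exact: measurableT_comp.
by move=> y _; exact: abse_ge0.
Qed.

Lemma integral_rowS n (f : 'rV[R]_n.+1 -> \bar R) :
  (lebesgue_row n.+1).-integrable setT f ->
  (\int[lebesgue_row n.+1]_x f x =
   \int[leb]_t \int[lebesgue_row n]_y f (row_cons (t, y)))%E.
Proof.
move=> fi; have mf : measurable_fun setT f by exact: measurable_int fi.
have fi' := @integrable_rowS n f fi.
transitivity (\int[leb \x lebesgue_row n]_z f (row_cons z))%E.
  exact: (@integral_pushforward _ _ _ _ _ _ (@measurable_row_consT n)
    (lebS n) setT f mf fi' measurableT).
by rewrite -fubini1.
Qed.

Lemma integrable_rowSP n (f : 'rV[R]_n.+1 -> \bar R) :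
  measurable_fun setT f ->
  (\int[leb]_t \int[lebesgue_row n]_y `|f (row_cons (t, y))| < +oo)%E ->
  (lebesgue_row n.+1).-integrable setT f.
Proof.
move=> mf fi; apply/integrableP; split => //.
have := @ge0_integral_rowS n (abse \o f) (measurableT_comp _ mf) (fun=> abse_ge0 _).
by move=> /= ->.
Qed.

(** Tonelli's theorem for the indicator of the complement of [P]. *)
Lemma ae_rowS n (P : set 'rV[R]_n.+1) : measurable P ->
  {ae leb, forall t, {ae lebesgue_row n, forall y, P (row_cons (t, y))}} ->
  {ae lebesgue_row n.+1, forall x, P x}.
Proof.
move=> mP aeP; exists (~` P); split; [exact: measurableC| |by []].
have mcP := measurableC mP.
have := @ge0_integral_rowS n (EFin \o (\1_(~` P) : _ -> R)).
rewrite integral_indic// setIT => ->; last 2 first.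
- exact/measurable_EFinP.
- by move=> x; rewrite lee_fin.
rewrite -[RHS](integral0 leb setT).
have mf1 : measurable_fun setT (fun z : (measurableTypeR R * 'rV[R]_n)%type => (EFin \o (\1_(~` P) : _ -> R)) (@row_cons R n z)).
  apply: measurableT_comp; last exact: measurable_row_consT.
  exact/measurable_EFinP.
apply: ae_eq_integral => //.
  apply: (@measurable_fun_fubini_tonelli_F _ _ _ _ _ _ _ mf1) => z.
  by rewrite lee_fin.
apply: (ae_imp aeP) => t {}aeP _ /=.
rewrite -[RHS](integral0 (lebesgue_row n) setT); apply: ae_eq_integral => //.
  exact: (measurable_fun_pair2 t mf1).
apply: (ae_imp aeP) => y Py _ /=.
by rewrite indicE memNset//= => -[].
Qed.

(** The inner integral in Fubini's theorem may be infinite on a null set, where [fine] sets it to 0;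
    this brings the theorem back to real-valued functions. *)
Lemma integrable_fine d (T : measurableType d) (mu : {measure set T -> \bar R})
    (f : T -> \bar R) : mu.-integrable setT f ->
  mu.-integrable setT (EFin \o (fine \o f)) /\
  \int[mu]_x fine (f x) = fine (\int[mu]_x f x)%E.
Proof.
move=> intf; have mf := measurable_int _ intf.
have ae_fin := integrable_ae measurableT intf.
have mff : measurable_fun setT (EFin \o (fine \o f)).
  by apply/measurable_EFinP; apply: measurableT_comp => //; exact: measurable_fine.
split.
  apply: (le_integrable measurableT mff _ intf) => x _ /=.
  by case: (f x) => [r| |] /=; rewrite ?normr0 ?leey.
congr fine; apply: ae_eq_integral => //.
by apply: (ae_imp ae_fin) => x fin _ /=; rewrite fineK// fin.
Qed.

Lemma Rintegral_rowS n (f : 'rV[R]_n.+1 -> R) :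
  (lebesgue_row n.+1).-integrable setT (EFin \o f) ->
  [/\ {ae leb, forall t, (lebesgue_row n).-integrable setT
        (fun y => (f (row_cons (t, y)))%:E)},
     leb.-integrable setT
       (EFin \o (fun t => \int[lebesgue_row n]_y f (row_cons (t, y)))) &
     \int[lebesgue_row n.+1]_x f x =
     \int[leb]_t \int[lebesgue_row n]_y f (row_cons (t, y))].
Proof.
move=> intf; have intf' := @integrable_rowS n _ intf.
have [h1 h2] := integrable_fine (integrable_fubini_F intf').
split => //; first exact: (ae_integrable1 intf').
by rewrite [RHS]h2 /Rintegral integral_rowS.
Qed.

Definition cube n (I : 'I_n -> set R) : set 'rV[R]_n :=
  [set x | forall j, I j (x ord0 j)].

Lemma measurable_cube n (I : 'I_n -> set R) : (forall j, measurable (I j)) ->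
  measurable (cube I).
Proof.
move=> mI; rewrite [X in measurable X](_ : _ =
    \bigcap_(j in [set: 'I_n]) [set x : 'rV[R]_n | I j (x ord0 j)]).
  apply: fin_bigcap_measurable => // j _.
  by rewrite -[X in measurable X]setTI; exact: measurable_coor.
by apply/seteqP; split => x /= h j; [move=> _; exact: h|exact: h].
Qed.

End lebesgue_row_theory.

(** * Measure of boxes; the sign of a function read off from its integrals over rational boxes *)

Section measure_of_boxes.
Context {R : realType}.
Local Notation leb := (@lebesgue_measure R).

Lemma lebesgue_row_cube n (I : 'I_n -> set R) (l : 'I_n -> R) :
  (forall j, measurable (I j)) -> (forall j, leb (I j) = (l j)%:E) ->
  lebesgue_row n (cube I) = (\prod_j l j)%:E.
Proof.
elim: n I l => [|n IH] I l mI Il.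
  by rewrite big_ord0 /= diracE mem_set//= => -[].
have -> : lebesgue_row n.+1 (cube I) =
    (\int[lebesgue_row n.+1]_x (\1_(cube I) x)%:E)%E.
  by rewrite integral_indic ?setIT//; exact: measurable_cube.
have mcI := measurable_cube mI.
have mI0 : measurable (I ord0 : set (measurableTypeR R)) := mI ord0.
rewrite ge0_integral_rowS//; last exact/measurable_EFinP.
set C := cube (fun j => I (lift ord0 j)).
have mC : measurable C by exact: measurable_cube.
transitivity (\int[leb]_t ((\prod_j l (lift ord0 j))%:E * (\1_(I ord0) t)%:E)%E)%E; last first.
  rewrite integralZl//; last first.
    apply/integrableP; split; first exact/measurable_EFinP/measurable_indic.
    under eq_integral do rewrite /= ger0_norm//.
    by rewrite integral_indic// setIT [X in (X < _)%E](Il ord0) ltry.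
  by rewrite integral_indic// setIT [X in (_ * X)%E](Il ord0) big_ord_recl -EFinM mulrC.
apply: eq_integral => t _; rewrite -(IH _ _ (fun j => mI (lift ord0 j)) (fun j => Il (lift ord0 j))).
have -> : lebesgue_row n C = (\int[lebesgue_row n]_y (\1_C y)%:E)%E.
  by rewrite integral_indic// setIT.
rewrite muleC -ge0_integralZl//; last exact/measurable_EFinP.
apply: eq_integral => y _; rewrite -EFinM !indicE -natrM mulnb; congr (_%:R%:E).
congr nat_of_bool; apply/idP/idP.
- move=> /set_mem h; apply/andP; split; apply/mem_set.
    by have := h ord0; rewrite row_cons0.
  by move=> j; have := h (lift ord0 j); rewrite row_cons_lift.
- move=> /andP[/set_mem h0 /set_mem hC]; apply/mem_set => j.
  by case: (unliftP ord0 j) => [i ->|->]; rewrite ?row_cons_lift ?row_cons0.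
Qed.

(** By Lebesgue differentiation the primitive of [f] has derivative [f x] at almost every x. If
    [f x < 0], the primitive is larger just before x than just after, so that some interval with
    rational ends around x has a negative integral. *)
Lemma ae_ge0_of_rat_itv (f : R -> R) : leb.-integrable setT (EFin \o f) ->
  (forall p q : rat, 0 <= \int[leb]_(x in `]ratr p, ratr q]) f x) ->
  {ae leb, forall x, 0 <= f x}.
Proof.
move=> intf f0.
have intf' (A : set R) : measurable A -> leb.-integrable A (EFin \o f).
  by move=> mA; exact: integrableS intf.
have locf : locally_integrable setT f.
  by apply: open_integrable_locally => //; exact: openT.
have := FTC1Ny (fun y => intf' _ _) locf => /(_ (fun _ => measurable_itv _)).
move=> aeF; apply: (ae_imp aeF) => x [dF Fx]; rewrite leNgt; apply/negP => fx0.
set F := fun y => \int[leb]_(t in `]-oo, y]) f t.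
have : h^-1 *: (F (h + x) - F x) @[h --> 0^'] --> f x.
  by rewrite -Fx derive1E; have := dF; rewrite /derivable /derive;
    under eq_fun do rewrite [_ *: 1]mulr1 /=.
move=> /cvgrPdist_lt /(_ (- f x)); rewrite oppr_gt0 => /(_ fx0) [e /= e0 He].
have [p /itvP px] := @rat_in_itvoo R (x - e) x ltac:(lra).
have [q /itvP qx] := @rat_in_itvoo R x (x + e) ltac:(lra).
have xp : ratr p < x :> R by rewrite px.
have xq : x < ratr q :> R by rewrite qx.
have ep : x - e < ratr p :> R by rewrite px.
have eq : ratr q < x + e :> R by rewrite qx.
have quo (r : R) : r != x -> `|x - r| < e -> (r - x)^-1 * (F r - F x) < 0.
  move=> rx er; have := He (r - x); rewrite /= sub0r normrN distrC => /(_ er).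
  rewrite subr_eq0 => /(_ rx); rewrite subrK.
  by rewrite ltr_norml => /andP[h _]; rewrite /GRing.scale/= in h; lra.
have Fp : F x < F (ratr p).
  have := quo (ratr p); rewrite lt_eqF// => /(_ isT).
  rewrite gtr0_norm ?subr_gt0// => /(_ ltac:(lra)).
  by rewrite nmulr_rlt0 ?invr_lt0 ?subr_lt0// subr_gt0.
have Fq : F (ratr q) < F x.
  have := quo (ratr q); rewrite gt_eqF// => /(_ isT).
  rewrite ltr0_norm ?subr_lt0// => /(_ ltac:(lra)).
  by rewrite pmulr_rlt0 ?invr_gt0 ?subr_gt0// subr_lt0.
have := f0 p q; rewrite -(Rintegral_itvB (a := -oo%O) (b := BRight (ratr q))) //.
- by rewrite -/(F _) -/(F _); lra.
- exact: intf'.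
- by rewrite bnd_simp; lra.
Qed.

Definition ratbox n (p q : {ffun 'I_n -> rat}) : set 'rV[R]_n :=
  cube (fun j => `](ratr (p j)), (ratr (q j))]%classic).

(** Induction on the dimension. For a fixed rational box in the remaining coordinates, the integral
    of the slice at t is nonnegative for almost every t by the case of one variable. There are
    countably many boxes, so almost every t serves for all of them, and the induction hypothesis
    applies to its slice. *)
Lemma ae_ge0_of_rat_box n (f : 'rV[R]_n -> R) :
  (lebesgue_row n).-integrable setT (EFin \o f) ->
  (forall p q : {ffun 'I_n -> rat},
    0 <= \int[lebesgue_row n]_(x in ratbox p q) f x) ->
  {ae lebesgue_row n, forall x, 0 <= f x}.
Proof.
elim: n f => [|n IH] f intf f0.
  (* In dimension 0 there is a single point, of mass 1, and every box contains it. *)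
  apply/nearW => x; have := f0 [ffun=> 0] [ffun=> 0].
  rewrite /ratbox (_ : cube _ = setT); last by apply/seteqP; split => // y _ [].
  rewrite /Rintegral integral_dirac//=; last exact: measurable_int intf.
  by rewrite indicE in_setT mul1r (_ : x = 0) //; apply/rowP => -[].
have mf : measurable_fun setT f.
  by apply/measurable_EFinP; exact: measurable_int intf.
apply: ae_rowS.
  have := mf measurableT _ (measurable_itv `[0, +oo[); rewrite setTI.
  rewrite (_ : _ @^-1` _ = (fun x => 0 <= f x))//.
  by apply/seteqP; split => x /=; rewrite in_itv/= andbT.
have slice (p q : {ffun 'I_n -> rat}) : {ae leb, forall t,
    0 <= \int[lebesgue_row n]_(y in ratbox p q) f (row_cons (t, y))}.
  set D := [set x : 'rV[R]_n.+1 | forall j, x ord0 (lift ord0 j) \in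
    `](ratr (p j) : R), (ratr (q j))]].
  have mD : measurable D.
    rewrite (_ : D = cube (fun j => if unlift ord0 j is Some i then
        `](ratr (p i) : R), (ratr (q i))]%classic else setT)).
      by apply: measurable_cube => j; case: unlift.
    apply/seteqP; split => x /= Dx j.
      by case: (unliftP ord0 j) => [i ->|//]; exact: Dx.
    by have := Dx (lift ord0 j); rewrite liftK.
  have intD : (lebesgue_row n.+1).-integrable setT (EFin \o (f \_ D)).
    rewrite -restrict_EFin; apply/(integrable_mkcond _ mD).
    exact: integrableS intf.
  have [_ iG _] := Rintegral_rowS intD.
  have E t : \int[lebesgue_row n]_(y in ratbox p q) f (row_cons (t, y)) =
      \int[lebesgue_row n]_y (f \_ D) (row_cons (t, y)).
    rewrite Rintegral_mkcond; apply: eq_Rintegral => y _.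
    rewrite /patch; congr (if _ then _ else _); apply/idP/idP => /set_mem h;
      by apply/mem_set => j; have := h j; rewrite row_cons_lift.
  apply: ae_imp; last by move=> t; rewrite E; exact.
  apply: (ae_ge0_of_rat_itv iG) => a b.
  have := f0 [ffun j => if unlift ord0 j is Some i then p i else a]
             [ffun j => if unlift ord0 j is Some i then q i else b].
  set B := ratbox _ _; have mB : measurable B by apply: measurable_cube => j; exact: measurable_itv.
  rewrite Rintegral_mkcond.
  have intB : (lebesgue_row n.+1).-integrable setT (EFin \o (f \_ B)).
    rewrite -restrict_EFin; apply/(integrable_mkcond _ mB).
    exact: integrableS intf.
  have [_ _ ->] := Rintegral_rowS intB; rewrite [X in _ -> 0 <= X]Rintegral_mkcond.
  congr (0 <= _); apply: eq_Rintegral => t _; rewrite /patch.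
  case: ifPn => /asboolP tab.
    apply: eq_Rintegral => y _; congr (if _ then _ else _).
    apply/idP/idP => /set_mem h; apply/mem_set => j.
      by have := h (lift ord0 j); rewrite /= !ffunE liftK.
    rewrite /= !ffunE; case: (unliftP ord0 j) => [i ->|-> //].
      exact: h.
    by rewrite row_cons0.
  rewrite /Rintegral integral0_eq// => y _.
  rewrite memNset// => /(_ ord0); rewrite /= !ffunE unlift_none row_cons0.
  exact: tab.
have [aeint _ _] := Rintegral_rowS intf.
(* The boxes are enumerated by [pickle], so that countably many null sets are united. *)
have aeslice : {ae leb, forall t, forall p q : {ffun 'I_n -> rat},
    0 <= \int[lebesgue_row n]_(y in ratbox p q) f (row_cons (t, y))}.
  have : {ae leb, forall t, forall k, if (unpickle k : option ({ffun 'I_n -> rat} * {ffun 'I_n -> rat})%type) is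
      Some (p, q) then 0 <= \int[lebesgue_row n]_(y in ratbox p q) f (row_cons (t, y))
      else true}.
    apply/ae_foralln => k; case: unpickle => [[p q]|]; first exact: slice.
    exact/nearW.
  move=> aek; apply: (ae_imp aek) => t h p q.
  by have := h (pickle (p, q)); rewrite pickleK.
apply: (ae_imp2 aeint aeslice) => t; exact: IH.
Qed.

End measure_of_boxes.

(** * Borel sets, translations and products of functions of one coordinate *)

Section row_topology_translation.
Context {R : realType}.
Local Notation leb := (@lebesgue_measure R).

Lemma measurable_ratbox n (p q : {ffun 'I_n -> rat}) :
  measurable (ratbox p q : set 'rV[R]_n).
Proof. by apply: measurable_cube => j; exact: measurable_itv. Qed.

(** The margin [e] leaves room inside [A] for the supports of smoothed indicators of the box and for
    its small translates. *)
Definition inner_ratbox n (A : set 'rV[R]_n) (p q : {ffun 'I_n -> rat}) :=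
  exists2 e : R, 0 < e &
    cube (fun j => `[(ratr (p j) - e), (ratr (q j) + e)]%classic) `<=` A.

Lemma open_inner_ratbox n (A : set 'rV[R]_n) x : open A -> A x ->
  exists p q, inner_ratbox A p q /\ ratbox p q x.
Proof.
move=> oA Ax; have /nbhs_ballP[e /= e0 xeA] := open_nbhs_nbhs (conj oA Ax).
have P j : exists p : rat, x ord0 j - e / 2 < ratr p < x ord0 j.
  have [p /itvP px] := @rat_in_itvoo R (x ord0 j - e / 2) (x ord0 j) ltac:(lra).
  by exists p; rewrite !px.
have Q j : exists q : rat, x ord0 j < ratr q < x ord0 j + e / 2.
  have [p /itvP px] := @rat_in_itvoo R (x ord0 j) (x ord0 j + e / 2) ltac:(lra).
  by exists p; rewrite !px.
have [p px] := choice P; have [q qx] := choice Q.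
exists [ffun j => p j], [ffun j => q j]; split; last first.
  move=> j /=; rewrite !ffunE in_itv/=.
  by have /andP[_ ->] := px j; have /andP[/ltW -> _] := qx j.
(* The corners are within e / 2 of x, so that the enlarged box stays within 3 e / 4 of it. *)
exists (e / 4); first lra.
move=> y /= hy; apply: xeA; split=> // i j; rewrite ord1 {i}.
have := hy j; rewrite /= !ffunE in_itv/= => /andP[y1 y2].
have /andP[p1 _] := px j; have /andP[_ q2] := qx j.
by rewrite /ball/= ltr_norml; apply/andP; split; lra.
Qed.

Lemma ratbox_inner n (A : set 'rV[R]_n) p q : inner_ratbox A p q -> ratbox p q `<=` A.
Proof.
move=> [e e0 eA] x hx; apply: eA => j; have := hx j; rewrite /= !in_itv/= => /andP[a b].
by apply/andP; split; lra.
Qed.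

Local Notation ratcorners n := ({ffun 'I_n -> rat} * {ffun 'I_n -> rat})%type.

(** The sigma-algebra on rows is generated by the coordinates, not by the topology; an open set
    belongs to it as the union of the countably many rational boxes that it contains with a
    margin. *)
Lemma open_measurable_row n (A : set 'rV[R]_n) : open A -> measurable A.
Proof.
move=> oA; rewrite (_ : A = \bigcup_k (if (unpickle k : option (ratcorners n)) is
    Some (p, q) then if `[< inner_ratbox A p q >] then ratbox p q else set0
    else set0)).
  apply: bigcup_measurable => k _; case: unpickle => [[p q]|//].
  by case: ifP => // _; exact: measurable_ratbox.
apply/seteqP; split => [x Ax|x [k _]].
  have [p [q [pqA xpq]]] := open_inner_ratbox oA Ax.
  by exists (pickle (p, q)) => //; rewrite pickleK asboolT.
case: unpickle => [[p q]|//]; case: ifPn => // /asboolP pqA.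
exact: ratbox_inner.
Qed.

Lemma ae_inner_ratbox n (A : set 'rV[R]_n) (P : set 'rV[R]_n) : open A ->
  (forall p q, inner_ratbox A p q ->
    {ae lebesgue_row n, forall x, ratbox p q x -> P x}) ->
  {ae lebesgue_row n, forall x, A x -> P x}.
Proof.
move=> oA aeP.
have : {ae lebesgue_row n, forall x, forall k,
    if (unpickle k : option (ratcorners n)) is Some (p, q)
    then inner_ratbox A p q -> ratbox p q x -> P x else True}.
  apply/ae_foralln => k; case: unpickle => [[p q]|]; last exact/nearW.
  have [pqA|npqA] := pselect (inner_ratbox A p q); last exact/nearW.
  by apply: (ae_imp (aeP p q pqA)) => x h _.
move=> aek; apply: (ae_imp aek) => x h Ax.
have [p [q [pqA xpq]]] := open_inner_ratbox oA Ax.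
by have := h (pickle (p, q)); rewrite pickleK; exact.
Qed.

Lemma closed_measurable_row n (A : set 'rV[R]_n) : closed A -> measurable A.
Proof. by rewrite -openC => /open_measurable_row /measurableC; rewrite setCK. Qed.

Lemma compact_cube n (p q : 'I_n -> R) :
  compact (cube (fun j => `[p j, q j]%classic)).
Proof. by apply: rV_compact => j; exact: segment_compact. Qed.

Lemma measurable_row_shift n (h : 'rV[R]_n) :
  measurable_fun setT (fun x : 'rV[R]_n => x + h).
Proof.
apply: measurable_rowP => i; under eq_fun do rewrite mxE.
by apply: measurable_funD => //; exact: measurable_coor.
Qed.

(** The image of Lebesgue measure under a translation agrees with it on half-open intervals, which
    determine it. *)
Lemma ge0_integral_shift (f : R -> \bar R) (h : R) :
  measurable_fun (setT : set (measurableTypeR R)) f -> (forall x, 0 <= f x)%E ->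
  (\int[leb]_x f (x + h)%R = \int[leb]_x f x)%E.
Proof.
move=> mf f0.
have msh : measurable_fun (setT : set (measurableTypeR R))
    (fun x : measurableTypeR R => (x + h : measurableTypeR R)).
  exact: measurable_funD.
have := @ge0_integral_pushforward _ _ _ _ R _ msh leb setT f measurableT mf
  (fun y _ => f0 y).
rewrite preimage_setT => /= <-.
apply: eq_measure_integral => A mA _; apply/esym.
apply: lebesgue_measure_unique; last exact: mA.
move=> X [[a b] _ <-] /=; rewrite /pushforward.
rewrite (_ : _ @^-1` _ = `](a - h), (b - h)]%classic).
  by rewrite !lebesgue_measure_itv/= !lte_fin ltrD2r; case: ifP => // _; congr _%:E; ring.
by apply/seteqP; split => x; rewrite /= !in_itv/= ltrBlDr lerBrDr.
Qed.

Lemma ge0_integral_row_shift n (f : 'rV[R]_n -> \bar R) (h : 'rV[R]_n) :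
  measurable_fun setT f -> (forall x, 0 <= f x)%E ->
  (\int[lebesgue_row n]_x f (x + h)%R = \int[lebesgue_row n]_x f x)%E.
Proof.
elim: n f h => [|n IH] f h mf f0.
  by apply: eq_integral => x _; congr f; apply/rowP => -[].
have mfh : measurable_fun setT (fun x : 'rV[R]_n.+1 => f (x + h)).
  exact: measurableT_comp (measurable_row_shift h).
rewrite [LHS]ge0_integral_rowS// [RHS]ge0_integral_rowS//.
pose G t := (\int[lebesgue_row n]_y f (row_cons (t, y)))%E.
have mfr : measurable_fun setT (fun z : (measurableTypeR R * 'rV[R]_n)%type => f (row_cons z)).
  exact: measurableT_comp (@measurable_row_consT R n).
transitivity (\int[leb]_t G (t + h ord0 ord0)%R)%E; last first.
  apply: ge0_integral_shift => [|t]; last exact: integral_ge0.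
  exact: (@measurable_fun_fubini_tonelli_F _ _ _ _ _ _ _ mfr).
apply: eq_integral => t _.
rewrite /G -(IH (fun y => f (row_cons (t + h ord0 ord0, y)))
  (\row_j h ord0 (lift ord0 j)))//; last exact: (measurable_fun_pair2 _ mfr).
apply: eq_integral => y _; congr f; apply/rowP => i; rewrite mxE.
by case: (unliftP ord0 i) => [j ->|->]; rewrite ?row_cons_lift ?row_cons0 ?mxE.
Qed.

Lemma ae_row_shift n (P : set 'rV[R]_n) (h : 'rV[R]_n) :
  {ae lebesgue_row n, forall x, P x} -> {ae lebesgue_row n, forall x, P (x + h)}.
Proof.
move=> [N [mN N0 PN]].
exists [set x | N (x + h)]; split.
- by rewrite -[X in measurable X]setTI; exact: measurable_row_shift.
- have mN1 : measurable_fun setT (EFin \o (\1_N : 'rV[R]_n -> R)).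
    exact/measurable_EFinP/measurable_indic.
  have := ge0_integral_row_shift h mN1 (fun x => _).
  have -> : (\int[lebesgue_row n]_x (EFin \o (\1_N : _ -> R)) x = 0)%E.
    by rewrite integral_indic// setIT.
  move=> <-; last by move=> x; rewrite lee_fin.
  set S := [set x | N (x + h)].
  have mS : measurable S.
    by rewrite -[X in measurable X]setTI; exact: measurable_row_shift.
  transitivity (\int[lebesgue_row n]_x (\1_S x)%:E)%E.
    by rewrite integral_indic// setIT.
  by apply: eq_integral => x _; rewrite /= !indicE.
- by move=> x /= nP; exact: PN.
Qed.

Lemma integrable_row_shift n (f : 'rV[R]_n -> R) (h : 'rV[R]_n) :
  (lebesgue_row n).-integrable setT (EFin \o f) ->
  (lebesgue_row n).-integrable setT (EFin \o (fun x => f (x + h))).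
Proof.
move=> /integrableP[mf fi]; apply/integrableP; split.
  by apply: (measurableT_comp mf); exact: measurable_row_shift.
have := @ge0_integral_row_shift n (abse \o (EFin \o f)) h.
by rewrite /= => -> //; exact: measurableT_comp.
Qed.

Lemma Rintegral_row_shift n (f : 'rV[R]_n -> R) (h : 'rV[R]_n) :
  measurable_fun setT f ->
  \int[lebesgue_row n]_x f (x + h) = \int[lebesgue_row n]_x f x.
Proof.
move=> mf; rewrite /Rintegral !(integralE _ _ (fun x => (f _)%:E)).
have mf' : measurable_fun setT (EFin \o f) by exact/measurable_EFinP.
have := @ge0_integral_row_shift n (EFin \o f)^\+%E h.
move=> <- //; last exact: measurable_funepos.
have := @ge0_integral_row_shift n (EFin \o f)^\-%E h.
move=> <- //; last exact: measurable_funeneg.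
by congr (fine (_ - _)); apply: eq_integral => x _; rewrite ?funeposE ?funenegE.
Qed.

Definition tensor n (f : 'I_n -> R -> R) (x : 'rV[R]_n) := \prod_j f j (x ord0 j).

Lemma measurable_tensor n (f : 'I_n -> R -> R) :
  (forall j, measurable_fun setT (f j)) -> measurable_fun setT (tensor f).
Proof.
move=> mf; apply: measurable_prod => j _.
by apply: measurableT_comp => //; exact: measurable_coor.
Qed.

Lemma tensor_rowS n (f : 'I_n.+1 -> R -> R) t y :
  tensor f (row_cons (t, y)) = f ord0 t * tensor (fun j => f (lift ord0 j)) y.
Proof.
rewrite /tensor big_ord_recl row_cons0; congr (_ * _).
by apply: eq_bigr => j _; rewrite row_cons_lift.
Qed.

Lemma Rintegral_tensor n (f : 'I_n -> R -> R) :
  (forall j, leb.-integrable setT (EFin \o f j)) ->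
  (lebesgue_row n).-integrable setT (EFin \o tensor f) /\
  \int[lebesgue_row n]_x tensor f x = \prod_j \int[leb]_t f j t.
Proof.
elim: n f => [|n IH] f intf.
  have -> : tensor f = cst 1 by apply/funext => x; rewrite /tensor big_ord0.
  split.
    apply/integrableP; split; first exact/measurable_EFinP.
    by rewrite /= integral_dirac//= ?indicE ?in_setT ?mul1e ?normr1 ?mul1r ?ltry.
  by rewrite big_ord0 /Rintegral integral_dirac//= indicE in_setT mul1r.
have mf j : measurable_fun setT (f j).
  by apply/measurable_EFinP; exact: measurable_int (intf j).
have [intt It] := IH _ (fun j => intf (lift ord0 j)).
have intT : (lebesgue_row n.+1).-integrable setT (EFin \o tensor f).
  apply: integrable_rowSP; first by apply/measurable_EFinP; exact: measurable_tensor.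
  set c := (\int[lebesgue_row n]_y `|(tensor (fun j => f (lift ord0 j)) y)%:E|)%E.
  have cfin : c \is a fin_num.
    by rewrite ge0_fin_numE ?integral_ge0//; case/integrableP : intt.
  rewrite (_ : (\int[leb]_t _)%E = (\int[leb]_t (`|(f ord0 t)%:E| * c))%E); last first.
    apply: eq_integral => t _; rewrite /c -ge0_integralZl//.
      by apply: eq_integral => y _; rewrite /= tensor_rowS normrM EFinM.
    by apply: measurableT_comp => //; exact: measurable_int intt.
  rewrite -(fineK cfin) ge0_integralZr//.
  + case/integrableP : (intf ord0) => _ h; rewrite muleC; apply: lte_mul_pinfty => //.
    by rewrite lee_fin fine_ge0// integral_ge0.
  + by apply: measurableT_comp => //; exact: measurable_int (intf ord0).
  + by rewrite lee_fin fine_ge0// integral_ge0.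
split => //; have [_ _ ->] := Rintegral_rowS intT.
rewrite big_ord_recl -It -RintegralZr//.
apply: eq_Rintegral => t _; rewrite -RintegralZl//.
by apply: eq_Rintegral => y _; rewrite tensor_rowS.
Qed.

End row_topology_translation.

(** * Smooth functions of one variable *)

Section smooth_on_the_line.
Context {R : realType}.
Implicit Types f g : R -> R.

Definition der f g := forall x : R, is_derive x (1 : R) f (g x).

Lemma der_continuous f g : der f g -> continuous f.
Proof.
move=> fg x; apply: differentiable_continuous; apply/derivable1_diffP.
by case: (fg x).
Qed.

Lemma der_unique f g h : der f g -> der f h -> g = h.
Proof. by move=> fg fh; apply/funext => x; case: (fg x) => _ <-; case: (fh x). Qed.

Lemma der_cst (c : R) : der (fun=> c) (fun=> 0).
Proof. by move=> x; exact: is_derive_cst. Qed.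

Lemma der_id : der (fun t => t) (fun=> 1).
Proof. by move=> x; exact: is_derive_id. Qed.

Lemma derD f g f' g' : der f f' -> der g g' ->
  der (fun t => f t + g t) (fun t => f' t + g' t).
Proof. by move=> hf hg x; exact: is_deriveD. Qed.

Lemma derM f g f' g' : der f f' -> der g g' ->
  der (fun t => f t * g t) (fun t => f t * g' t + g t * f' t).
Proof. by move=> hf hg x; exact: is_deriveM. Qed.

Lemma derV f f' : (forall t, f t != 0) -> der f f' ->
  der (fun t => (f t)^-1) (fun t => - (f t)^-1 * ((f t)^-1 * f' t)).
Proof.
move=> f0 hf x; apply: (is_derive_eq (is_deriveV (f0 x) (hf x))).
by rewrite /GRing.scale/= expr2 invfM; ring.
Qed.

Lemma der_affine f f' (a b : R) : der f f' ->
  der (fun t => f (a * t + b)) (fun t => a * f' (a * t + b)).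
Proof.
move=> hf x; rewrite mulrC.
apply: (@is_derive1_comp _ f (fun t => a * t + b)); first exact: hf.
apply: (is_derive_eq (derD (derM (der_cst a) der_id) (der_cst b) x)).
by rewrite mulr0 addr0 mulr1 addr0.
Qed.

Fixpoint Cn k f : Prop :=
  if k is k'.+1 then exists2 f', der f f' & Cn k' f' else continuous f.

Lemma CnS k f : Cn k.+1 f -> Cn k f.
Proof.
elim: k f => [|k IH] f [f' ff' hf']; first exact: der_continuous ff'.
by exists f' => //; exact: IH.
Qed.

Lemma Cn_cst k (c : R) : Cn k (fun=> c).
Proof.
elim: k c => [|k IH] c; first by move=> x; exact: cvg_cst.
by exists (fun=> 0); [exact: der_cst|exact: IH].
Qed.

Lemma CnD k f g : Cn k f -> Cn k g -> Cn k (fun t => f t + g t).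
Proof.
elim: k f g => [|k IH] f g; first by move=> hf hg x; apply: cvgD; [exact: hf|exact: hg].
move=> [f' ff' hf'] [g' gg' hg'].
by exists (fun t => f' t + g' t); [exact: derD|exact: IH].
Qed.

Lemma CnM k f g : Cn k f -> Cn k g -> Cn k (fun t => f t * g t).
Proof.
elim: k f g => [|k IH] f g; first by move=> hf hg x; apply: cvgM; [exact: hf|exact: hg].
move=> hf hg; have hf0 := CnS hf; have hg0 := CnS hg.
case: hf hg => f' ff' hf' [g' gg' hg'].
exists (fun t => f t * g' t + g t * f' t); first exact: derM.
by apply: CnD; apply: IH.
Qed.

Lemma Cn_id k : Cn k (fun t => t).
Proof.
case: k => [|k]; first by move=> x; exact: cvg_id.
by exists (fun=> 1); [exact: der_id|exact: Cn_cst].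
Qed.

Lemma CnV k f : (forall t, f t != 0) -> Cn k f -> Cn k (fun t => (f t)^-1).
Proof.
move=> f0; elim: k => [|k IH] hf; first by move=> x; apply: cvgV; [exact: f0|exact: hf].
have hf0 := CnS hf; case: hf => f' ff' hf'.
exists (fun t => - (f t)^-1 * ((f t)^-1 * f' t)); first exact: derV.
apply: CnM; last by apply: CnM => //; exact: IH.
rewrite (_ : (fun t => _) = (fun t => -1 * (f t)^-1)); last first.
  by apply/funext => t; rewrite mulN1r.
by apply: CnM; [exact: Cn_cst|exact: IH].
Qed.

Lemma Cn_affine k f (a b : R) : Cn k f -> Cn k (fun t => f (a * t + b)).
Proof.
elim: k f => [|k IH] f.
  move=> hf x; apply: (@continuous_comp _ _ _ (fun t => a * t + b) f); last exact: hf.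
  by apply: cvgD; [apply: cvgM; [exact: cvg_cst|exact: cvg_id]|exact: cvg_cst].
move=> [f' ff' hf']; exists (fun t => a * f' (a * t + b)); first exact: der_affine.
by apply: CnM; [exact: Cn_cst|exact: IH].
Qed.

Definition smooth1 f := forall k, Cn k f.

Lemma smooth1_der f : smooth1 f -> exists2 f', der f f' & smooth1 f'.
Proof.
move=> hf; have [f' ff' _] := hf 1%N; exists f' => // k.
by have [g fg hg] := hf k.+1; rewrite (der_unique ff' fg).
Qed.

Lemma der_smooth1 f g : der f g -> smooth1 f -> smooth1 g.
Proof. by move=> fg /smooth1_der[h fh]; rewrite (der_unique fg fh). Qed.

(* x ^ - k exp (- 1 / x) on the right half-line: a family closed under
   differentiation up to linear combinations. *)
Definition flat k (x : R) := if 0 < x then x ^- k * expR (- x^-1) else 0.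

(** From e^y = (e^(y / (k + 1)))^(k + 1) >= (y / (k + 1))^(k + 1) at y = 1 / x. A bound linear in x
    is what differentiability at 0 requires. *)
Lemma flat_bound k x : `|flat k x| <= (k.+1%:R ^+ k.+1) * `|x|.
Proof.
rewrite /flat; case: ltP => x0; last first.
  by rewrite normr0 mulr_ge0// exprn_ge0.
have x1 : 0 < x^-1 by rewrite invr_gt0.
rewrite ger0_norm; last by rewrite mulr_ge0// ?expR_ge0// invr_ge0 exprn_ge0// ltW.
rewrite (gtr0_norm x0) expRN.
have h : (x^-1 / k.+1%:R) ^+ k.+1 <= expR x^-1.
  have -> : x^-1 = k.+1%:R * (x^-1 / k.+1%:R) by rewrite mulrC divfK.
  rewrite expRM_natl mulrAC divff// mul1r.
  have y0 : 0 <= x^-1 / k.+1%:R by rewrite divr_ge0// ltW.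
  rewrite ler_pXn2r ?nnegrE ?expR_ge0//.
  by apply: le_trans (expR_ge1Dx _); rewrite lerDr.
rewrite ler_pdivrMr ?expR_gt0//; apply: le_trans (ler_wpM2l _ h).
  rewrite expr_div_n exprVn [x ^+ k.+1]exprS; set K := k.+1%:R ^+ k.+1.
  have K0 : K != 0 by rewrite expf_neq0.
  have xn0 : x != 0 by rewrite gt_eqF.
  have xk0 : x ^+ k != 0 by rewrite expf_neq0.
  by rewrite le_eqVlt; apply/orP; left; apply/eqP; field; rewrite xn0 xk0 K0.
by rewrite mulr_ge0 ?exprn_ge0// ltW.
Qed.

Lemma der_flat k : der (flat k) (fun x => - k%:R * flat k.+1 x + flat k.+2 x).
Proof.
move=> x; have [x0|x0|->] := ltgtP x 0.
- rewrite /flat !ifF ?mulr0 ?addr0; try by apply/negbTE; rewrite -leNgt ltW.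
  apply: (near_eq_is_derive _ (is_derive_cst (0 : R) x (1 : R))).
  near=> y; rewrite ifF//; apply/negbTE; rewrite -leNgt ltW//.
  by near: y; exact: lt_nbhsl.
- have xn0 : x != 0 by rewrite gt_eqF.
  have dV : is_derive x (1 : R) (fun y => y^-1) (- x ^- 2).
    apply: (is_derive_eq (@is_deriveV _ id x _ _ xn0 (is_derive_id _ _))).
    by rewrite /GRing.scale/= mulr1.
  have dX : is_derive x (1 : R) (fun y => (y^-1) ^+ k) (k%:R * x^-1 ^+ k.-1 * (- x ^- 2)).
    have -> : (fun y : R => y^-1 ^+ k) = (fun y => y^-1) ^+ k.
      by apply/funext => y; elim: k => [|m IH]; rewrite ?expr0// !exprS IH.
    exact: is_deriveX.
  have dE : is_derive x (1 : R) (fun y => expR (- y^-1)) (expR (- x^-1) * x ^- 2).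
    rewrite -[x ^- 2]opprK.
    by apply: (@is_derive1_comp _ expR (fun y => - y^-1)); exact: is_deriveN.
  have dP : is_derive x (1 : R) (fun y => y^-1 ^+ k * expR (- y^-1))
      (- k%:R * flat k.+1 x + flat k.+2 x); last first.
    apply: (near_eq_is_derive _ dP); near=> y; rewrite /flat ifT ?exprVn//.
    by near: y; exact: lt_nbhsr.
  apply: (is_derive_eq (is_deriveM dX dE)).
  rewrite /flat x0 /GRing.scale/= -!exprVn; set e := expR _; set y := x^-1.
  by case: k {dX} => [|m]; rewrite ?mul0r ?mulr0 ?addr0 -?pred_Sn !exprS; ring.
- rewrite {2 3}/flat ltxx mulr0 addr0.
  (* At the origin the difference quotient of [flat k] is [flat k.+1], which tends to 0 by
     [flat_bound]. *)
  have h : h^-1 *: ((flat k \o shift 0) (h *: (1 : R)) - flat k 0) @[h --> 0^'] --> (0 : R).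
    apply/cvgrPdist_lt => e e0 /=; near=> h.
    have hn0 : h != 0 by near: h; exact: nbhs_dnbhs_neq.
    rewrite /flat ltxx subr0 [h *: _]mulr1 addr0 sub0r normrN.
    have -> : h^-1 *: (if 0 < h then h ^- k * expR (- h^-1) else 0) = flat k.+1 h.
      rewrite /flat; case: ifP => _; last by rewrite scaler0.
      by rewrite /GRing.scale/= mulrA exprS invfM.
    apply: (le_lt_trans (flat_bound _ _)).
    rewrite mulrC -ltr_pdivlMr ?exprn_gt0//.
    near: h; apply: dnbhs0_lt; by rewrite divr_gt0// exprn_gt0.
  by apply: DeriveDef; [apply/cvg_ex; exists 0|apply/cvg_lim].
Unshelve. all: by end_near. Qed.

Lemma smooth1_flat k : smooth1 (flat k).
Proof.
move=> m; elim: m k => [|m IH] k; first exact: der_continuous (der_flat k).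
exists (fun x => - k%:R * flat k.+1 x + flat k.+2 x); first exact: der_flat.
by apply: CnD => //; apply: CnM => //; exact: Cn_cst.
Qed.

(** A smooth stand-in for max(t, 0): the identity times the usual smooth step, a quotient of two
    flat functions. Its first two derivatives are a smooth step and a bump, and all test functions
    below are made from these three. *)
Lemma smooth_positive_part : exists th : R -> R,
  [/\ smooth1 th, forall t, t <= 1 -> th t = 0 & forall t, 2 <= t -> th t = t].
Proof.
(* Positive, because t - 1 and 2 - t are never both nonpositive. *)
pose den (t : R) := flat 0 (1 * t + -1) + flat 0 (-1 * t + 2).
have flat0_ge0 x : 0 <= flat 0 x.
  by rewrite /flat; case: ifP => // _; rewrite expr0 invr1 mul1r expR_ge0.
have flat0_gt0 x : 0 < x -> 0 < flat 0 x.
  by move=> x0; rewrite /flat x0 expr0 invr1 mul1r expR_gt0.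
have flat0_eq0 x : x <= 0 -> flat 0 x = 0 by rewrite leNgt /flat => /negbTE ->.
have den0 t : den t != 0.
  rewrite gt_eqF// /den; have [t1|t1] := lerP t (3/2).
    by apply: ltr_wpDl => //; apply: flat0_gt0; lra.
  by apply: ltr_pwDl => //; apply: flat0_gt0; lra.
exists (fun t => t * (flat 0 (1 * t + -1) * (den t)^-1)); split.
- move=> k; apply: CnM; first exact: Cn_id.
  have h (a b : R) : Cn k (fun t => flat 0 (a * t + b)).
    by apply: Cn_affine; exact: smooth1_flat.
  by apply: CnM => //; apply: CnV => //; exact: CnD.
- by move=> t t1; rewrite flat0_eq0 ?mul0r ?mulr0//; lra.
- move=> t t1; rewrite /den (flat0_eq0 (-1 * t + 2)) ?addr0; last lra.
  by rewrite divff ?mulr1// gt_eqF// flat0_gt0//; lra.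
Qed.

End smooth_on_the_line.

(** * Test functions of product form *)

Section smooth_tensors.
Context {R : realType} {n : nat}.
Implicit Types (f : 'I_n -> R -> R) (Omega : set 'rV[R]_n).

Definition upd f (i : 'I_n) (g : R -> R) := fun j => if j == i then g else f j.

Lemma tensor_upd f i g (x : 'rV[R]_n) :
  tensor (upd f i g) x = g (x ord0 i) * \prod_(j | j != i) f j (x ord0 j).
Proof.
rewrite /tensor (bigD1 i)//= /upd eqxx; congr (_ * _).
by apply: eq_bigr => j /negbTE ->.
Qed.

Lemma upd_id f i : upd f i (f i) = f.
Proof. by apply/funext => j; rewrite /upd; case: eqP => [->|]. Qed.

Lemma is_derive_line (F : 'rV[R]_n -> R) (x v : 'rV[R]_n) (df : R) :
  is_derive (0 : R) (1 : R) (fun h => F (h *: v + x)) df -> is_derive x v F df.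
Proof.
have E : (fun h : R => h^-1 *: (((fun h => F (h *: v + x)) \o shift 0) (h *: (1 : R)) -
     F (0 *: v + x))) = (fun h => h^-1 *: ((F \o shift x) (h *: v) - F x)).
  by apply/funext => h /=; rewrite addr0 scale0r add0r [h *: 1]mulr1.
by move=> [dF <-]; apply: DeriveDef; rewrite /derivable /derive -E.
Qed.

Lemma is_derive_tensor f i g : der (f i) g ->
  forall x, is_derive x (delta_mx ord0 i : 'rV[R]_n) (tensor f) (tensor (upd f i g) x).
Proof.
move=> fg x; apply: is_derive_line; rewrite tensor_upd.
set c := \prod_(j | _) _.
have -> : (fun h : R => tensor f (h *: delta_mx ord0 i + x)) =
    (fun h => f i (1 * h + x ord0 i) * c).
  apply/funext => h; rewrite -{1}(upd_id f i) tensor_upd !mxE !eqxx mulr1 mul1r.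
  congr (_ * _); apply: eq_bigr => j /negbTE ji.
  by rewrite !mxE eqxx/= ji mulr0 add0r.
apply: (is_derive_eq (derM (der_affine 1 (x ord0 i) fg) (der_cst c) 0)).
by rewrite !mulr0 !mul1r !add0r mulrC.
Qed.

Lemma partial1_tensor f i g : der (f i) g ->
  partial [:: i] (tensor f) = tensor (upd f i g).
Proof.
by move=> fg; apply/funext => x /=; case: (is_derive_tensor fg x) => _ ->.
Qed.

Lemma partial2_tensor f i g h : der (f i) g -> der g h ->
  partial [:: i; i] (tensor f) = tensor (upd f i h).
Proof.
move=> fg gh; rewrite -[LHS]/(partial [:: i] (partial [:: i] (tensor f))).
rewrite (partial1_tensor fg) (@partial1_tensor _ _ h); last by rewrite /upd eqxx.
by congr tensor; apply/funext => j; rewrite /upd; case: eqP.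
Qed.

Lemma continuous_tensor f : (forall j, continuous (f j)) -> continuous (tensor f).
Proof.
move=> cf; apply: (@continuous_big R 'I_n *%R 1 xpredT _ 'rV[R]_n (index_enum 'I_n)
  (fun j x => f j (x ord0 j))).
  exact: mul_continuous.
move=> j _ x.
apply: (@continuous_comp _ _ _ (fun x : 'rV[R]_n => x ord0 j) (f j)); last exact: cf.
exact: coord_continuous.
Qed.

Lemma partial_tensor_smooth f s : (forall j, smooth1 (f j)) ->
  exists2 g : 'I_n -> R -> R, partial s (tensor f) = tensor g &
    forall j, smooth1 (g j).
Proof.
move=> sf; elim: s => [|i s [g sg smg]] /=; first by exists f.
have [h gh smh] := smooth1_der (smg i).
exists (upd g i h); first by rewrite sg -(partial1_tensor gh).
by move=> j; rewrite /upd; case: eqP.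
Qed.

Lemma smooth_tensor f : (forall j, smooth1 (f j)) -> smooth (tensor f).
Proof.
move=> sf s; have [g -> smg] := partial_tensor_smooth s sf; split.
  by apply: continuous_tensor => j; exact: (smg j 0%N).
by move=> i x; have [h gh _] := smooth1_der (smg i); case: (is_derive_tensor gh x).
Qed.

Lemma closed_cube (p q : 'I_n -> R) : closed (cube (fun j => `[p j, q j]%classic)).
Proof.
rewrite (_ : cube _ = \bigcap_(j in [set: 'I_n])
    ((fun x : 'rV[R]_n => x ord0 j) @^-1` `[p j, q j]%classic)); last first.
  by apply/seteqP; split => x /= h j; [move=> _; exact: h|exact: h].
apply: closed_bigI => j _; apply: preimage_closed; last exact: itv_closed.
by move=> x _; exact: coord_continuous.
Qed.

Lemma tensor_supp f (p q : 'I_n -> R) (x : 'rV[R]_n) :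
  (forall j t, f j t != 0 -> p j <= t <= q j) ->
  tensor f x != 0 -> cube (fun j => `[p j, q j]%classic) x.
Proof.
move=> supp; rewrite /tensor prodf_seq_neq0 => /allP h j /=.
by rewrite in_itv/=; apply: supp; have := h j (mem_index_enum _).
Qed.

Lemma test_tensor Omega f (p q : 'I_n -> R) : (forall j, smooth1 (f j)) ->
  (forall j t, f j t != 0 -> p j <= t <= q j) ->
  cube (fun j => `[p j, q j]%classic) `<=` Omega ->
  test_function Omega (tensor f).
Proof.
move=> sf supp pqO.
have S : closure [set x : 'rV[R]_n | tensor f x != 0] `<=`
    cube (fun j => `[p j, q j]%classic).
  rewrite closureE; apply: smallest_sub; first exact: closed_cube.
  by move=> x; exact: tensor_supp.
split; first exact: smooth_tensor.
- apply: subclosed_compact S; first exact: closed_closure.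
  exact: compact_cube.
- exact: subset_trans pqO.
Qed.

Local Notation mu := (lebesgue_row n).

Lemma Rintegral_patchM Omega (v w : 'rV[R]_n -> R) :
  \int[mu]_(x in Omega) (v x * w x) = \int[mu]_x ((v \_ Omega) x * w x).
Proof.
rewrite Rintegral_mkcond; apply: eq_Rintegral => x _.
by rewrite /patch; case: ifP => // _; rewrite mul0r.
Qed.

Section tested.
Variables (Omega : set 'rV[R]_n) (p q : 'I_n -> R) (f : 'I_n -> R -> R).
Hypotheses (sf : forall j, smooth1 (f j)).
Hypothesis supp : forall j t, f j t != 0 -> p j <= t <= q j.
Hypothesis pqO : cube (fun j => `[p j, q j]%classic) `<=` Omega.

Lemma weak_derivative1_tensor i (v w : 'rV[R]_n -> R) g :
  weak_derivative Omega [:: i] v w -> der (f i) g ->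
  \int[mu]_x ((v \_ Omega) x * tensor (upd f i g) x) =
  - \int[mu]_x ((w \_ Omega) x * tensor f x).
Proof.
move=> [_ _ /(_ _ (test_tensor sf supp pqO)) E] fg.
rewrite -[RHS]mulN1r -!Rintegral_patchM -(partial1_tensor fg); exact: E.
Qed.

Lemma weak_derivative2_tensor i (v w : 'rV[R]_n -> R) g h :
  weak_derivative Omega [:: i; i] v w -> der (f i) g -> der g h ->
  \int[mu]_x ((v \_ Omega) x * tensor (upd f i h) x) =
  \int[mu]_x ((w \_ Omega) x * tensor f x).
Proof.
move=> [_ _ /(_ _ (test_tensor sf supp pqO)) E] fg gh.
rewrite -[RHS]mul1r -[X in X * _](expr1n R 2) -[X in X * _]sqrrN.
rewrite -!Rintegral_patchM -(partial2_tensor fg gh); exact: E.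
Qed.

Lemma weak_derivative_unique_tensor s (v w w' : 'rV[R]_n -> R) :
  weak_derivative Omega s v w -> weak_derivative Omega s v w' ->
  \int[mu]_x ((w \_ Omega) x * tensor f x) =
  \int[mu]_x ((w' \_ Omega) x * tensor f x).
Proof.
move=> [_ _ /(_ _ (test_tensor sf supp pqO)) h].
move=> [_ _ /(_ _ (test_tensor sf supp pqO)) h']; rewrite -!Rintegral_patchM.
have c0 : (-1 : R) ^+ size s != 0 by rewrite expf_neq0// oppr_eq0 oner_eq0.
by apply: (mulfI c0); rewrite -h -h'.
Qed.

End tested.
End smooth_tensors.

(** * One-dimensional profiles *)

Section profiles.
Context {R : realType}.

Lemma der_loc_cst (f g : R -> R) (U : set R) (a b : R) : open U -> der f g ->
  (forall t, U t -> f t = a * t + b) -> forall t, U t -> g t = a.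
Proof.
move=> oU fg fU t Ut.
have h : is_derive t (1 : R) f a.
  apply: (near_eq_is_derive _ (is_derive_eq (derD (derM (der_cst a) (@der_id R)) (der_cst b) t) _)).
    by near=> y; rewrite fU//; near: y; exact: open_nbhs_nbhs.
  by rewrite mulr0 addr0 mulr1 addr0.
by case: h => _ <-; case: (fg t) => _ <-.
Unshelve. all: by end_near. Qed.

Lemma continuous_bounded_supp (f : R -> R) (p q : R) : continuous f ->
  (forall t, f t != 0 -> p <= t <= q) -> exists2 K, 0 <= K & forall t, `|f t| <= K.
Proof.
move=> cf supp.
have [pq|qp] := leP p q; last first.
  exists 0 => // t; have [->|/supp/andP[]] := eqVneq (f t) 0; first by rewrite normr0.
  by move=> /le_trans /[apply]; rewrite leNgt qp.
have [c cpq cmax] := @EVT_max R (fun t => `|f t|) p q pq ltac:(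
  apply: continuous_subspaceT => t; apply: cvg_norm; exact: cf).
exists `|f c| => // t; have [->|/supp tpq] := eqVneq (f t) 0; first by rewrite normr0.
by apply: cmax; rewrite in_itv.
Qed.

End profiles.

Section profile_functions.
Context {R : realType}.

(** [B] and [b] are the first and second derivatives of [th]: a smooth step from 0 to 1, and a bump
    of integral 1, both varying on [1, 2] only. A single [K >= 1] bounds everything, so that later
    estimates carry one constant. *)
Lemma exists_profile : exists (th B b : R -> R) (K : R),
  [/\ der th B, der B b, smooth1 th & 1 <= K] /\
  [/\ forall t, t <= 1 -> th t = 0, forall t, 2 <= t -> th t = t,
      forall t, t < 1 -> B t = 0 & forall t, 2 < t -> B t = 1] /\
  [/\ forall t, `|B t| <= K, forall t, b t != 0 -> 1 <= t <= 2,
      forall t, `|b t| <= K & forall t, `|th t - Num.max t 0| <= K].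
Proof.
have [th [sth th0 th1]] := @smooth_positive_part R.
have [B thB sB] := smooth1_der sth; have [b Bb sb] := smooth1_der sB.
have B0 t : t < 1 -> B t = 0.
  apply: (der_loc_cst (@open_lt R 1) thB (b := 0)) => {}t t1.
  by rewrite th0 ?mul0r ?addr0// ltW.
have B1 t : 2 < t -> B t = 1.
  apply: (der_loc_cst (@open_gt R 2) thB (b := 0)) => {}t t1.
  by rewrite th1 ?mul1r ?addr0// ltW.
have b0 t : b t != 0 -> 1 <= t <= 2.
  move=> bt; rewrite leNgt [X in _ && X]leNgt; apply/andP; split; apply/negP => h.
    suff : b t = 0 by move/eqP; apply/negP.
    by apply: (der_loc_cst (@open_lt R 1) Bb (b := 0)) h => u /B0 ->; rewrite mul0r addr0.
  suff : b t = 0 by move/eqP; apply/negP.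
  by apply: (der_loc_cst (@open_gt R 2) Bb (b := 1)) h => u /B1 ->; rewrite mul0r add0r.
have [K1 K10 hK1] := continuous_bounded_supp (sb 0%N) b0.
have cB := sB 0%N; have cth := sth 0%N.
have [K2 K20 hK2] : exists2 K, 0 <= K & forall t, `|B t| <= K.
  have [c c02 cmax] := @EVT_max R (fun t => `|B t|) 0 3 ltac:(lra) ltac:(
    apply: continuous_subspaceT => t; apply: cvg_norm; exact: cB).
  exists (Num.max `|B c| 1) => [|t]; first by rewrite le_max ler01 orbT.
  rewrite le_max; have [t0|t0] := ltP t 1; first by rewrite B0// normr0 normr_ge0.
  have [t3|t3] := ltP 2 t; first by rewrite B1// normr1 lexx orbT.
  by rewrite cmax// in_itv/=; apply/andP; split; lra.
have [K3 K30 hK3] : exists2 K, 0 <= K & forall t, `|th t - Num.max t 0| <= K.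
  have [c c02 cmax] := @EVT_max R (fun t => `|th t|) 0 3 ltac:(lra) ltac:(
    apply: continuous_subspaceT => t; apply: cvg_norm; exact: cth).
  exists (`|th c| + 2) => [|t]; first by rewrite addr_ge0.
  have [t0|t0] := leP t 0; first by rewrite th0 ?subr0 ?normr0 ?addr_ge0//; lra.
  have [t2|t2] := leP 2 t; first by rewrite th1// subrr normr0 addr_ge0.
  apply: (le_trans (ler_normB _ _)); apply: lerD.
    by apply: cmax; rewrite in_itv/=; apply/andP; split; lra.
  by rewrite ger0_norm; lra.
exists th, B, b, (1 + K1 + K2 + K3); split; first by split => //; lra.
split; first by split.
by split => // t; [have := hK2 t|have := hK1 t|have := hK3 t]; lra.
Qed.

End profile_functions.

(** * Almost everywhere inequalities and limits of integrals against products *)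

Section box_criteria.
Context {R : realType} {n : nat}.
Local Notation mu := (@lebesgue_row R n).
Implicit Types (f g : 'rV[R]_n -> R) (P Q : 'I_n -> R) (e : R) (Omega : set 'rV[R]_n).

Definition box P Q : set 'rV[R]_n := cube (fun j => `](P j), (Q j)]%classic).
Definition cbox P Q : set 'rV[R]_n := cube (fun j => `[(P j), (Q j)]%classic).

Lemma measurable_box P Q : measurable (box P Q).
Proof. by apply: measurable_cube => j; exact: measurable_itv. Qed.

Lemma measurable_cbox P Q : measurable (cbox P Q).
Proof. by apply: measurable_cube => j; exact: measurable_itv. Qed.

Lemma integrable_patch D f : measurable D -> mu.-integrable D (EFin \o f) ->
  mu.-integrable setT (EFin \o (f \_ D)).
Proof. by move=> mD; rewrite -restrict_EFin; exact: (integrable_mkcond _ mD).1. Qed.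

(** A rational box meets [ratbox p q] in the box whose corners are the maxima and minima of the
    given ones, or not at all; so it suffices to test boxes inside [ratbox p q]. *)
Lemma ae_ge0_on_ratbox (p q : {ffun 'I_n -> rat}) f :
  mu.-integrable (ratbox p q) (EFin \o f) ->
  (forall P Q, (forall j, ratr (p j) <= P j) -> (forall j, P j < Q j) ->
     (forall j, Q j <= ratr (q j)) -> 0 <= \int[mu]_(x in box P Q) f x) ->
  {ae mu, forall x, ratbox p q x -> 0 <= f x}.
Proof.
move=> intf f0; have mpq := @measurable_ratbox R n p q.
have intfp := integrable_patch mpq intf.
have : {ae mu, forall x, 0 <= (f \_ (ratbox p q)) x}.
  apply: ae_ge0_of_rat_box => // p' q'; rewrite -Rintegral_mkcondr.
  pose P j : R := Num.max (ratr (p j)) (ratr (p' j)).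
  pose Q j : R := Num.min (ratr (q j)) (ratr (q' j)).
  have -> : cube (fun j => `](ratr (p' j)), (ratr (q' j))]%classic) `&` ratbox p q = box P Q.
    apply/seteqP; split => x /=.
      move=> [h1 h2] j; have := h1 j; have := h2 j.
      by rewrite /= !in_itv/= gt_max le_min => /andP[-> ->] /andP[-> ->].
    move=> h; split => j; have := h j; rewrite /= !in_itv/= gt_max le_min.
      by move=> /andP[/andP[_ ->] /andP[_ ->]].
    by move=> /andP[/andP[-> _] /andP[-> _]].
  have [/forallP PQ|] := boolP [forall j, P j < Q j].
    by apply: f0 => // j; rewrite ?le_max ?ge_min lexx.
  rewrite negb_forall => /existsP[j]; rewrite -leNgt => QP.
  rewrite (_ : box P Q = set0) ?Rintegral_set0//.
  apply/seteqP; split => // x /(_ j); rewrite /= in_itv/= => /andP[a b].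
  by have := lt_le_trans a b; rewrite ltNge QP.
move=> h; apply: (ae_imp h) => x hx xpq; move: hx.
by rewrite /patch mem_set.
Qed.

Lemma ae_ge0_of_boxes Omega f : open Omega -> loc_integrable Omega f ->
  (forall P Q e, 0 < e -> (forall j, P j < Q j) ->
     cbox (fun j => P j - e) (fun j => Q j + e) `<=` Omega ->
     0 <= \int[mu]_(x in box P Q) f x) ->
  {ae mu, forall x, Omega x -> 0 <= f x}.
Proof.
move=> oO locf f0; apply: ae_inner_ratbox => // p q pqO.
have [e e0 eO] := pqO; apply: ae_ge0_on_ratbox.
  apply: (@integrableS _ _ _ _ (cbox (fun j => ratr (p j)) (fun j => ratr (q j)))).
  - exact: measurable_cbox.
  - exact: measurable_ratbox.
  - by move=> x h j; have := h j; rewrite /= !in_itv/= => /andP[/ltW -> ->].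
  - apply: locf; first exact: compact_cube.
    move=> x h; apply: eO => j; have := h j; rewrite /= !in_itv/= => /andP[a b].
    by apply/andP; split; lra.
move=> P Q pP PQ Qq; apply: (f0 P Q e) => // x h; apply: eO => j.
have := h j; have := pP j; have := Qq j; rewrite /= !in_itv/= => a b /andP[c d].
by apply/andP; split; lra.
Qed.

Lemma norm_tensor_le (F : 'I_n -> R -> R) (M : 'I_n -> R) x :
  (forall j t, `|F j t| <= M j) -> `|tensor F x| <= \prod_j M j.
Proof.
move=> FM; rewrite /tensor normr_prod; apply: ler_prod => j _.
by rewrite normr_ge0 FM.
Qed.

Lemma tensor_dominated_cvg g (F_ : nat -> 'I_n -> R -> R) (F : 'I_n -> R -> R)
    (K : R) : mu.-integrable setT (EFin \o g) ->
  (forall k j, measurable_fun setT (F_ k j)) ->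
  (forall j, measurable_fun setT (F j)) ->
  (forall k j t, `|F_ k j t| <= K) ->
  {ae mu, forall x : 'rV[R]_n, forall j,
    F_ k j (x ord0 j) @[k --> \oo] --> F j (x ord0 j)} ->
  \int[mu]_x (g x * tensor (F_ k) x) @[k --> \oo] --> \int[mu]_x (g x * tensor F x).
Proof.
move=> intg mF_ mF FK FF.
have mg : measurable_fun setT g by apply/measurable_EFinP; exact: measurable_int intg.
suff [_ cv] : mu.-integrable setT (EFin \o (fun x => g x * tensor F x)) /\
  \int[mu]_x (g x * tensor (F_ k) x) @[k --> \oo] --> \int[mu]_x (g x * tensor F x).
  exact: cv.
apply: (Rintegral_dominated_cvg (g := fun x => `|g x| * (\prod_(j < n) K))) => //.
- by move=> k; apply: measurable_funM => //; exact: measurable_tensor.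
- by apply: measurable_funM => //; exact: measurable_tensor.
- apply: (ae_imp FF) => x h _; apply: cvgM; first exact: cvg_cst.
  apply: (@cvg_big _ _ _ _ xpredT); first exact: mul_continuous.
  by move=> j _; exact: h.
- rewrite (_ : EFin \o _ = (fun x => (`|g x|)%:E * (\prod_(j < n) K)%:E)%E)//.
  apply: integrableZr => //; exact: (integrable_abse intg).
- apply/nearW => x _ k; rewrite normrM ler_wpM2l//.
  exact: norm_tensor_le.
Qed.

Lemma patch_tensor Omega P Q f (F : 'I_n -> R -> R) x :
  (forall j t, F j t != 0 -> P j <= t <= Q j) -> cbox P Q `<=` Omega ->
  (f \_ Omega) x * tensor F x = (f \_ (cbox P Q)) x * tensor F x.
Proof.
move=> supp PQO; have [->|/(tensor_supp supp) PQx] := eqVneq (tensor F x) 0.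
  by rewrite !mulr0.
by rewrite /patch !mem_set//; exact: PQO.
Qed.

End box_criteria.

(** * Uniqueness of weak derivatives *)

Section unique.
Context {R : realType} {n : nat}.
Local Notation mu := (@lebesgue_row R n).
Implicit Types (f g : 'rV[R]_n -> R) (P Q : 'I_n -> R) (e : R) (Omega : set 'rV[R]_n).

Lemma tensor_indic P Q (x : 'rV[R]_n) :
  tensor (fun j => \1_`](P j), (Q j)]%classic : R -> R) x = \1_(box P Q) x.
Proof.
rewrite /tensor indicE; case: (boolP (_ \in _)) => [/set_mem h|nh].
  by rewrite big1// => j _; rewrite indicE mem_set//; exact: h.
have [j nj] : exists j, ~ `](P j), (Q j)]%classic (x ord0 j).
  by apply: contrapT => /forallNP h; case/negP: nh; apply/mem_set => j; apply: contrapT.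
by rewrite (bigD1 j)//= indicE memNset// mul0r.
Qed.

Lemma Rintegral_tensor_indic P Q D f : box P Q `<=` D ->
  \int[mu]_x ((f \_ D) x * tensor (fun j => \1_`](P j), (Q j)]%classic : R -> R) x) =
  \int[mu]_(x in box P Q) f x.
Proof.
move=> PQD; rewrite [RHS]Rintegral_mkcond; apply: eq_Rintegral => x _.
rewrite tensor_indic indicE /patch; case: (boolP (x \in box P Q)) => xPQ.
  by rewrite mem_set ?mulr1//; apply: PQD; exact: set_mem.
by rewrite mulr0.
Qed.

Section step.
Variables (B : R -> R) (K : R).
Hypotheses (sB : smooth1 B) (B0 : forall t : R, t < 1 -> B t = 0)
  (B1 : forall t : R, 2 < t -> B t = 1) (BK : forall t, `|B t| <= K).

(** A smoothed indicator: it rises on [p + s, p + 2 s] and falls on [q + s, q + 2 s]. Since both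
    transitions lie to the right of the ends, the pointwise limit as s tends to 0 is exactly the
    indicator of ]p, q]. The arguments of [B] are expanded to fit [Cn_affine]. *)
Definition step (s p q t : R) := B (s^-1 * t + - (s^-1 * p)) - B (s^-1 * t + - (s^-1 * q)).

Lemma smooth1_step s p q : smooth1 (step s p q).
Proof.
move=> k; apply: CnD; first exact: Cn_affine.
rewrite (_ : (fun t => _) = (fun t => -1 * B (s^-1 * t + - (s^-1 * q)))).
  by apply: CnM; [exact: Cn_cst|exact: Cn_affine].
by apply/funext => t; rewrite mulN1r.
Qed.

Lemma step_supp s p q t : 0 < s -> p < q -> step s p q t != 0 -> p <= t <= q + 2 * s.
Proof.
move=> s0 pq; rewrite /step -!mulrBr => h.
have t1 (r : R) : t < r + s -> B (s^-1 * (t - r)) = 0.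
  by move=> tr; apply: B0; rewrite mulrC ltr_pdivrMr//; lra.
have t2 (r : R) : r + 2 * s < t -> B (s^-1 * (t - r)) = 1.
  by move=> tr; apply: B1; rewrite mulrC ltr_pdivlMr//; lra.
apply/andP; split; rewrite leNgt; apply/negP => tp; case/eqP: h.
  by rewrite !t1 ?subrr//; lra.
by rewrite !t2 ?subrr//; lra.
Qed.

Lemma step_bound s p q t : `|step s p q t| <= K + K.
Proof. by apply: (le_trans (ler_normB _ _)); exact: lerD. Qed.

Lemma step_cvg (s_ : nat -> R) p q t : (forall k, 0 < s_ k) ->
  s_ k @[k --> \oo] --> 0 -> p < q ->
  step (s_ k) p q t @[k --> \oo] --> (\1_`]p, q]%classic t : R).
Proof.
move=> s0 s_0 pq.
have h (r : R) : B ((s_ k)^-1 * t + - ((s_ k)^-1 * r)) @[k --> \oo] -->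
    (if r < t then 1 else 0 : R).
  apply: cvg_near_cst; case: ltP => tr.
    have d0 : 0 < (t - r) / 3 by rewrite divr_gt0// subr_gt0.
    near=> k; rewrite -mulrBr; apply: B1.
    rewrite mulrC ltr_pdivlMr//.
    have : s_ k < (t - r) / 3 by near: k; exact: (cvgr_lt 0).
    lra.
  near=> k; rewrite -mulrBr; apply: B0.
  by apply: (@le_lt_trans _ _ 0) => //; rewrite pmulr_rle0 ?invr_gt0// subr_le0.
have -> : (\1_`]p, q]%classic t : R) = (if p < t then 1 else 0) - (if q < t then 1 else 0).
  rewrite indicE; case: (boolP (_ \in _)) => [/set_mem|/negP ntpq].
    by rewrite /= in_itv/= => /andP[-> tq]; rewrite ltNge tq subr0.
  case: ifPn => pt; case: ifPn => qt; rewrite ?subrr ?subr0//.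
    by exfalso; apply: ntpq; apply/mem_set; rewrite /= in_itv/= pt leNgt.
  by move: (lt_trans pq qt); rewrite (negbTE pt).
by apply: cvgB; exact: h.
Unshelve. all: by end_near. Qed.

(** The supports of the steps overshoot the box by twice the width, here at most e, and so remain in
    the enlarged box; there [f] is integrable and the convergence is dominated. *)
Lemma box_approx Omega P Q e f : 0 < e -> (forall j, P j < Q j) ->
  cbox (fun j => P j - e) (fun j => Q j + e) `<=` Omega ->
  loc_integrable Omega f ->
  \int[mu]_x ((f \_ Omega) x *
     tensor (fun j => step (e / 2 / k.+1%:R) (P j) (Q j)) x) @[k --> \oo]
  --> \int[mu]_(x in box P Q) f x.
Proof.
move=> e0 PQ PQO locf; set C := cbox _ _ in PQO.
have intf : mu.-integrable setT (EFin \o (f \_ C)).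
  apply: integrable_patch; first exact: measurable_cbox.
  by apply: locf => //; exact: compact_cube.
have sk0 k : 0 < e / 2 / k.+1%:R by rewrite !divr_gt0.
have ske k : 2 * (e / 2 / k.+1%:R) <= e.
  rewrite mulrA [2 * _]mulrC divfK// ler_pdivrMr// ler_peMr//; first exact: ltW.
  by rewrite ler1n.
rewrite -(@Rintegral_tensor_indic _ _ C); last first.
  move=> x h j; have := h j; rewrite /= !in_itv/= => /andP[a b].
  by apply/andP; split; lra.
under eq_cvg => k.
  under eq_Rintegral => x _.
    rewrite (@patch_tensor _ _ _ (fun j => P j - e) (fun j => Q j + e))//; last first.
      move=> j t /(step_supp (sk0 k) (PQ j)) /andP[a b].
      move: (ske k) b; set s : R := _ / k.+1%:R; move: s => s hs b.
      by apply/andP; split; lra.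
  over.
over.
apply: (@tensor_dominated_cvg _ _ _ _ _ (K + K)) => //.
- by move=> k j; apply: continuous_measurable_fun; exact: (@smooth1_step _ _ _ 0%N).
- by move=> k j t; exact: step_bound.
- apply/nearW => x j; apply: step_cvg => //.
  have -> : (0 : R) = e / 2 * 0 by rewrite mulr0.
  by apply: cvgM; [exact: cvg_cst|exact: cvg_harmonic].
Qed.

End step.

Lemma loc_integrableB Omega f g : loc_integrable Omega f ->
  loc_integrable Omega g -> loc_integrable Omega (fun x => f x - g x).
Proof.
move=> hf hg K cK KO.
have mK : measurable K.
  by apply: closed_measurable_row; exact: compact_closed.
rewrite (_ : EFin \o _ = (fun x => (f x)%:E - (g x)%:E)%E)//.
by apply: integrableB; [|exact: hf|exact: hg].
Qed.

(** The fundamental lemma of the calculus of variations, with smoothed indicators of boxes as test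
    functions: in the limit [g] and [g'] have the same integral over every box inside [Omega]. *)
Lemma weak_derivative_unique Omega s f g g' : open Omega ->
  weak_derivative Omega s f g -> weak_derivative Omega s f g' ->
  {ae mu, forall x, Omega x -> g x = g' x}.
Proof.
move=> oO dg dg'.
have [th [B [b [K [[thB Bb sth _] [[_ _ B0 B1] [BK _ _ _]]]]]]] := @exists_profile R.
have sB := der_smooth1 thB sth.
have [_ lg _] := dg; have [_ lg' _] := dg'.
have E P Q e : 0 < e -> (forall j, P j < Q j) ->
     cbox (fun j => P j - e) (fun j => Q j + e) `<=` Omega ->
    \int[mu]_(x in box P Q) g x = \int[mu]_(x in box P Q) g' x.
  move=> e0 PQ PQO.
  have c1 := box_approx sB B0 B1 BK e0 PQ PQO lg.
  have c2 := box_approx sB B0 B1 BK e0 PQ PQO lg'.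
  apply: (cvg_unique _ c1); first exact: Rhausdorff.
  apply: cvg_trans c2; apply: near_eq_cvg; near=> k.
  apply/esym/(weak_derivative_unique_tensor _ _ _ dg dg').
  - by move=> j; exact: smooth1_step.
  - move=> j t; apply: (step_supp B0 B1 _ (PQ j)).
    by rewrite !divr_gt0.
  - move=> x h; apply: PQO => j; have := h j; rewrite /= !in_itv/= => /andP[a b'].
    apply/andP; split; first lra.
    apply: (le_trans b'); rewrite lerD2l mulrA [2 * _]mulrC divfK//.
    by rewrite ler_pdivrMr// ler_peMr ?ler1n// ltW.
have intbox (h : 'rV[R]_n -> R) P Q e : loc_integrable Omega h -> 0 < e ->
    cbox (fun j => P j - e) (fun j => Q j + e) `<=` Omega ->
    mu.-integrable (box P Q) (EFin \o h).
  move=> lh e0 PQO; apply: (@integrableS _ _ _ _ (cbox P Q)).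
  - exact: measurable_cbox.
  - exact: measurable_box.
  - by move=> x hx j; have := hx j; rewrite /= !in_itv/= => /andP[/ltW -> ->].
  - apply: lh; first exact: compact_cube.
    move=> x hx; apply: PQO => j; have := hx j; rewrite /= !in_itv/= => /andP[a b'].
    by apply/andP; split; lra.
have h1 : {ae mu, forall x, Omega x -> 0 <= g x - g' x}.
  apply: ae_ge0_of_boxes => //; first exact: loc_integrableB.
  move=> P Q e e0 PQ PQO; rewrite RintegralB ?(E _ _ e)// ?subrr//.
  - exact: measurable_box.
  - exact: intbox PQO.
  - exact: intbox PQO.
have h2 : {ae mu, forall x, Omega x -> 0 <= g' x - g x}.
  apply: ae_ge0_of_boxes => //; first exact: loc_integrableB.
  move=> P Q e e0 PQ PQO; rewrite RintegralB ?(E _ _ e)// ?subrr//.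
  - exact: measurable_box.
  - exact: intbox PQO.
  - exact: intbox PQO.
apply: (ae_imp2 h1 h2) => x a c Ox; have := a Ox; have := c Ox.
by rewrite !subr_ge0 => *; apply/eqP; rewrite eq_le; apply/andP.
Unshelve. all: by end_near. Qed.

End unique.

(** * Square integrable functions *)

Section square_integrable.
Context {d : measure_display} {T : measurableType d} {R : realType}.
Variable mu : {measure set T -> \bar R}.
Implicit Types f g : T -> R.

Definition sqi f := measurable_fun setT f /\
  mu.-integrable setT (EFin \o (fun x => f x ^+ 2)).

Definition norm2 f : R := Num.sqrt (\int[mu]_x (f x ^+ 2)).

Lemma norm2_ge0 f : 0 <= norm2 f.
Proof. exact: sqrtr_ge0. Qed.

Lemma norm2_sqr f : norm2 f ^+ 2 = \int[mu]_x (f x ^+ 2).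
Proof. by rewrite sqr_sqrtr// Rintegral_ge0// => x _; exact: sqr_ge0. Qed.

Lemma sqi_le f g : measurable_fun setT f -> (forall x, `|f x| <= g x) -> sqi g ->
  sqi f /\ norm2 f <= norm2 g.
Proof.
move=> mf fg [mg ig]; have fg2 x : f x ^+ 2 <= g x ^+ 2.
  by rewrite -[f x ^+ 2]real_normK ?num_real// lerXn2r// ?nnegrE// (le_trans _ (fg x)).
have if2 : mu.-integrable setT (EFin \o (fun x => f x ^+ 2)).
  apply: (le_integrable measurableT _ _ ig).
    by apply/measurable_EFinP; exact: measurable_funX.
  by move=> x _ /=; rewrite lee_fin !ger0_norm ?sqr_ge0.
split; first by split.
by rewrite ler_wsqrtr// le_Rintegral.
Qed.

Lemma sqi_integrableM f g : sqi f -> sqi g ->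
  mu.-integrable setT (EFin \o (fun x => f x * g x)).
Proof.
move=> [mf if2] [mg ig2].
have := integrableD measurableT if2 ig2.
apply: le_integrable => //.
  by apply/measurable_EFinP; exact: measurable_funM.
move=> x _ /=; rewrite lee_fin [X in _ <= X]ger0_norm ?addr_ge0 ?sqr_ge0//.
rewrite normrM -[f x ^+ 2]real_normK ?num_real// -[g x ^+ 2]real_normK ?num_real//.
have := sqr_ge0 (`|f x| - `|g x|); have := sqr_ge0 `|f x|; have := sqr_ge0 `|g x|.
nra.
Qed.

Lemma integrable_EFinZ (c : R) f : mu.-integrable setT (EFin \o f) ->
  mu.-integrable setT (EFin \o (fun x => c * f x)).
Proof.
move=> intf; rewrite (_ : EFin \o _ = (fun x => c%:E * (f x)%:E)%E)//.
exact: integrableZl.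
Qed.

Lemma integrable_EFinD f g : mu.-integrable setT (EFin \o f) ->
  mu.-integrable setT (EFin \o g) ->
  mu.-integrable setT (EFin \o (fun x => f x + g x)).
Proof.
move=> intf intg; rewrite (_ : EFin \o _ = (fun x => (f x)%:E + (g x)%:E)%E)//.
exact: integrableD.
Qed.

Lemma sqiN f : sqi f -> sqi (fun x => - f x).
Proof.
move=> [mf if2]; split; first exact: measurable_funN.
by under [X in EFin \o X]eq_fun do rewrite sqrrN.
Qed.

Lemma sqi_norm f : sqi f -> sqi (fun x => `|f x|).
Proof.
move=> [mf if2]; split; first exact: measurableT_comp.
by under [X in EFin \o X]eq_fun do rewrite real_normK ?num_real//.
Qed.

Lemma norm2_norm f : norm2 (fun x => `|f x|) = norm2 f.
Proof.
by congr Num.sqrt; apply: eq_Rintegral => x _; rewrite real_normK ?num_real.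
Qed.

Lemma Rintegral_sqrD f g (c : R) : sqi f -> sqi g ->
  mu.-integrable setT (EFin \o (fun x => (f x + c * g x) ^+ 2)) /\
  \int[mu]_x ((f x + c * g x) ^+ 2) =
  norm2 f ^+ 2 + 2 * c * \int[mu]_x (f x * g x) + c ^+ 2 * norm2 g ^+ 2.
Proof.
move=> sf sg; have ifg := sqi_integrableM sf sg; have [mf if2] := sf; have [mg ig2] := sg.
have E : (fun x => (f x + c * g x) ^+ 2) =
    (fun x => (f x ^+ 2 + 2 * c * (f x * g x)) + c ^+ 2 * g x ^+ 2).
  by apply/funext => x; ring.
have i1 := integrable_EFinZ (2 * c) ifg.
have i2 := integrable_EFinZ (c ^+ 2) ig2.
have i3 := integrable_EFinD if2 i1.
rewrite E; split; first exact: integrable_EFinD.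
by rewrite !norm2_sqr RintegralD// RintegralD// !RintegralZl.
Qed.

(** The integral of (f + c g)^2 is a quadratic polynomial in c without negative values. *)
Lemma cauchy_schwarz f g : sqi f -> sqi g ->
  \int[mu]_x (f x * g x) <= norm2 f * norm2 g.
Proof.
move=> sf sg; have Q c : 0 <= norm2 f ^+ 2 + 2 * c * \int[mu]_x (f x * g x)
    + c ^+ 2 * norm2 g ^+ 2.
  have [_ <-] := Rintegral_sqrD c sf sg.
  by apply: Rintegral_ge0 => x _; exact: sqr_ge0.
set a := norm2 f in Q *; set b := norm2 g in Q *; set i := \int[mu]_x _ in Q *.
have a0 : 0 <= a := norm2_ge0 f; have b0 : 0 <= b := norm2_ge0 g.
have [bp|bn] := ltP 0 b; last first.
  have {bn b0}b0 : b = 0 by apply/eqP; rewrite eq_le bn b0.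
  rewrite b0 mulr0 leNgt; apply/negP => i0.
  (* With a vanishing quadratic coefficient the polynomial is affine in c; this c gives it the value
     -1. *)
  have := Q (- ((a ^+ 2 + 1) / (2 * i))); rewrite b0 expr0n/= mulr0 addr0.
  rewrite (_ : _ + _ = -1); first lra.
  by field; rewrite gt_eqF.
rewrite leNgt; apply/negP => iab.
(* The minimiser of the polynomial. *)
have := Q (- (i / b ^+ 2)); rewrite leNgt => /negP; apply.
rewrite (_ : _ + _ = (a ^+ 2 * b ^+ 2 - i ^+ 2) / b ^+ 2); last first.
  by field; rewrite gt_eqF.
rewrite pmulr_llt0 ?invr_gt0 ?exprn_gt0// subr_lt0 -exprMn.
by rewrite ltr_pXn2r// ?nnegrE ?mulr_ge0//; apply: ltW; apply: le_lt_trans iab; exact: mulr_ge0.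
Qed.

Lemma cauchy_schwarz_norm f g : sqi f -> sqi g ->
  \int[mu]_x `|f x * g x| <= norm2 f * norm2 g.
Proof.
move=> sf sg; rewrite -(norm2_norm f) -(norm2_norm g).
under eq_Rintegral do rewrite normrM.
by apply: cauchy_schwarz; exact: sqi_norm.
Qed.

Lemma norm_Rintegral_le f g : sqi f -> sqi g ->
  `|\int[mu]_x (f x * g x)| <= norm2 f * norm2 g.
Proof.
move=> sf sg; apply: le_trans (cauchy_schwarz_norm sf sg).
by apply: le_normr_Rintegral => //; exact: sqi_integrableM.
Qed.

Lemma sqiD f g : sqi f -> sqi g -> sqi (fun x => f x + g x).
Proof.
move=> sf sg; split; first by apply: measurable_funD; [case: sf|case: sg].
have [+ _] := Rintegral_sqrD 1 sf sg.
by under [X in EFin \o X]eq_fun do rewrite mul1r.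
Qed.

Lemma sqiB f g : sqi f -> sqi g -> sqi (fun x => f x - g x).
Proof. by move=> sf /sqiN sg; exact: sqiD. Qed.

Lemma norm2D f g : sqi f -> sqi g -> norm2 (fun x => f x + g x) <= norm2 f + norm2 g.
Proof.
move=> sf sg.
rewrite -(@ler_pXn2r _ 2%N)// ?nnegrE ?addr_ge0 ?norm2_ge0// norm2_sqr.
have [_] := Rintegral_sqrD 1 sf sg.
under eq_Rintegral do rewrite mul1r.
by move=> ->; have := cauchy_schwarz sf sg; nra.
Qed.

Lemma norm2N f : norm2 (fun x => - f x) = norm2 f.
Proof. by congr Num.sqrt; apply: eq_Rintegral => x _; rewrite sqrrN. Qed.

Lemma sqi_indic (M : R) (C : set T) (f : T -> R) : measurable C -> (mu C < +oo)%E ->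
  measurable_fun setT f -> (forall x, `|f x| <= M * \1_C x) ->
  sqi f /\ norm2 f <= M * Num.sqrt (fine (mu C)).
Proof.
move=> mC Cfin mf fM.
have [M0|M0] := ltP M 0.
  have C0 : C = set0.
    apply/seteqP; split => // x Cx; have := fM x; rewrite indicE mem_set// mulr1.
    by rewrite leNgt (lt_le_trans M0).
  have f0 : f = cst 0.
    by apply/funext => x; have := fM x; rewrite C0 indic0 mulr0 normr_le0 => /eqP.
  rewrite f0 C0 measure0 sqrtr0 mulr0; split.
    split; first exact: measurable_cst.
    by rewrite (_ : EFin \o _ = cst 0%E) ?integrable0//; apply/funext => x /=; rewrite expr0n.
  by rewrite /norm2 /Rintegral integral0_eq ?sqrtr0// => x _; rewrite expr0n.
have i1 : mu.-integrable setT (EFin \o (\1_C : T -> R)).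
  apply/integrableP; split; first exact/measurable_EFinP/measurable_indic.
  rewrite (eq_integral (fun x => (\1_C x)%:E)%E).
    by rewrite integral_indic// setIT.
  by move=> x _ /=; rewrite ger0_norm.
have E : (fun x => (M * \1_C x) ^+ 2) = (fun x => M ^+ 2 * (\1_C x : R)).
  by apply/funext => x; rewrite exprMn indicE; case: (_ \in _); rewrite /= ?expr1n ?expr0n.
have sM : sqi (fun x => M * \1_C x).
  split; first by apply: measurable_funM => //; exact: measurable_indic.
  by rewrite E; exact: integrable_EFinZ.
have [sf le] := sqi_le mf fM sM; split => //; apply: (le_trans le).
rewrite /norm2 E RintegralZl// sqrtrM ?sqr_ge0// sqrtr_sqr ger0_norm//.
by rewrite /Rintegral integral_indic// setIT.
Qed.

Lemma sqi_integrable_on (C : set T) f : measurable C -> (mu C < +oo)%E -> sqi f ->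
  mu.-integrable C (EFin \o f).
Proof.
move=> mC Cfin sf; apply/(integrable_mkcond _ mC).
have m1 : measurable_fun setT (\1_C : T -> R) by exact: measurable_indic.
have h1 x : `|\1_C x : R| <= 1 * \1_C x by rewrite mul1r ger0_norm.
have [s1 _] := sqi_indic mC Cfin m1 h1.
have := sqi_integrableM sf s1; apply: eq_integrable => // x _ /=.
by rewrite /patch indicE; case: ifP => _; rewrite /= ?mulr1 ?mulr0.
Qed.

Lemma sqi_ae f g : measurable_fun setT f -> {ae mu, forall x, f x = g x} -> sqi g ->
  sqi f /\ norm2 f = norm2 g.
Proof.
move=> mf fg [mg ig].
have mf2 : measurable_fun setT (EFin \o (fun x => f x ^+ 2)).
  by apply/measurable_EFinP; exact: measurable_funX.
have ae2 : ae_eq mu setT (EFin \o (fun x => g x ^+ 2)) (EFin \o (fun x => f x ^+ 2)).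
  by apply: (ae_imp fg) => x fgx _ /=; rewrite fgx.
split; last first.
  congr Num.sqrt; congr fine; apply/esym/ae_eq_integral => //.
  exact: measurable_int ig.
split => //; apply/integrableP; split => //.
case/integrableP : ig => mg2; apply: le_lt_trans; rewrite le_eqVlt; apply/orP; left.
apply/eqP/ae_eq_integral => //; [exact: measurableT_comp|exact: measurableT_comp|].
by apply: (ae_imp fg) => x fgx _ /=; rewrite fgx.
Qed.

Lemma Lnorm2E f : sqi f -> 'N[mu]_2%:E[EFin \o f]%E = (norm2 f)%:E.
Proof.
move=> [mf if2]; rewrite unlock /Lnorm.
have -> : (\int[mu]_x `|(EFin \o f) x| `^ 2 = (\int[mu]_x (f x ^+ 2))%:E)%E.
  rewrite /Rintegral fineK; last exact: integrable_fin_num.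
  by apply: eq_integral => x _ /=; rewrite powR_mulrn// real_normK ?num_real.
by rewrite poweR_EFin powR12_sqrt// Rintegral_ge0// => x _; exact: sqr_ge0.
Qed.

Lemma Lfun2P f : f \in Lfun mu 2%:E -> sqi f.
Proof.
move=> /andP[]; rewrite inE /= => mf; rewrite inE /= /finite_norm unlock /Lnorm => h.
split => //; apply/integrableP; split.
  by apply/measurable_EFinP; exact: measurable_funX.
move: h; rewrite (eq_integral (fun x => `|(f x ^+ 2)%:E|%E)).
  by apply: lty_poweRy; rewrite invr_eq0.
by move=> x _ /=; rewrite powR_mulrn// real_normK ?num_real// ger0_norm ?sqr_ge0.
Qed.

End square_integrable.

(** * Interpolation on cones *)

Section kernels.
Context {R : realType}.
Local Notation leb := (@lebesgue_measure R).
Variables (th B b : R -> R) (K : R).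
Hypotheses (thB : der th B) (Bb : der B b) (sth : smooth1 th) (K1 : 1 <= K).
Hypotheses (th0 : forall t : R, t <= 1 -> th t = 0) (th1 : forall t : R, 2 <= t -> th t = t).
Hypotheses (B0 : forall t : R, t < 1 -> B t = 0) (B1 : forall t : R, 2 < t -> B t = 1).
Hypotheses (BK : forall t : R, `|B t| <= K) (b_supp : forall t : R, b t != 0 -> 1 <= t <= 2).
Hypotheses (bK : forall t : R, `|b t| <= K).
Hypotheses (thK : forall t : R, `|th t - Num.max t 0| <= K).
Implicit Types s x t p q : R.

Let sB : smooth1 B := der_smooth1 thB sth.
Let sb : smooth1 b := der_smooth1 Bb sB.

(* The profile 2 b(t) - b(t/2) / 2 has integral 1 and vanishing first moment, so
   that the difference of the kernels at the scales s and s / 2 is the second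
   derivative of a compactly supported function, here called [potential]. *)
Definition kernel s x t := `|s|^-1 *
  (2 * b (s^-1 * t + - (s^-1 * x)) + - 2^-1 * b ((2 * s)^-1 * t + - ((2 * s)^-1 * x))).

Definition potential s x t := `|s| * (3 * th (s^-1 * t + - (s^-1 * x)) +
  (- 2 * th ((2 * s)^-1 * t + - ((2 * s)^-1 * x)) +
   -1 * th ((s / 2)^-1 * t + - ((s / 2)^-1 * x)))).

Lemma smooth1_kernel s x : smooth1 (kernel s x).
Proof.
move=> k; apply: CnM; first exact: Cn_cst.
by apply: CnD; (apply: CnM; [exact: Cn_cst|exact: Cn_affine]).
Qed.

Lemma smooth1_potential s x : smooth1 (potential s x).
Proof.
move=> k; apply: CnM; first exact: Cn_cst.
by apply: CnD; [|apply: CnD]; (apply: CnM; [exact: Cn_cst|exact: Cn_affine]).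
Qed.

Lemma derZ (c : R) f g : der f g -> der (fun t => c * f t) (fun t => c * g t).
Proof.
move=> fg t; apply: (is_derive_eq (derM (der_cst c) fg t)).
by rewrite mulr0 addr0.
Qed.

Lemma der_eq (f g h : R -> R) : der f g -> (forall t, g t = h t) -> der f h.
Proof. by move=> fg gh; rewrite (_ : h = g)//; apply/funext. Qed.

(** With u = (t - x) / s, the difference of the kernels is (3 b(u) - b(u / 2) / 2 - 4 b(2 u)) / |s|.
    Integrating each term twice, with [th] in place of [b], divides the coefficients by 1, 1 / 4 and
    4: this is the origin of 3, -2, -1 in [potential]. The scale s may be negative, hence the
    absolute values. *)
Lemma potential_der2 s x : s != 0 -> exists2 g, der (potential s x) g &
  der g (fun t => kernel s x t - kernel (s / 2) x t).
Proof.
move=> s0; eexists.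
  apply: derZ; apply: derD; first by apply: derZ; apply: der_affine; exact: thB.
  by apply: derD; apply: derZ; apply: der_affine; exact: thB.
apply: der_eq.
  apply: derZ; apply: derD; first by do 2!apply: derZ; apply: der_affine; exact: Bb.
  by apply: derD; (do 2!apply: derZ; apply: der_affine; exact: Bb).
move=> t /=; rewrite /kernel.
have e2 : 2 * (s / 2) = s by rewrite mulrC divfK.
rewrite e2; set u := b (_ * t + - _); set v := b _; set w := b _.
have e3 : (2 * s)^-1 = s^-1 / 2 by rewrite invfM mulrC.
have e4 : (s / 2)^-1 = 2 * s^-1 by rewrite invfM invrK mulrC.
have e5 : `|s / 2|^-1 = 2 * `|s|^-1.
  by rewrite normrM [ `|2^-1|]ger0_norm// invfM invrK mulrC.
have n2 : `|s| ^+ 2 = s ^+ 2 by rewrite real_normK ?num_real.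
have ss : `|s|^-1 = `|s| * (s^-1 * s^-1).
  by rewrite -invfM -expr2 -n2 expr2 invfM mulrA mulfV ?normr_eq0// mul1r.
by rewrite e3 e4 e5 ss; field.
Qed.

Lemma kernel_supp s x t : kernel s x t != 0 -> 1 <= s^-1 * t - s^-1 * x <= 4.
Proof.
rewrite /kernel invfM -!mulrA -!mulrBr; set u := s^-1 * (t - x) => h.
have [bu|/b_supp /andP[u1 u2]] := eqVneq (b u) 0; last by apply/andP; split; lra.
have [bu2|/b_supp /andP[u1 u2]] := eqVneq (b (2^-1 * u)) 0; last by apply/andP; split; lra.
by move: h; rewrite bu bu2 !mulr0 addr0 mulr0 eqxx.
Qed.

Lemma potential_supp s x t : potential s x t != 0 -> 1 / 2 <= s^-1 * t - s^-1 * x <= 4.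
Proof.
rewrite /potential !invfM invrK -!mulrA ![_ * (2 * _)]mulrCA -!mulrBr.
set u := s^-1 * (t - x) => h.
apply/andP; split; rewrite leNgt; apply/negP => hu; case/eqP: h.
  by rewrite !th0 ?mulr0 ?addr0 ?mulr0//; lra.
(* Beyond 4 all three arguments exceed 2, where [th] is the identity, and 3 u - 2 (u / 2) - 2 u =
   0. *)
by rewrite !th1; [field|lra..].
Qed.

Lemma kernel_bound s x t : `|kernel s x t| <= 6 * K * `|s|^-1.
Proof.
rewrite /kernel normrM normfV normr_id mulrC ler_wpM2r ?invr_ge0//.
set u := b _; set v := b _.
have : `|u| <= K by exact: bK.
have : `|v| <= K by exact: bK.
by rewrite !ler_norml => /andP[? ?] /andP[? ?]; apply/andP; split; lra.
Qed.

(** The combination of the three terms vanishes identically when [th] is replaced by max(., 0), by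
    homogeneity. Only the three errors remain, with total weight 3 + 2 + 1. *)
Lemma potential_bound s x t : `|potential s x t| <= 6 * K * `|s|.
Proof.
rewrite /potential normrM normr_id mulrC ler_wpM2r//.
rewrite !invfM invrK -!mulrA ![_ * (2 * _)]mulrCA -!mulrBr.
set u := s^-1 * (t - x).
have := thK u; have := thK (2^-1 * u); have := thK (2 * u).
have [u0|u0] := leP 0 u.
  have -> : Num.max (2^-1 * u) 0 = 2^-1 * u by apply: max_l; lra.
  have -> : Num.max (2 * u) 0 = 2 * u by apply: max_l; lra.
  rewrite !ler_norml => /andP[? ?] /andP[? ?] /andP[? ?].
  by apply/andP; split; lra.
have -> : Num.max (2^-1 * u) 0 = 0 by apply: max_r; lra.
have -> : Num.max (2 * u) 0 = 0 by apply: max_r; lra.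
rewrite !ler_norml => /andP[? ?] /andP[? ?] /andP[? ?].
by apply/andP; split; lra.
Qed.

(** Up to the sign of s, a primitive of the kernel in t and, since only t - x matters, the opposite
    of a primitive in x. *)
Definition prim s x t :=
  2 * B (s^-1 * t + - (s^-1 * x)) + -1 * B ((2 * s)^-1 * t + - ((2 * s)^-1 * x)).

Definition window s p q t := Num.sg s * (prim s p t - prim s q t).

Lemma kernel_continuous s t : continuous (fun x => kernel s x t).
Proof.
rewrite (_ : (fun x => _) = (fun x => `|s|^-1 *
  (2 * b (- s^-1 * x + s^-1 * t) + - 2^-1 * b (- (2 * s)^-1 * x + (2 * s)^-1 * t)))).
  apply: (CnM (k := 0) (Cn_cst 0 _)).
  by apply: (CnD (k := 0)); (apply: (CnM (k := 0) (Cn_cst 0 _)); exact: (Cn_affine (k := 0))).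
by apply/funext => x; rewrite /kernel !mulNr ![- (_ * x) + _]addrC.
Qed.

Lemma integral_kernel s p q t : s != 0 -> p < q ->
  \int[leb]_(x in `]p, q]) kernel s x t = window s p q t.
Proof.
move=> s0 pq.
have ck := @kernel_continuous s t.
have ik : leb.-integrable `[p, q] (EFin \o (fun x => kernel s x t)).
  apply: continuous_compact_integrable; first exact: segment_compact.
  exact: continuous_subspaceT.
rewrite Rintegral_itv_obnd_cbnd; last first.
  by apply: integrableS ik => //; apply: subset_itvr; rewrite bnd_simp.
pose G x := - Num.sg s * prim s x t.
have dG : der G (fun x => kernel s x t).
  rewrite /G (_ : (fun x => _) = (fun x => - Num.sg s *
    (2 * B (- s^-1 * x + s^-1 * t) + -1 * B (- (2 * s)^-1 * x + (2 * s)^-1 * t)))).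
    apply: der_eq.
      apply: derZ; apply: derD; (apply: derZ; apply: der_affine; exact: Bb).
    move=> x /=; rewrite /kernel !mulNr ![- _ + _]addrC.
    set u := b (s^-1 * t - _); set v := b _.
    have -> : `|s|^-1 = Num.sg s * s^-1.
      by rewrite normrEsg invfM; congr (_ * _); rewrite invr_sg.
    by rewrite invfM; field.
  by apply/funext => x; rewrite /prim !mulNr ![- (_ * x) + _]addrC.
have := @continuous_FTC2 R (fun x => kernel s x t) G p q pq (continuous_subspaceT ck).
rewrite /Rintegral => -> /=.
- by rewrite /G /window; ring.
- split.
  + by move=> x _; case: (dG x).
  + by apply: cvg_at_right_filter; exact: der_continuous dG p.
  + by apply: cvg_at_left_filter; exact: der_continuous dG q.
- by move=> x _; rewrite derive1E; case: (dG x).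
Qed.

Lemma window_bound s p q t : `|window s p q t| <= 6 * K.
Proof.
rewrite /window normrM; apply: (@le_trans _ _ (1 * `|prim s p t - prim s q t|)).
  by apply: ler_wpM2r => //; rewrite normr_sg; case: (s != 0).
rewrite mul1r /prim.
set u := B _; set v := B _; set w := B _; set z := B _.
have : `|u| <= K by exact: BK.
have : `|v| <= K by exact: BK.
have : `|w| <= K by exact: BK.
have : `|z| <= K by exact: BK.
by rewrite !ler_norml => /andP[? ?] /andP[? ?] /andP[? ?] /andP[? ?]; apply/andP; split; lra.
Qed.

(** At small scales [prim] tends to 2 - 1 = 1 if t lies beyond r in the direction of s, and to 0
    otherwise. The end points are excluded because a negative s would produce the indicator of [p,
    q[ instead. *)
Lemma window_cvg s p q t : s != 0 -> p < q -> t != p -> t != q ->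
  window (s / 2 ^+ k) p q t @[k --> \oo] --> (\1_`]p, q]%classic t : R).
Proof.
move=> s0 pq tp tq.
have h (r : R) : t != r -> prim (s / 2 ^+ k) r t @[k --> \oo] -->
    (if 0 < s^-1 * (t - r) then 1 else 0 : R).
  move=> tr; apply: cvg_near_cst.
  have u0 : s^-1 * (t - r) != 0 by rewrite mulf_neq0 ?invr_eq0// subr_eq0.
  have E k : prim (s / 2 ^+ k) r t = 2 * B (2 ^+ k * (s^-1 * (t - r))) -
      B (2^-1 * (2 ^+ k * (s^-1 * (t - r)))).
    rewrite /prim !invfM invrK mulN1r; congr (2 * B _ - B _); ring.
  case: ltP => u.
    near=> k; rewrite E !B1; first by lra.
    + have : 4 / (s^-1 * (t - r)) < 2 ^+ k.
        apply: (@lt_trans _ _ k%:R); last by rewrite -natrX ltr_nat ltn_expl.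
        by near: k; exact: nbhs_infty_gtr.
      rewrite ltr_pdivrMr//; lra.
    + have : 4 / (s^-1 * (t - r)) < 2 ^+ k.
        apply: (@lt_trans _ _ k%:R); last by rewrite -natrX ltr_nat ltn_expl.
        by near: k; exact: nbhs_infty_gtr.
      rewrite ltr_pdivrMr//; lra.
  near=> k; have : 2 ^+ k * (s^-1 * (t - r)) <= 0 by rewrite pmulr_rle0 ?exprn_gt0.
  by rewrite E => v; rewrite !B0 ?mulr0 ?subr0//; lra.
have -> : (\1_`]p, q]%classic t : R) = Num.sg s *
    ((if 0 < s^-1 * (t - p) then 1 else 0) - (if 0 < s^-1 * (t - q) then 1 else 0)).
  rewrite indicE; have [sn|sp|] := ltgtP s 0; last by move/eqP; rewrite (negbTE s0).
    rewrite ltr0_sg// !nmulr_rgt0 ?invr_lt0// !subr_lt0.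
    case: (boolP (_ \in _)) => [/set_mem|/negP ntpq].
      rewrite /= in_itv/= => /andP[pt tq']; rewrite ltNge ltW//= lt_neqAle tq tq'/=; ring.
    case: ifPn => pt; case: ifPn => qt; rewrite ?subrr ?mulr0 ?sub0r ?mulrNN ?mulr1//.
      by move: (lt_trans pt pq); rewrite (negbTE qt).
    by exfalso; apply: ntpq; apply/mem_set; rewrite /= in_itv/= (ltW qt) andbT lt_neqAle eq_sym tp leNgt.
  rewrite gtr0_sg// !pmulr_rgt0 ?invr_gt0// !subr_gt0 mul1r.
  case: (boolP (_ \in _)) => [/set_mem|/negP ntpq].
    by rewrite /= in_itv/= => /andP[-> tq']; rewrite ltNge tq' subr0.
  case: ifPn => pt; case: ifPn => qt; rewrite ?subrr ?subr0//.
    by exfalso; apply: ntpq; apply/mem_set; rewrite /= in_itv/= pt leNgt.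
  by move: (lt_trans pq qt); rewrite (negbTE pt).
have sgE k : Num.sg (s / 2 ^+ k) = Num.sg s.
  by rewrite sgrM sgrV (@gtr0_sg _ (2 ^+ k))// ?mulr1// exprn_gt0.
rewrite /window; under eq_cvg do rewrite sgE.
by apply: cvgM; [exact: cvg_cst|apply: cvgB; exact: h].
Unshelve. all: by end_near. Qed.

End kernels.

Section fubini_real.
Context d1 d2 (T1 : measurableType d1) (T2 : measurableType d2) (R : realType).
Variables (m1 : {sigma_finite_measure set T1 -> \bar R})
  (m2 : {sigma_finite_measure set T2 -> \bar R}).

Lemma Rintegral_fubini (H : T1 * T2 -> R) :
  (m1 \x m2)%E.-integrable setT (EFin \o H) ->
  \int[m1]_x \int[m2]_y H (x, y) = \int[m2]_y \int[m1]_x H (x, y).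
Proof.
move=> intH.
have [_ e1] := integrable_fine (integrable_fubini_F intH).
have mH := measurable_int _ intH.
have intS : (m2 \x m1)%E.-integrable setT (EFin \o (H \o unstable.swap)).
  have h := (integrable21ltyP m1 m2 mH).1 intH; apply/integrable12ltyP; last exact: h.
  exact: (measurableT_comp mH (@measurable_swap _ _ T2 T1)).
have [_ e2] := integrable_fine (integrable_fubini_F intS).
rewrite [LHS]e1 [RHS]e2; congr fine.
by rewrite fubini1// -fubini2.
Qed.

End fubini_real.

Section integrable_extra.
Context d (T : measurableType d) (R : realType) (mu : {measure set T -> \bar R}).

Lemma integrable_cst_on (D : set T) (c : R) : measurable D -> (mu D < +oo)%E ->
  mu.-integrable D (EFin \o (fun=> c)).
Proof.
move=> mD Dfin; apply/integrableP; split; first exact/measurable_EFinP/measurable_cst.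
rewrite (eq_integral (cst `|c|%:E))// integral_cst// lte_mul_pinfty// lee_fin.
Qed.

Lemma integrable_restrictT (D : set T) (f : T -> R) : measurable D ->
  mu.-integrable D (EFin \o f) -> mu.-integrable setT (EFin \o (f \_ D)).
Proof. by move=> mD; rewrite -restrict_EFin; exact: (integrable_mkcond _ mD).1. Qed.

End integrable_extra.

Section hyperplanes.
Context {R : realType}.

(** Makes the exceptional end points of [window_cvg] negligible in every coordinate at once. *)
Lemma ae_coordinates_neq n (c : 'I_n -> R) :
  {ae @lebesgue_row R n, forall x : 'rV[R]_n, forall j, x ord0 j != c j}.
Proof.
elim: n c => [|n IH] c; first by apply/nearW => x [].
apply: ae_rowS.
  rewrite (_ : (fun x => _) = cube (fun j => ~` [set c j])).
    by apply: measurable_cube => j; apply: measurableC; exact: measurable_set1.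
  by apply/seteqP; split => x /= h j; have := h j => /eqP.
have h0 : {ae @lebesgue_measure R, forall t : R, t != c ord0}.
  exists [set c ord0]; split; [exact: measurable_set1|exact: lebesgue_measure_set1|].
  by move=> t /= /negP; rewrite negbK => /eqP.
apply: (ae_imp h0) => t tc; apply: (ae_imp (IH (fun j => c (lift ord0 j)))) => y yc j.
by case: (unliftP ord0 j) => [i ->|->]; rewrite ?row_cons_lift ?row_cons0.
Qed.

End hyperplanes.

(** * Averages at dyadic scales and the interpolation inequality for a fixed cone *)

Section agmon.
Context {R : realType} {n : nat}.
Local Notation mu := (@lebesgue_row R n).
Variables (th B b : R -> R) (K : R).
Hypotheses (thB : der th B) (Bb : der B b) (sth : smooth1 th) (K1 : 1 <= K).
Hypotheses (th0 : forall t : R, t <= 1 -> th t = 0) (th1 : forall t : R, 2 <= t -> th t = t).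
Hypotheses (B0 : forall t : R, t < 1 -> B t = 0) (B1 : forall t : R, 2 < t -> B t = 1).
Hypotheses (BK : forall t : R, `|B t| <= K) (b_supp : forall t : R, b t != 0 -> 1 <= t <= 2).
Hypotheses (bK : forall t : R, `|b t| <= K).
Hypotheses (thK : forall t : R, `|th t - Num.max t 0| <= K).

Let K0 : 0 <= K := le_trans ler01 K1.
Let K12 : 6 * K <= 12 * K.
Proof. by rewrite ler_wpM2r// ler_nat. Qed.

Local Notation kappa := (kernel b).
Local Notation zeta := (potential th).
Local Notation window := (window B).

Lemma slabP (s x t : R) : s != 0 -> 1 / 2 <= s^-1 * t - s^-1 * x <= 4 <->
  x + Num.min (s / 2) (4 * s) <= t <= x + Num.max (s / 2) (4 * s).
Proof.
rewrite -mulrBr => s0; have [sn|sp|] := ltgtP s 0; last by move/eqP; rewrite (negbTE s0).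
- rewrite ler_ndivlMl// ler_ndivrMl// min_r ?max_l; [|lra..].
  by split => /andP[? ?]; apply/andP; split; lra.
- rewrite ler_pdivlMl// ler_pdivrMl// min_l ?max_r; [|lra..].
  by split => /andP[? ?]; apply/andP; split; lra.
Qed.

Lemma slab_norm (s x t : R) : s != 0 -> 1 / 2 <= s^-1 * t - s^-1 * x <= 4 ->
  x - 4 * `|s| <= t <= x + 4 * `|s|.
Proof.
move=> s0 /(slabP _ _ s0); have [sn|sp|] := ltgtP s 0; last by move/eqP; rewrite (negbTE s0).
- by rewrite ltr0_norm// min_r ?max_l; [|lra..] => /andP[? ?]; apply/andP; split; lra.
- by rewrite gtr0_norm// min_l ?max_r; [|lra..] => /andP[? ?]; apply/andP; split; lra.
Qed.

Lemma measurable_smooth1 (f : R -> R) : smooth1 f -> measurable_fun setT f.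
Proof. by move=> sf; apply: continuous_measurable_fun; exact: (sf 0%N). Qed.

Lemma sqi_supported_tensor (F : 'I_n -> R -> R) (M s : 'I_n -> R) (x : 'rV[R]_n) :
  (forall j, smooth1 (F j)) -> (forall j t, `|F j t| <= M j) ->
  (forall j t, F j t != 0 -> x ord0 j - 4 * `|s j| <= t <= x ord0 j + 4 * `|s j|) ->
  sqi mu (tensor F) /\
  norm2 mu (tensor F) <= \prod_j M j * Num.sqrt (\prod_j (8 * `|s j|)).
Proof.
move=> sF FM supp.
set C := cbox (fun j => x ord0 j - 4 * `|s j|) (fun j => x ord0 j + 4 * `|s j|).
have mC : measurable C by exact: measurable_cbox.
have muC : mu C = (\prod_j (8 * `|s j|))%:E.
  apply: lebesgue_row_cube; first by move=> j; exact: measurable_itv.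
  move=> j; rewrite lebesgue_measure_itv/= lte_fin.
  have := normr_ge0 (s j); case: ltP => h s0.
    by rewrite -EFinD; congr _%:E; ring.
  by congr _%:E; lra.
have FC y : `|tensor F y| <= \prod_j M j * \1_C y.
  have [->|/(tensor_supp supp) yC] := eqVneq (tensor F y) 0.
    rewrite normr0 mulr_ge0// prodr_ge0// => j _.
    exact: le_trans (FM j 0).
  by rewrite indicE mem_set// mulr1; exact: norm_tensor_le.
have mF : measurable_fun setT (tensor F).
  by apply: measurable_tensor => j; exact: measurable_smooth1.
have finC : (mu C < +oo)%E by rewrite muC ltry.
have [h1 h2] := sqi_indic mC finC mF FC; split => //; apply: (le_trans h2).
by have -> : \prod_j (8 * `|s j|) = fine (mu C) by rewrite muC.
Qed.

Variables (Omega V : set 'rV[R]_n) (lam : 'I_n -> R).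
Hypothesis lam0 : forall j, lam j != 0.
(** For fixed rho these y form a box that contains the supports of all products of kernels and
    potentials at the scales [rho * lam j], which are therefore admissible in test functions on
    [Omega]. *)
Hypothesis cone : forall x, V x -> forall rho : R, 0 < rho <= 1 -> forall y : 'rV[R]_n,
  (forall j, 1 / 2 <= (rho * lam j)^-1 * y ord0 j - (rho * lam j)^-1 * x ord0 j <= 4) ->
  Omega y.
Variables (f : 'rV[R]_n -> R) (g : 'I_n -> 'rV[R]_n -> R).
Hypothesis intf : mu.-integrable setT (EFin \o (f \_ Omega)).
Hypothesis sf : sqi mu (f \_ Omega).
Hypothesis sg : forall m, sqi mu (g m \_ Omega).
Hypothesis fg : forall m, weak_derivative Omega [:: m; m] f (g m).

(** The maximum of a product of kernels times the square root of the volume of its support, once the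
    factor rho^(- n / 2) is taken out; see [agmon_cstE]. *)
Definition agmon_cst : R := (12 * K) ^+ n * Num.sqrt (8 ^+ n) /
  Num.sqrt (\prod_j `|lam j|).

Lemma prod_lam_gt0 : 0 < \prod_j `|lam j|.
Proof. by apply: prodr_gt0 => j _; rewrite normr_gt0. Qed.

Lemma agmon_cst_ge0 : 0 <= agmon_cst.
Proof.
by rewrite /agmon_cst divr_ge0 ?mulr_ge0 ?sqrtr_ge0 ?exprn_ge0// mulr_ge0.
Qed.

Lemma agmon_cstE rho : 0 < rho ->
  \prod_j (12 * K * `|rho * lam j|^-1) * Num.sqrt (\prod_j (8 * `|rho * lam j|)) =
  agmon_cst / Num.sqrt (rho ^+ n).
Proof.
move=> r0; have L0 := prod_lam_gt0.
have -> : \prod_j (12 * K * `|rho * lam j|^-1) =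
    (12 * K) ^+ n * (rho ^+ n)^-1 * (\prod_j `|lam j|)^-1.
  rewrite big_split/= prodr_const card_ord -prodfV -mulrA; congr (_ * _).
  under eq_bigr do rewrite normrM gtr0_norm// invfM.
  by rewrite big_split/= prodr_const card_ord exprVn.
have -> : \prod_j (8 * `|rho * lam j|) = 8 ^+ n * (rho ^+ n * \prod_j `|lam j|).
  under eq_bigr do rewrite normrM gtr0_norm//.
  by rewrite !big_split/= !prodr_const card_ord.
set L := \prod_j _ in L0 *; have rn0 : 0 < rho ^+ n by rewrite exprn_gt0.
rewrite !sqrtrM ?exprn_ge0 ?ltW//.
have e1 : (rho ^+ n)^-1 = (Num.sqrt (rho ^+ n))^-1 * (Num.sqrt (rho ^+ n))^-1.
  by rewrite -invfM -expr2 sqr_sqrtr// ltW.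
have e2 : L^-1 = (Num.sqrt L)^-1 * (Num.sqrt L)^-1.
  by rewrite -invfM -expr2 sqr_sqrtr// ltW.
rewrite e1 e2 /agmon_cst -/L; field.
by rewrite !gt_eqF ?sqrtr_gt0.
Qed.

Definition kernels rho (x : 'rV[R]_n) : 'I_n -> R -> R :=
  fun j => kappa (rho * lam j) (x ord0 j).

Definition average rho x := \int[mu]_y ((f \_ Omega) y * tensor (kernels rho x) y).

Lemma rho_lam_neq0 rho j : 0 < rho -> rho * lam j != 0.
Proof. by move=> r0; rewrite mulf_neq0// gt_eqF. Qed.

Lemma kernels_slab rho x j t : 0 < rho -> kernels rho x j t != 0 ->
  1 / 2 <= (rho * lam j)^-1 * t - (rho * lam j)^-1 * x ord0 j <= 4.
Proof. by move=> r0 /(kernel_supp b_supp) /andP[? ?]; apply/andP; split; lra. Qed.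

Lemma kernels_half_slab rho x j t : 0 < rho -> kernels (rho / 2) x j t != 0 ->
  1 / 2 <= (rho * lam j)^-1 * t - (rho * lam j)^-1 * x ord0 j <= 4.
Proof.
move=> r0 /(kernel_supp b_supp); rewrite mulrAC invfM invrK -!mulrA ![_ * (2 * _)]mulrCA.
by rewrite -!mulrBr => /andP[? ?]; apply/andP; split; lra.
Qed.

Lemma smooth1_kernels rho x j : smooth1 (kernels rho x j).
Proof. exact: (smooth1_kernel thB Bb sth). Qed.

Lemma kernels_bound rho x j t : `|kernels rho x j t| <= 12 * K * `|rho * lam j|^-1.
Proof.
apply: (le_trans (kernel_bound bK _ _ _)); by rewrite ler_wpM2r ?invr_ge0.
Qed.

Lemma kernels_half_bound rho x j t : `|kernels (rho / 2) x j t| <= 12 * K * `|rho * lam j|^-1.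
Proof.
apply: (le_trans (kernel_bound bK _ _ _)); rewrite [rho / 2 * _]mulrAC [ `|_ / 2|]normrM invfM.
rewrite [ `|2^-1|]ger0_norm// invrK le_eqVlt; apply/orP; left; apply/eqP; ring.
Qed.

Lemma average_bound rho x : 0 < rho ->
  `|average rho x| <= agmon_cst / Num.sqrt (rho ^+ n) * norm2 mu (f \_ Omega).
Proof.
move=> r0.
have [sk le] := @sqi_supported_tensor (kernels rho x) (fun j => 12 * K * `|rho * lam j|^-1)
  (fun j => rho * lam j) x (smooth1_kernels rho x) (kernels_bound rho x)
  (fun j t h => slab_norm (rho_lam_neq0 j r0) (kernels_slab r0 h)).
apply: (le_trans (norm_Rintegral_le sf sk)); rewrite mulrC ler_wpM2r ?norm2_ge0//.
by rewrite -agmon_cstE.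
Qed.

(** The products at the scales rho and rho / 2 differ in every coordinate. Changing one coordinate
    at a time makes each difference a second derivative in a single direction, so that only the
    derivatives [[:: m; m]] are ever needed. *)
Definition hybrid rho x (m : nat) : 'I_n -> R -> R :=
  fun j => if (j < m)%N then kernels (rho / 2) x j else kernels rho x j.

Lemma smooth1_hybrid rho x m j : smooth1 (hybrid rho x m j).
Proof. by rewrite /hybrid; case: ifP => _; exact: smooth1_kernels. Qed.

Lemma hybrid_bound rho x m j t : `|hybrid rho x m j t| <= 12 * K * `|rho * lam j|^-1.
Proof. by rewrite /hybrid; case: ifP => _; rewrite (kernels_bound, kernels_half_bound). Qed.

Lemma hybrid_slab rho x m j t : 0 < rho -> hybrid rho x m j t != 0 ->
  1 / 2 <= (rho * lam j)^-1 * t - (rho * lam j)^-1 * x ord0 j <= 4.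
Proof.
by move=> r0; rewrite /hybrid; case: ifP => _; [exact: kernels_half_slab|exact: kernels_slab].
Qed.

(** The two products differ by the second derivative, in direction m, of the product [z] that has
    the potential in coordinate m. Both derivatives are moved onto [f], and the Cauchy-Schwarz
    inequality applies. *)
Lemma hybrid_step rho x (m : 'I_n) : V x -> 0 < rho <= 1 ->
  `|\int[mu]_y ((f \_ Omega) y * tensor (hybrid rho x m.+1) y) -
    \int[mu]_y ((f \_ Omega) y * tensor (hybrid rho x m) y)| <=
  agmon_cst / Num.sqrt (rho ^+ n) * ((rho * lam m) ^+ 2 * norm2 mu (g m \_ Omega)).
Proof.
move=> Vx /andP[r0 r1]; set s := rho * lam m.
have s0 : s != 0 by exact: rho_lam_neq0.
pose z := upd (hybrid rho x m) m (zeta s (x ord0 m)).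
have sz j : smooth1 (z j).
  rewrite /z /upd; case: eqP => _; last exact: smooth1_hybrid.
  exact: (smooth1_potential sth).
have zslab j t : z j t != 0 ->
    1 / 2 <= (rho * lam j)^-1 * t - (rho * lam j)^-1 * x ord0 j <= 4.
  rewrite /z /upd; have [->|_] := eqVneq j m; last exact: hybrid_slab.
  exact: (potential_supp th0 th1).
(* The potential is larger than a kernel by a factor s^2; this is the origin of rho^2 in front of
   the second derivatives. *)
have zbound j t : `|z j t| <= 12 * K * `|rho * lam j|^-1 * (if j == m then s ^+ 2 else 1).
  rewrite /z /upd; have [->|_] := eqVneq j m; last by rewrite mulr1; exact: hybrid_bound.
  apply: (le_trans (potential_bound thK _ _ _)); rewrite -/s.
  have n0 : `|s| != 0 by rewrite normr_eq0.
  have -> : s ^+ 2 = `|s| * `|s| by rewrite -expr2 real_normK ?num_real.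
  by rewrite mulrA divfK// ler_wpM2r.
have [szt le] := @sqi_supported_tensor z _ (fun j => rho * lam j) x sz zbound
  (fun j t h => slab_norm (rho_lam_neq0 j r0) (zslab j t h)).
have [sh _] := @sqi_supported_tensor (hybrid rho x m) _ (fun j => rho * lam j) x
  (smooth1_hybrid rho x m) (hybrid_bound rho x m)
  (fun j t h => slab_norm (rho_lam_neq0 j r0) (hybrid_slab r0 h)).
have [sh' _] := @sqi_supported_tensor (hybrid rho x m.+1) _ (fun j => rho * lam j) x
  (smooth1_hybrid rho x m.+1) (hybrid_bound rho x m.+1)
  (fun j t h => slab_norm (rho_lam_neq0 j r0) (hybrid_slab r0 h)).
rewrite distrC -RintegralB//; [|exact: sqi_integrableM..].
have [z1 dz1 dz2] := potential_der2 thB Bb (x ord0 m) s0.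
have E y : (f \_ Omega) y * tensor (hybrid rho x m) y -
    (f \_ Omega) y * tensor (hybrid rho x m.+1) y =
    (f \_ Omega) y *
       tensor (upd z m (fun t => kappa s (x ord0 m) t - kappa (s / 2) (x ord0 m) t)) y.
  rewrite -mulrBr; congr (_ * _).
  rewrite -(upd_id (hybrid rho x m.+1) m) -{1}(upd_id (hybrid rho x m) m).
  rewrite !tensor_upd /hybrid ltnSn ltnn /kernels [rho / 2 * _]mulrAC -/s.
  rewrite mulrBl; congr (_ * _ - _ * _); apply: eq_bigr => j jm.
    by rewrite /z /upd (negbTE jm).
  by rewrite /z /upd (negbTE jm) /hybrid ltnS leq_eqVlt (inj_eq val_inj) (negbTE jm).
rewrite (eq_Rintegral _ (fun y _ => E y)).
rewrite (@weak_derivative2_tensor _ _ Omega (fun j => x ord0 j +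
    Num.min (rho * lam j / 2) (4 * (rho * lam j))) (fun j => x ord0 j +
    Num.max (rho * lam j / 2) (4 * (rho * lam j))) z sz _ _ m _ _ _ _ (fg m) _ dz2);
  last 3 first.
- by move=> j t /zslab /(slabP _ _ (rho_lam_neq0 j r0)).
- move=> y hy; apply: (cone Vx (rho := rho)); first by rewrite r0.
  by move=> j; apply/(slabP _ _ (rho_lam_neq0 j r0)); have := hy j; rewrite /= in_itv.
- by rewrite /z /upd eqxx.
apply: (le_trans (norm_Rintegral_le (sg m) szt)).
rewrite mulrC mulrA ler_wpM2r ?norm2_ge0//; apply: (le_trans le).
rewrite big_split/= mulrAC agmon_cstE//.
rewrite (bigD1 m)//= eqxx big1 ?mulr1// => j /negbTE ->.
by [].
Qed.

Lemma average_half rho x : V x -> 0 < rho <= 1 ->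
  `|average (rho / 2) x - average rho x| <=
  agmon_cst / Num.sqrt (rho ^+ n) * rho ^+ 2 *
    \sum_m (lam m ^+ 2 * norm2 mu (g m \_ Omega)).
Proof.
move=> Vx r01.
pose I (m : nat) := \int[mu]_y ((f \_ Omega) y * tensor (hybrid rho x m) y).
have -> : average (rho / 2) x = I n.
  by apply: eq_Rintegral => y _; congr (_ * tensor _ _); apply/funext => j; rewrite /hybrid ltn_ord.
have -> : average rho x = I 0%N.
  by apply: eq_Rintegral => y _; congr (_ * tensor _ _); apply/funext => j; rewrite /hybrid ltn0.
rewrite -(telescope_sumr I (leq0n n)) big_mkord.
apply: (le_trans (ler_norm_sum _ _ _)); rewrite mulr_sumr; apply: ler_sum => m _.
apply: (le_trans (hybrid_step m Vx r01)).
by rewrite exprMn -!mulrA.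
Qed.

Hypothesis n3 : (n <= 3)%N.

(** The exact ratio is 2^(n / 2) / 4. For n <= 3 it is at most 3 / 4, since 8 <= 9, and the dyadic
    steps sum to a geometric series; for n = 4 it would be 1. *)
Lemma scale_half (rho : R) : 0 < rho ->
  (rho / 2) ^+ 2 / Num.sqrt ((rho / 2) ^+ n) <= 3 / 4 * (rho ^+ 2 / Num.sqrt (rho ^+ n)).
Proof.
move=> r0; rewrite expr_div_n [in X in Num.sqrt X]expr_div_n.
have rn0 : 0 <= rho ^+ n by rewrite exprn_ge0// ltW.
rewrite [Num.sqrt (_ / _)]sqrtrM// sqrtrV ?exprn_ge0//.
have s3 : Num.sqrt (2 ^+ n : R) <= 3.
  rewrite -[leRHS]ger0_norm// -sqrtr_sqr ler_wsqrtr//.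
  apply: (@le_trans _ _ (2 ^+ 3)); first by rewrite ler_weXn2l// ler1n.
  by rewrite -!natrX ler_nat.
rewrite invf_div.
have -> : rho ^+ 2 / 2 ^+ 2 * (Num.sqrt (2 ^+ n) / Num.sqrt (rho ^+ n)) =
  Num.sqrt (2 ^+ n) / 4 * (rho ^+ 2 / Num.sqrt (rho ^+ n)).
  by rewrite (_ : 2 ^+ 2 = 4 :> R); [ring|rewrite -natrX].
apply: ler_wpM2r; last by lra.
by rewrite divr_ge0 ?sqrtr_ge0 ?sqr_ge0.
Qed.

Lemma scale_dyadic (rho : R) k : 0 < rho ->
  (rho / 2 ^+ k) ^+ 2 / Num.sqrt ((rho / 2 ^+ k) ^+ n) <=
  (3 / 4) ^+ k * (rho ^+ 2 / Num.sqrt (rho ^+ n)).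
Proof.
move=> r0; elim: k => [|k IH]; first by rewrite expr0 divr1 mul1r.
have e : rho / 2 ^+ k.+1 = rho / 2 ^+ k / 2 by rewrite exprSr invfM mulrA.
rewrite e; apply: (le_trans (scale_half _)); first by rewrite divr_gt0// exprn_gt0.
have -> : (3 / 4) ^+ k.+1 * (rho ^+ 2 / Num.sqrt (rho ^+ n)) =
    3 / 4 * ((3 / 4) ^+ k * (rho ^+ 2 / Num.sqrt (rho ^+ n))).
  by rewrite exprS mulrA.
by rewrite ler_wpM2l//; lra.
Qed.

Local Notation D2 := (\sum_m (lam m ^+ 2 * norm2 mu (g m \_ Omega))).

Let D2_ge0 : 0 <= D2.
Proof. by apply: sumr_ge0 => m _; rewrite mulr_ge0 ?sqr_ge0 ?norm2_ge0. Qed.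

(** The factor 4 is the sum of the powers of 3 / 4. *)
Definition agmon_bound rho := agmon_cst / Num.sqrt (rho ^+ n) *
  (norm2 mu (f \_ Omega) + 4 * rho ^+ 2 * D2).

Lemma average_dyadic rho x k : V x -> 0 < rho <= 1 ->
  `|average (rho / 2 ^+ k) x| <= agmon_bound rho.
Proof.
move=> Vx /andP[r0 r1].
(* Strengthened with the partial sum of the geometric series, so that induction on k goes
   through. *)
suff H : `|average (rho / 2 ^+ k) x| <=
    agmon_cst / Num.sqrt (rho ^+ n) * norm2 mu (f \_ Omega) +
    agmon_cst * (4 * (1 - (3 / 4) ^+ k)) * (rho ^+ 2 / Num.sqrt (rho ^+ n)) * D2.
  apply: (le_trans H); rewrite /agmon_bound [X in _ <= X]mulrDr lerD2l.
  have -> : agmon_cst / Num.sqrt (rho ^+ n) * (4 * rho ^+ 2 * D2) =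
    agmon_cst * (4 * 1) * (rho ^+ 2 / Num.sqrt (rho ^+ n)) * D2 by ring.
  apply: ler_wpM2r => //; apply: ler_wpM2r.
    by rewrite divr_ge0 ?sqrtr_ge0 ?sqr_ge0.
  apply: ler_wpM2l; first exact: agmon_cst_ge0.
  by rewrite ler_wpM2l// lerBlDr lerDl exprn_ge0//; lra.
elim: k => [|k IH].
  rewrite !expr0 divr1 subrr !mulr0 !mul0r addr0.
  exact: average_bound.
have rk0 : 0 < rho / 2 ^+ k by rewrite divr_gt0// exprn_gt0.
have rk1 : rho / 2 ^+ k <= 1.
  rewrite ler_pdivrMr ?exprn_gt0// mul1r (le_trans r1)//.
  by rewrite exprn_ege1// ler1n.
have e : rho / 2 ^+ k.+1 = rho / 2 ^+ k / 2 by rewrite exprSr invfM mulrA.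
have st := average_half Vx (_ : 0 < rho / 2 ^+ k <= 1).
have {}st := st ltac:(by rewrite rk0 rk1).
have tri : `|average (rho / 2 ^+ k.+1) x| <= `|average (rho / 2 ^+ k) x| +
    `|average (rho / 2 ^+ k / 2) x - average (rho / 2 ^+ k) x|.
  by rewrite e -{1}(subrK (average (rho / 2 ^+ k) x) (average (rho / 2 ^+ k / 2) x))
    addrC ler_normD.
apply: (le_trans tri); apply: (le_trans (lerD IH st)); rewrite -addrA lerD2l.
have := scale_dyadic k r0.
set c := rho ^+ 2 / _; set q := (3 / 4) ^+ k => sc.
rewrite [(3 / 4) ^+ k.+1]exprS -/q.
have -> : agmon_cst / Num.sqrt ((rho / 2 ^+ k) ^+ n) * (rho / 2 ^+ k) ^+ 2 * D2 =
  agmon_cst * ((rho / 2 ^+ k) ^+ 2 / Num.sqrt ((rho / 2 ^+ k) ^+ n)) * D2 by ring.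
apply: (@le_trans _ _ (agmon_cst * (4 * (1 - q)) * c * D2 + agmon_cst * (q * c) * D2)).
  by rewrite lerD2l ler_wpM2r// ler_wpM2l ?agmon_cst_ge0.
by rewrite le_eqVlt; apply/orP; left; apply/eqP; field.
Qed.

Lemma kernels_joint_measurable rho (j : 'I_n) :
  measurable_fun setT (fun z : 'rV[R]_n * 'rV[R]_n =>
    kappa (rho * lam j) (z.1 ord0 j) (z.2 ord0 j)).
Proof.
have mb : measurable_fun setT b.
  exact: measurable_smooth1 (der_smooth1 Bb (der_smooth1 thB sth)).
have m1 : measurable_fun setT (fun z : 'rV[R]_n * 'rV[R]_n => z.1 ord0 j).
  exact: (measurableT_comp (measurable_coor j) measurable_fst).
have m2 : measurable_fun setT (fun z : 'rV[R]_n * 'rV[R]_n => z.2 ord0 j).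
  exact: (measurableT_comp (measurable_coor j) measurable_snd).
rewrite /kernel; apply: measurable_funM => //.
by apply: measurable_funD; (apply: measurable_funM => //;
  apply: measurableT_comp => //; apply: measurable_funD;
  [exact: measurable_funM|apply: measurable_funN; exact: measurable_funM]).
Qed.

(** After exchanging the integrals the vertex x runs over the box, and in each coordinate the kernel
    integrates to a window. *)
Lemma integral_average rho (P Q : 'I_n -> R) : 0 < rho -> (forall j, P j < Q j) ->
  \int[mu]_(x in box P Q) average rho x =
  \int[mu]_y ((f \_ Omega) y *
    tensor (fun j => window (rho * lam j) (P j) (Q j)) y).
Proof.
move=> r0 PQ; have mbox := measurable_box P Q.
pose M : R := \prod_(j < n) (12 * K * `|rho * lam j|^-1).
pose H (z : 'rV[R]_n * 'rV[R]_n) := \1_(box P Q) z.1 *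
  ((f \_ Omega) z.2 * tensor (kernels rho z.1) z.2).
have mf : measurable_fun setT (f \_ Omega) by case: sf.
have mH : measurable_fun setT H.
  apply: measurable_funM.
    by apply: (measurableT_comp (f := (\1_(box P Q) : 'rV[R]_n -> R))).
  apply: measurable_funM; first exact: (measurableT_comp mf measurable_snd).
  apply: measurable_prod => j _; exact: kernels_joint_measurable.
have M0 : 0 <= M.
  by apply: prodr_ge0 => j _; rewrite !mulr_ge0// invr_ge0.
have mubox : mu (box P Q) = (\prod_j (Q j - P j))%:E.
  apply: lebesgue_row_cube; first by move=> j; exact: measurable_itv.
  by move=> j; rewrite lebesgue_measure_itv/= lte_fin PQ.
have Hle z : `|H z| <= \1_(box P Q) z.1 * (`|(f \_ Omega) z.2| * M).
  rewrite /H !normrM ger0_norm// ler_wpM2l// ler_wpM2l//.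
  by apply: norm_tensor_le => j t; exact: kernels_bound.
have intH : (mu \x mu)%E.-integrable setT (EFin \o H).
  apply/integrable12ltyP; first exact/measurable_EFinP.
  set c := (\int[mu]_y `|((f \_ Omega) y)%:E|)%E.
  have cfin : c \is a fin_num.
    by rewrite ge0_fin_numE ?integral_ge0//; case/integrableP : intf.
  apply: (@le_lt_trans _ _ (\int[mu]_x ((\1_(box P Q) x)%:E * (c * M%:E)))%E).
    apply: ge0_le_integral => //.
    - by move=> x _; exact: integral_ge0.
    - apply: (@measurable_fun_fubini_tonelli_F _ _ _ _ _ _ (abse \o (EFin \o H))) => [|z]; last exact: abse_ge0.
      by apply: measurableT_comp => //; exact/measurable_EFinP.
    - by apply: emeasurable_funM => //; exact/measurable_EFinP.
    move=> x _; rewrite /c -ge0_integralZr//; last first.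
      by apply: measurableT_comp => //; exact/measurable_EFinP.
    rewrite -ge0_integralZl//.
    + apply: ge0_le_integral => //.
      * apply: measurableT_comp => //; apply/measurable_EFinP.
        exact: (measurable_fun_pair2 x mH).
      * apply: measurable_funeM; apply: emeasurable_funM => //.
        by apply: measurableT_comp => //; exact/measurable_EFinP.
      * by move=> y _; rewrite /= -!EFinM lee_fin; exact: (Hle (x, y)).
    + apply: emeasurable_funM => //.
      by apply: measurableT_comp => //; exact/measurable_EFinP.
    + by move=> y _; rewrite mule_ge0.
  have cM0 : (0 <= c * M%:E)%E by rewrite mule_ge0// integral_ge0.
  rewrite ge0_integralZr//; last exact/measurable_EFinP.
  rewrite integral_indic// setIT [X in (X * _)%E]mubox -(fineK cfin) -!EFinM.
  exact: ltry.
transitivity (\int[mu]_x \int[mu]_y H (x, y)).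
  rewrite Rintegral_mkcond; apply: eq_Rintegral => x _.
  rewrite /patch /H /= indicE; case: ifPn => xPQ.
    by rewrite /average; under [RHS]eq_Rintegral do rewrite mul1r.
  rewrite /Rintegral integral0_eq// => y _.
  by rewrite mul0r.
rewrite (Rintegral_fubini intH); apply: eq_Rintegral => y _.
rewrite /H /=.
pose F j t : R := ((fun t => kappa (rho * lam j) t (y ord0 j)) \_ `](P j), (Q j)]) t.
have iF j : (@lebesgue_measure R).-integrable setT (EFin \o F j).
  apply: (@integrable_restrictT _ _ _ (@lebesgue_measure R)).
    exact: measurable_itv.
  have ik : (@lebesgue_measure R).-integrable `[(P j), (Q j)]
      (EFin \o (fun t => kappa (rho * lam j) t (y ord0 j))).
    apply: continuous_compact_integrable; first exact: segment_compact.
    apply: continuous_subspaceT => t.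
    exact: (kernel_continuous thB Bb sth).
  apply: integrableS ik; [exact: measurable_itv|exact: measurable_itv|].
  by apply: subset_itvr; rewrite bnd_simp.
have [iT IT] := Rintegral_tensor iF.
transitivity (\int[mu]_x ((f \_ Omega) y * tensor F x)).
  apply: eq_Rintegral => x _; rewrite mulrCA; congr (_ * _).
  rewrite indicE /tensor; case: (boolP (_ \in _)) => [/set_mem h|nh].
    rewrite mul1r; apply: eq_bigr => j _; rewrite /F /patch mem_set//.
  rewrite mul0r; have [j nj] : exists j, ~ `](P j), (Q j)]%classic (x ord0 j).
    apply: contrapT => /forallNP h; case/negP: nh; apply/mem_set => j.
    exact: contrapT.
  by rewrite (bigD1 j)//= /F /patch memNset// mul0r.
rewrite RintegralZl// IT; congr (_ * _); apply: eq_bigr => j _.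
rewrite /F -Rintegral_mkcond; apply: (integral_kernel thB Bb sth) => //.
exact: rho_lam_neq0.
Qed.

Hypotheses (oV : open V) (VO : V `<=` Omega) (mO : measurable Omega)
  (muO : (mu Omega < +oo)%E).

Let intfO : mu.-integrable Omega (EFin \o f).
Proof. by apply/(integrable_mkcond _ mO); rewrite restrict_EFin. Qed.

Lemma measurable_window (s p q : R) : measurable_fun setT (window s p q).
Proof.
have mB : measurable_fun setT B by exact: measurable_smooth1 (der_smooth1 thB sth).
have h (c d : R) : measurable_fun setT (fun t : R => B (c * t + d)).
  by apply: measurableT_comp => //; apply: measurable_funD => //; exact: measurable_funM.
by apply: measurable_funM => //; apply: measurable_funB;
  apply: measurable_funD; exact: measurable_funM.
Qed.

(** Convergence of the averages at individual points is avoided: their integrals over a box converge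
    by dominated convergence of the windows to the indicator, and the bound, uniform in k, passes to
    the limit. *)
Lemma box_average_bound rho (P Q : 'I_n -> R) : 0 < rho <= 1 ->
  (forall j, P j < Q j) -> box P Q `<=` V ->
  `|\int[mu]_(x in box P Q) f x| <= agmon_bound rho * fine (mu (box P Q)).
Proof.
move=> r01 PQ PQV; have /andP[r0 r1] := r01; have mbox := measurable_box P Q.
have mubox : (mu (box P Q) < +oo)%E.
  by apply: le_lt_trans muO; apply: le_measure; rewrite ?inE//; exact: subset_trans VO.
pose J k := \int[mu]_y ((f \_ Omega) y *
    tensor (fun j => window (rho / 2 ^+ k * lam j) (P j) (Q j)) y).
have J1 k : `|J k| <= agmon_bound rho * fine (mu (box P Q)).
  have rk0 : 0 < rho / 2 ^+ k by rewrite divr_gt0// exprn_gt0.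
  rewrite /J -integral_average// -Rintegral_cst//.
  apply: ae_le_normr_Rintegral => //.
    by apply: integrable_cst_on.
  by apply/nearW => x /PQV Vx; exact: average_dyadic.
have J2 : J k @[k --> \oo] --> \int[mu]_(x in box P Q) f x.
  rewrite -(@Rintegral_tensor_indic _ _ P Q Omega); last exact: subset_trans VO.
  apply: (@tensor_dominated_cvg _ _ _ _ _ (6 * K)) => //.
  - by move=> k j; exact: measurable_window.
  - by move=> k j t; exact: window_bound.
  - apply: (ae_imp2 (ae_coordinates_neq P) (ae_coordinates_neq Q)) => x xP xQ j.
    under eq_cvg do rewrite mulrAC.
    by apply: window_cvg => //; exact: rho_lam_neq0.
have J3 : `|J k| @[k --> \oo] --> `|\int[mu]_(x in box P Q) f x| by exact: cvg_norm.
apply: (ler_cvg_to J3 (cvg_cst _)); exact: nearW.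
Qed.

Lemma agmon_ae rho : 0 < rho <= 1 ->
  {ae mu, forall x, V x -> `|f x| <= agmon_bound rho}.
Proof.
move=> r01.
have icst (D : set 'rV[R]_n) : measurable D -> D `<=` Omega ->
    mu.-integrable D (EFin \o (fun=> agmon_bound rho)).
  move=> mD DO; apply: (@integrableS _ _ _ _ Omega) => //.
  exact: integrable_cst_on.
have ifD (D : set 'rV[R]_n) : measurable D -> D `<=` Omega ->
    mu.-integrable D (EFin \o f).
  by move=> mD DO; exact: integrableS intfO.
have mK (D : set 'rV[R]_n) : compact D -> measurable D.
  by move=> cD; apply: closed_measurable_row; exact: compact_closed.
have lcst : loc_integrable V (fun=> agmon_bound rho).
  by move=> D cD DV; apply: icst; [exact: mK|exact: subset_trans VO].
have lf : loc_integrable V f.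
  by move=> D cD DV; apply: ifD; [exact: mK|exact: subset_trans VO].
have sub (P Q : 'I_n -> R) (e : R) : 0 < e ->
    cbox (fun j => P j - e) (fun j => Q j + e) `<=` V -> box P Q `<=` V.
  move=> e0 h x hx; apply: h => j; have := hx j; rewrite /= !in_itv/= => /andP[a c].
  by apply/andP; split; lra.
have h1 : {ae mu, forall x, V x -> 0 <= agmon_bound rho - f x}.
  apply: ae_ge0_of_boxes => //; first exact: loc_integrableB.
  move=> P Q e e0 PQ /(sub _ _ _ e0) PQV; have PQO := subset_trans PQV VO.
  have mb := measurable_box P Q.
  rewrite RintegralB//; [|exact: icst|exact: ifD].
  by rewrite Rintegral_cst// subr_ge0 (le_trans (ler_norm _))// box_average_bound.
have h2 : {ae mu, forall x, V x -> 0 <= f x - - agmon_bound rho}.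
  apply: ae_ge0_of_boxes => //.
    apply: loc_integrableB => // D cD DV.
    rewrite (_ : EFin \o _ = (fun=> - (agmon_bound rho)%:E)%E)//.
    by apply: integrableN; exact: lcst.
  move=> P Q e e0 PQ /(sub _ _ _ e0) PQV; have PQO := subset_trans PQV VO.
  have mb := measurable_box P Q.
  rewrite RintegralB//; [|exact: ifD|].
    rewrite Rintegral_cst// mulNr opprK -lerBlDr sub0r.
    by have := box_average_bound r01 PQ PQV; rewrite ler_norml => /andP[].
  rewrite (_ : EFin \o _ = (fun=> - (agmon_bound rho)%:E)%E)//.
  by apply: integrableN; exact: icst.
apply: (ae_imp2 h1 h2) => x a c Vx; have := a Vx; have := c Vx.
by rewrite ler_norml => ? ?; apply/andP; split; lra.
Qed.

End agmon.

(** * The cone condition *)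

Section lipschitz.
Context {R : realType}.

Lemma is_derive_along n (F : 'rV[R]_n -> R) (x v : 'rV[R]_n) (t : R) :
  derivable F (t *: v + x) v ->
  is_derive t (1 : R) (fun h => F (h *: v + x)) ('D_v F (t *: v + x)).
Proof.
have E : (fun h : R => h^-1 *: (((fun h => F (h *: v + x)) \o shift t) (h *: (1 : R)) -
     F (t *: v + x))) =
   (fun h => h^-1 *: ((F \o shift (t *: v + x)) (h *: v) - F (t *: v + x))).
  by apply/funext => h /=; rewrite [h *: 1]mulr1 scalerDl addrA.
by move=> dF; apply: DeriveDef; rewrite /derivable /derive E.
Qed.

(** The two conditions on t describe the segment between 0 and a, whatever the sign of a. *)
Lemma mean_value_bound (f df : R -> R) (a L : R) :
  (forall t, is_derive t (1 : R) f (df t)) ->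
  (forall t, `|t| <= `|a| -> 0 <= t * a -> `|df t| <= L) ->
  `|f a - f 0| <= L * `|a|.
Proof.
move=> fd dfL.
have cf : continuous f.
  move=> t; apply: differentiable_continuous; apply/derivable1_diffP.
  by case: (fd t).
have [a0|a0] := leP 0 a.
- have [|c /[!in_itv]/= /andP[c0 ca] ->] := @MVT_segment R f df 0 a a0 (fun x _ => fd x).
  + exact: continuous_subspaceT.
  rewrite subr0 normrM ler_wpM2r//; apply: dfL; last exact: mulr_ge0.
  by rewrite !ger0_norm.
- have [|c /[!in_itv]/= /andP[ac c0] E] := @MVT_segment R f df a 0 (ltW a0) (fun x _ => fd x).
  + exact: continuous_subspaceT.
  rewrite distrC E sub0r normrM normrN ler_wpM2r//; apply: dfL.
    by rewrite !ler0_norm ?lerN2// ltW.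
  by rewrite mulr_le0// ltW.
Qed.

Lemma row_ballP n (x y : 'rV[R]_n) (r : R) :
  0 < r -> ball x r y <-> forall j, `|x ord0 j - y ord0 j| < r.
Proof.
move=> r0; split=> [[_ h] j|h]; first exact: (h ord0 j).
by split => // i j; rewrite (ord1 i); exact: h.
Qed.

(** The path from x to y changes one coordinate at a time. Balls are those of the maximum norm, so
    that the whole path stays inside. *)
Lemma lipschitz_of_partials n (g : 'rV[R]_n -> R) (z0 : 'rV[R]_n) (r L : R) : 0 < r ->
  (forall j x, derivable g x (delta_mx ord0 j)) ->
  (forall j x, ball z0 r x -> `|partial [:: j] g x| <= L) ->
  forall x y, ball z0 r x -> ball z0 r y ->
    `|g y - g x| <= L * \sum_j `|y ord0 j - x ord0 j|.
Proof.
move=> r0 dg gL x y /(row_ballP _ _ r0) xr /(row_ballP _ _ r0) yr.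
pose h k : 'rV[R]_n := \row_j (if (j < k)%N then y ord0 j else x ord0 j).
have h0 : h 0%N = x by apply/rowP => j; rewrite mxE.
have hn : h n = y by apply/rowP => j; rewrite mxE ltn_ord.
have step (k : 'I_n) : `|g (h k.+1) - g (h k)| <= L * `|y ord0 k - x ord0 k|.
  set a := y ord0 k - x ord0 k.
  have hS : h k.+1 = a *: delta_mx ord0 k + h k.
    apply/rowP => j; rewrite !mxE eqxx /= /a ltnS leq_eqVlt.
    have [->|jk] := eqVneq j k; first by rewrite eqxx ltnn/= mulr1 subrK.
    by rewrite (_ : (j == k :> nat) = false)/= ?mulr0 ?add0r//; exact: negbTE.
  have := @mean_value_bound (fun t => g (t *: delta_mx ord0 k + h k))
    (fun t => partial [:: k] g (t *: delta_mx ord0 k + h k)) a L.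
  rewrite scale0r add0r -hS; apply => [t|t ta ta0]; first exact: is_derive_along.
  apply: gL; apply/(row_ballP _ _ r0) => j; rewrite !mxE eqxx /=.
  have [->|jk] := eqVneq j k; last by rewrite mulr0 add0r; case: ifP.
  rewrite mulr1 ltnn; have := xr k; have := yr k; rewrite !ltr_norml.
  move: ta; rewrite /a in ta0 *; have [a0|a0] := leP 0 (y ord0 k - x ord0 k).
    rewrite (ger0_norm a0) ler_norml => /andP[? ?] /andP[? ?] /andP[? ?].
    have t0 : 0 <= t \/ y ord0 k - x ord0 k = 0.
      have [->|an] := eqVneq (y ord0 k - x ord0 k) 0; first by right.
      by left; rewrite -(pmulr_lge0 _ (_ : 0 < y ord0 k - x ord0 k)) ?lt_def ?an.
    by apply/andP; case: t0 => ?; split; lra.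
  rewrite (ltr0_norm a0) ler_norml => /andP[? ?] /andP[? ?] /andP[? ?].
  by have t0 : t <= 0 by [rewrite -(nmulr_lge0 _ a0)]; apply/andP; split; lra.
have -> : g y - g x = \sum_(k < n) (g (h k.+1) - g (h k)).
  rewrite -(big_mkord xpredT (fun k => g (h k.+1) - g (h k))) telescope_sumr//.
  by rewrite hn h0.
apply: (le_trans (ler_norm_sum _ _ _)); rewrite mulr_sumr; apply: ler_sum => k _.
exact: step.
Qed.

Lemma smooth_locally_lipschitz n (g : 'rV[R]_n -> R) (z0 : 'rV[R]_n) : smooth g ->
  exists r L : R, [/\ 0 < r, 0 <= L & forall x y, ball z0 r x -> ball z0 r y ->
    `|g y - g x| <= L * \sum_j `|y ord0 j - x ord0 j|].
Proof.
move=> sg; pose L := \sum_j (`|partial [:: j] g z0| + 1).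
have : \forall x \near nbhs z0, forall j, `|partial [:: j] g x| <= L.
  apply: filter_forall => j.
  have /cvgrPdist_lt/(_ 1 ltr01) := (sg [:: j]).1 z0.
  apply: filterS => x /ltW hx.
  apply: (@le_trans _ _ (`|partial [:: j] g z0| + 1)).
    rewrite -lerBlDl; apply: le_trans hx; rewrite distrC; exact: lerB_dist.
  rewrite /L (bigD1 j)//= lerDl; apply: sumr_ge0 => k _; exact: addr_ge0.
move=> /nbhs_ballP[r /= r0 hr]; exists r, L; split => //.
  by apply: sumr_ge0 => k _; exact: addr_ge0.
apply: (lipschitz_of_partials r0); first by move=> j x; exact: (sg [::]).2.
by move=> j x /hr; exact.
Qed.

End lipschitz.

Section cone_condition.
Context {R : realType} {n : nat}.
Implicit Types (Omega V : set 'rV[R]_n) (lam : 'I_n -> R).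

(** As rho varies, the boxes x + rho [lam / 2, 4 lam] sweep a truncated cone with vertex x. The
    signs of [lam] choose its orthant and the moduli its shape; product boxes fit the supports of
    product kernels. *)
Definition cone_on Omega V lam := forall x, V x ->
  forall rho : R, 0 < rho <= 1 -> forall y : 'rV[R]_n,
  (forall j, 1 / 2 <= (rho * lam j)^-1 * y ord0 j - (rho * lam j)^-1 * x ord0 j <= 4) ->
  Omega y.

Lemma cone_dist (s x y : R) : s != 0 -> 1 / 2 <= s^-1 * y - s^-1 * x <= 4 ->
  `|y - x| <= 4 * `|s|.
Proof.
move=> s0 /(slab_norm s0) /andP[? ?]; rewrite ler_norml; apply/andP; split; lra.
Qed.

Lemma interior_cone Omega x0 : open Omega -> Omega x0 ->
  exists V lam, [/\ open V, V x0, forall j, lam j != 0 & cone_on Omega (V `&` Omega) lam].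
Proof.
move=> oO Ox0; have /nbhs_ballP[e /= e0 he] : nbhs x0 Omega by exact: open_nbhs_nbhs.
have e20 : 0 < e / 2 by rewrite divr_gt0.
(* The cone reaches at most 4 e / 8 = e / 2 away from its vertex. *)
exists (ball x0 (e / 2)), (fun=> e / 8); split.
- exact: ball_open.
- by apply: ballxx; rewrite divr_gt0.
- by move=> j; rewrite gt_eqF// divr_gt0.
move=> x [/(row_ballP _ _ e20) xb _] rho /andP[r0 r1] y h; apply: he; apply/(row_ballP _ _ e0) => j.
have := cone_dist _ (h j); rewrite mulf_neq0 ?gt_eqF ?divr_gt0// => /(_ isT).
rewrite normrM (gtr0_norm r0) (gtr0_norm (_ : 0 < e / 8)) ?divr_gt0// => d1.
have d2 : 4 * (rho * (e / 8)) <= e / 2.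
  have : rho * e <= e by rewrite ler_piMl// ltW.
  by lra.
by have := xb j; rewrite !ltr_norml => /andP[? ?];
  move: d1; rewrite ler_norml => /andP[? ?]; apply/andP; split; lra.
Qed.

(** The cone points into the epigraph along axis i and is thin in the other directions. Moving in
    the box of scale rho raises the i-th coordinate, suitably oriented, by at least rho c / 2, while
    the Lipschitz function [g] grows by at most L n (4 rho c eta) <= rho c / 2. *)
Lemma boundary_cone Omega x0 : smooth_boundary Omega -> (closure Omega `\` Omega°) x0 ->
  exists V lam, [/\ open V, V x0, forall j, lam j != 0 & cone_on Omega (V `&` Omega) lam].
Proof.
move=> sO bx0; have [r [i [b [g [r0 sg gO]]]]] := sO x0 bx0.
have [r1 [L [r10 L0 gL]]] := smooth_locally_lipschitz (col' i x0) sg.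
pose e := Num.min r r1; have e0 : 0 < e by rewrite lt_min r0.
have e20 : 0 < e / 2 by rewrite divr_gt0.
pose s : R := (-1) ^+ b.
have ss : s * s = 1 by rewrite /s; case: (b); rewrite ?expr1 ?expr0 ?mulr1// mulrNN mulr1.
have s1 : `|s| = 1 by rewrite normr_sign.
pose c := e / 8; have c0 : 0 < c by rewrite divr_gt0.
(* Chosen for L n eta <= 1 / 8; the added 1 keeps the denominator positive and gives eta <= 1, so
   that no edge of the cone is longer than along axis i. *)
pose eta := (8 * (L * n%:R + 1))^-1.
have Ln0 : 0 <= L * n%:R by rewrite mulr_ge0.
have eta0 : 0 < eta by rewrite invr_gt0 mulr_gt0// ltr_wpDl.
have eta1 : eta <= 1 by rewrite invf_le1; lra.
have etaL : L * n%:R * eta <= 1 / 8.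
  by rewrite /eta ler_pdivrMr ?mulr_gt0 ?ltr_wpDl//; lra.
pose lam j := if j == i then s * c else c * eta.
have lamc j : `|lam j| <= c.
  rewrite /lam; case: ifP => _; first by rewrite normrM s1 mul1r gtr0_norm.
  by rewrite gtr0_norm ?mulr_gt0// ler_piMr// ltW.
have lam0 j : lam j != 0.
  rewrite -normr_gt0 /lam; case: ifP => _; first by rewrite normrM s1 mul1r gtr0_norm.
  by rewrite gtr0_norm ?mulr_gt0.
exists (ball x0 (e / 2)), lam; split => //.
- exact: ball_open.
- by apply: ballxx; rewrite divr_gt0.
move=> x [/(row_ballP _ _ e20) xb Ox] rho /andP[rho0 rho1] y h.
have rl0 j : rho * lam j != 0 by rewrite mulf_neq0 ?(gt_eqF rho0).
have dist j := cone_dist (rl0 j) (h j).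
have distc j : `|y ord0 j - x ord0 j| <= e / 2.
  apply: (le_trans (dist j)); rewrite normrM (gtr0_norm rho0).
  have : rho * `|lam j| <= c.
    by rewrite (le_trans _ (lamc j))// ler_piMl.
  by rewrite /c; lra.
have yb j : `|x0 ord0 j - y ord0 j| < e.
  have := xb j; have := distc j; rewrite ler_norml !ltr_norml => /andP[? ?] /andP[? ?].
  by apply/andP; split; lra.
have xb' j : `|x0 ord0 j - x ord0 j| < e.
  by apply: (lt_trans (xb j)); lra.
have er : e <= r by rewrite ge_min lexx.
have er1 : e <= r1 by rewrite ge_min lexx orbT.
have bxr (w : 'rV[R]_n) : (forall j, `|x0 ord0 j - w ord0 j| < e) -> ball x0 r w.
  by move=> H; apply/(row_ballP _ _ r0) => j; exact: lt_le_trans (H j) er.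
have bxr1 (w : 'rV[R]_n) : (forall j, `|x0 ord0 j - w ord0 j| < e) ->
    ball (col' i x0) r1 (col' i w).
  by move=> H; apply/(row_ballP _ _ r10) => j; rewrite !mxE; exact: lt_le_trans (H _) er1.
apply/(gO _ (bxr _ yb)); have /(gO _ (bxr _ xb')) := Ox.
have := gL _ _ (bxr1 _ xb') (bxr1 _ yb).
have sumle : \sum_j `|(col' i y) ord0 j - (col' i x) ord0 j| <= n%:R * (4 * (rho * (c * eta))).
  apply: (@le_trans _ _ (\sum_(j < n.-1) 4 * (rho * (c * eta)))).
    apply: ler_sum => j _; rewrite !mxE; apply: (le_trans (dist _)).
    rewrite normrM (gtr0_norm rho0) /lam eq_sym (negbTE (neq_lift _ _)).
    by rewrite gtr0_norm ?mulr_gt0.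
  rewrite sumr_const card_ord -[leLHS]mulr_natl ler_wpM2r//; last first.
    by rewrite ler_nat leq_pred.
  by rewrite !mulr_ge0// ltW.
have gi : rho * c / 2 <= s * y ord0 i - s * x ord0 i.
  have := h i; rewrite /lam eqxx => /andP[+ _].
  have sV : s^-1 = s by rewrite -[LHS]mul1r -ss mulfK// -normr_eq0 s1 oner_eq0.
  rewrite (_ : rho * (s * c) = (rho * c) * s); last by ring.
  rewrite -mulrBr invfM sV mulrAC mulrC; move: (rho * c) (mulr_gt0 rho0 c0) => k k0.
  rewrite -mulrA ler_pdivlMl// mulrBl ![_ * s]mulrC; lra.
have Lsum : L * \sum_j `|(col' i y) ord0 j - (col' i x) ord0 j| <= rho * c / 2.
  apply: (le_trans (ler_wpM2l L0 sumle)).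
  have -> : L * (n%:R * (4 * (rho * (c * eta)))) = 4 * (rho * c) * (L * n%:R * eta) by ring.
  apply: (@le_trans _ _ (4 * (rho * c) * (1 / 8))); last by lra.
  by rewrite ler_wpM2l// !mulr_ge0// ltW.
rewrite -/s ler_norml => /andP[? ?] ?; lra.
Qed.

Lemma local_cone Omega x0 : open Omega -> smooth_boundary Omega -> closure Omega x0 ->
  exists V lam, [/\ open V, V x0, forall j, lam j != 0 & cone_on Omega (V `&` Omega) lam].
Proof.
move=> oO sO cx0; have [Ox0|nOx0] := pselect (Omega x0); first exact: interior_cone.
by apply: boundary_cone => //; split => //; rewrite (interior_id _).1.
Qed.

End cone_condition.

(** * From local cones to the whole domain *)

Section global_agmon.
Context {R : realType} {n : nat}.
Local Notation mu := (@lebesgue_row R n).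
Implicit Types (Omega : set 'rV[R]_n).

Lemma bounded_set_cube Omega : bounded_set Omega ->
  exists2 M : R, 0 < M & Omega `<=` cube (fun=> `[- M, M]%classic).
Proof.
move=> [M [Mr hM]]; exists (`|M| + 1); first by rewrite ltr_wpDl.
move=> x /(hM (`|M| + 1) _); rewrite (le_lt_trans (ler_norm M)) ?ltrDl// => /(_ isT) h j.
rewrite /= in_itv/= -ler_norml; apply: le_trans h.
have /mapP[k Hk ->] : `|x ord0 j| \in [seq `|x z.1 z.2| | z : 'I_1 * 'I_n].
  by apply/mapP; exists (ord0, j) => //=; rewrite mem_enum.
by rewrite [leRHS]/Num.norm /= mx_normrE; apply/bigmax_geP; right => /=; exists k.
Qed.

Lemma bounded_set_measure Omega : bounded_set Omega -> measurable Omega ->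
  (mu Omega < +oo)%E.
Proof.
move=> bO mO; have [M M0 OM] := bounded_set_cube bO.
have mI (j : 'I_n) : measurable (`[- M, M]%classic : set R) by exact: measurable_itv.
apply: (@le_lt_trans _ _ (mu (cube (fun=> `[- M, M]%classic)))).
  exact: (@le_measure _ _ _ mu _ _ (mem_set mO) (mem_set (measurable_cube mI)) OM).
rewrite (@lebesgue_row_cube _ _ _ (fun=> M - - M)) ?ltry// => j.
by rewrite lebesgue_measure_itv/= lte_fin; case: ltP => h; congr _%:E; lra.
Qed.

Lemma bounded_closure_compact Omega : bounded_set Omega -> compact (closure Omega).
Proof.
move=> bO; have [M M0 OM] := bounded_set_cube bO.
apply: (subclosed_compact (@closed_closure _ _) (@compact_cube _ _ (fun=> - M) (fun=> M))).
  rewrite [X in _ `<=` X](closure_id _).1; last exact: closed_cube.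
  exact: closureS.
Qed.

Definition agmon_on Omega (V : set 'rV[R]_n) (C : R) :=
  forall (f : 'rV[R]_n -> R) (g : 'I_n -> 'rV[R]_n -> R),
  sqi mu (f \_ Omega) -> (forall m, sqi mu (g m \_ Omega)) ->
  (forall m, weak_derivative Omega [:: m; m] f (g m)) ->
  forall rho : R, 0 < rho <= 1 ->
  {ae mu, forall x, V x -> `|f x| <= C / Num.sqrt (rho ^+ n) *
    (norm2 mu (f \_ Omega) + rho ^+ 2 * \sum_m norm2 mu (g m \_ Omega))}.

Lemma agmon_on_cone Omega V (lam : 'I_n -> R) : (n <= 3)%N -> open Omega ->
  (mu Omega < +oo)%E -> open V -> (forall j, lam j != 0) -> cone_on Omega (V `&` Omega) lam ->
  exists2 C : R, 0 <= C & agmon_on Omega (V `&` Omega) C.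
Proof.
move=> n3 oO muO oV lam0 cone; have mO : measurable Omega by exact: open_measurable_row.
have [th [B [b [K [[thB Bb sth K1] [[th0 th1 B0 B1] [BK bs bK thK]]]]]]] := @exists_profile R.
have K0 : 0 <= K by exact: le_trans K1.
have c0 := agmon_cst_ge0 K1 lam.
(* Absorbs the weights [lam m ^+ 2] and the factor 4 of [agmon_bound]; the 1 covers the term without
   derivatives. *)
pose S := 1 + 4 * \sum_m lam m ^+ 2.
have S0 : 0 <= \sum_m lam m ^+ 2 by apply: sumr_ge0 => m _; exact: sqr_ge0.
exists (agmon_cst K lam * S); first by rewrite mulr_ge0// /S; lra.
move=> f g sf sg fg rho r01; have /andP[r0 _] := r01.
have fint : mu.-integrable setT (EFin \o (f \_ Omega)).
  have := integrable_patch mO (sqi_integrable_on mO muO sf).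
  by rewrite (_ : (f \_ Omega) \_ Omega = f \_ Omega)// -patch_setI setIid.
have H := agmon_ae thB Bb sth K1 th0 th1 B0 B1 BK bs bK thK lam0 cone fint sf sg fg n3
   (openI oV oO) (@subIsetr _ _ _) mO muO r01.
apply: (ae_imp H) => x h /h /le_trans; apply.
rewrite /agmon_bound; move: (agmon_cst K lam) c0 => A A0.
rewrite -[leLHS]mulrA -2![leRHS]mulrA ler_wpM2l//.
rewrite [leRHS]mulrCA ler_wpM2l ?invr_ge0 ?sqrtr_ge0//.
rewrite [leRHS]mulrDr; apply: lerD.
  by rewrite ler_peMl ?norm2_ge0// /S; lra.
rewrite -mulrA [leLHS]mulrCA [leRHS]mulrCA ler_wpM2l ?sqr_ge0//.
rewrite mulr_sumr mulr_sumr; apply: ler_sum => m _; rewrite mulrA ler_wpM2r ?norm2_ge0//.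
rewrite /S; have : lam m ^+ 2 <= \sum_m lam m ^+ 2.
  by rewrite [leRHS](bigD1 m)//= lerDl; apply: sumr_ge0 => k _; exact: sqr_ge0.
lra.
Qed.

Lemma agmon Omega : (n <= 3)%N -> open Omega -> bounded_set Omega -> smooth_boundary Omega ->
  exists2 C : R, 0 <= C & agmon_on Omega Omega C.
Proof.
move=> n3 oO bO sO; have mO : measurable Omega by exact: open_measurable_row.
have muO := bounded_set_measure bO mO.
have loc x : exists VC : set 'rV[R]_n * R, closure Omega x ->
    [/\ open VC.1, VC.1 x, 0 <= VC.2 & agmon_on Omega (VC.1 `&` Omega) VC.2].
  have [cx|ncx] := pselect (closure Omega x); last by exists (set0, 0).
  have [V [lam [oV Vx lam0 cone]]] := local_cone oO sO cx.
  have [C C0 VC] := agmon_on_cone n3 oO muO oV lam0 cone.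
  by exists (V, C).
have [F hF] := choice loc.
pose U x : set 'rV[R]_n := if x \in closure Omega then (F x).1 else set0.
have := bounded_closure_compact bO; rewrite compact_cover => /(_ _ (closure Omega) U).
case.
- by move=> x cx; rewrite /U mem_set//; have [] := hF x cx.
- move=> x cx; exists x => //; rewrite /U mem_set//.
  by have [] := hF x cx.
move=> D DO cover.
have Dc x : x \in D -> closure Omega x by move=> /DO/set_mem.
(* The local constants are nonnegative, so their sum over the finite subcover dominates each of
   them. *)
exists (\sum_(x <- D) (F x).2).
  rewrite big_seq_cond; apply: sumr_ge0 => x /andP[xD _].
  by have [] := hF x (Dc _ xD).
move=> f g sf sg fg rho r01.
set X := _ + _.
have X0 : 0 <= X.
  by rewrite addr_ge0 ?norm2_ge0// mulr_ge0 ?sqr_ge0// sumr_ge0// => m _; exact: norm2_ge0.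
have H : {ae mu, forall x, forall z, z \in D -> ((F z).1 `&` Omega) x ->
    `|f x| <= (F z).2 / Num.sqrt (rho ^+ n) * X}.
  have := @filter_bigI _ _ D (fun z => [set x | ((F z).1 `&` Omega) x ->
    `|f x| <= (F z).2 / Num.sqrt (rho ^+ n) * X]) (almost_everywhere mu) _.
  case=> [z zD|A [mA A0 AS]]; first by have [_ _ _] := hF z (Dc _ zD); exact.
  by exists A; split => // x nx; apply: AS => h; apply: nx => z zD; exact: h.
apply: (ae_imp H) => x h Ox.
have [z zD Uz] : exists2 z, z \in D & U z x.
  by have [|z] := cover x _; [exact: subset_closure|exists z].
have cz := Dc _ zD; have [_ _ Cz0 _] := hF z cz.
apply: (@le_trans _ _ ((F z).2 / Num.sqrt (rho ^+ n) * X)).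
  by apply: h => //; split => //; move: Uz; rewrite /U mem_set.
rewrite ler_wpM2r// ler_wpM2r ?invr_ge0 ?sqrtr_ge0//.
rewrite (big_rem z)//= lerDl big_seq_cond; apply: sumr_ge0 => y /andP[/mem_rem yD _].
by have [] := hF y (Dc _ yD).
Qed.

End global_agmon.

(** * Weak derivatives *)

Section weak_partial_theory.
Context {R : realType} {n : nat}.
Local Notation mu := (@lebesgue_row R n).
Variable Omega : set 'rV[R]_n.
Hypothesis oO : open Omega.
Implicit Types (f g : 'rV[R]_n -> R) (s : seq 'I_n).

Let mO : measurable Omega. Proof. exact: open_measurable_row. Qed.

Local Notation ratcorners := ({ffun 'I_n -> rat} * {ffun 'I_n -> rat})%type.

(** Measurability is known on compact subsets only; an open set is a countable union of rational
    boxes contained in such compacts. *)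
Lemma loc_integrable_measurable f : loc_integrable Omega f ->
  measurable_fun setT (f \_ Omega).
Proof.
move=> lf; apply/(measurable_restrictT _ mO).
rewrite [X in measurable_fun X](_ : Omega = \bigcup_k (if (unpickle k : option ratcorners) is
    Some (p, q) then if `[< inner_ratbox Omega p q >] then ratbox p q else set0
    else set0)).
  apply/measurable_fun_bigcup => k; case: unpickle => [[p q]|//].
    by case: ifP => // _; exact: measurable_ratbox.
  case: ifPn => [/asboolP[e e0 eO]|_]; last exact: measurable_fun_set0.
  apply: (@measurable_funS _ _ _ _
    (cube (fun j => `[(ratr (p j) - e), (ratr (q j) + e)]%classic))).
  - by apply: measurable_cube => j; exact: measurable_itv.
  - move=> x hx j; have := hx j; rewrite /= !in_itv/= => /andP[a b].
    by apply/andP; split; lra.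
  - apply/measurable_EFinP; apply: measurable_int; apply: lf => //.
    exact: compact_cube.
  - exact: measurable_fun_set0.
apply/seteqP; split => [x Ox|x [k _]].
  have [p [q [pqO xpq]]] := open_inner_ratbox oO Ox.
  by exists (pickle (p, q)) => //; rewrite pickleK asboolT.
case: unpickle => [[p q]|//]; case: ifPn => // /asboolP pqO.
exact: ratbox_inner.
Qed.

Lemma partial_eq0 (phi : 'rV[R]_n -> R) (U : set 'rV[R]_n) s : open U ->
  (forall x, U x -> phi x = 0) -> forall x, U x -> partial s phi x = 0.
Proof.
move=> oU U0; elim: s => [|i s IH] //= x Ux.
rewrite (@near_eq_derive _ _ _ _ (cst 0)) ?derive_cst//.
by near=> y; apply: IH; near: y; exact: open_nbhs_nbhs.
Unshelve. all: by end_near. Qed.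

Lemma continuous_measurable_row f : continuous f -> measurable_fun setT f.
Proof.
move=> cf; apply: (measurability _ (RGenOInfty.measurableE R)) => _ [_ [x ->] <-].
rewrite setTI; apply: open_measurable_row; exact: open_comp.
Qed.

Lemma integrable_test f (phi : 'rV[R]_n -> R) s : loc_integrable Omega f ->
  test_function Omega phi ->
  mu.-integrable Omega (EFin \o (fun x => f x * partial s phi x)).
Proof.
move=> lf [sphi]; set K := closure _ => cK KO.
have mK : measurable K by apply: closed_measurable_row; exact: closed_closure.
have clK : closed K by exact: closed_closure.
have phi0 x : (~` K) x -> partial s phi x = 0.
  apply: partial_eq0; first exact: closed_openC.
  by move=> y nKy; apply/eqP; apply: contra_notT nKy => h; exact: subset_closure.
have cphi := (sphi s).1.
have iK : mu.-integrable K (EFin \o (fun x => f x * partial s phi x)).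
  rewrite (_ : EFin \o _ = ((EFin \o f) \* (EFin \o partial s phi))%E)//.
  apply: integrableMl => //; first exact: lf.
    by apply: measurable_funTS; apply: continuous_measurable_row.
  have : compact (partial s phi @` K).
    by apply: continuous_compact => //; exact: continuous_subspaceT.
  move=> /compact_bounded[M [Mr hM]]; exists M; split => // y /hM {}hM x Kx.
  by apply: hM; exists x.
have iO := (integrable_mkcond (EFin \o (fun x => f x * partial s phi x)) mK).1 iK.
have := integrableS measurableT mO (@subsetT _ _) iO; apply: eq_integrable => // x _ /=.
rewrite /patch; case: ifPn => // /negP; rewrite inE => nKx.
by rewrite phi0 ?mulr0.
Qed.

Lemma weak_derivative_id f : loc_integrable Omega f -> weak_derivative Omega [::] f f.
Proof. by split => // phi _; rewrite mul1r. Qed.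

Lemma weak_derivativeB s f g f' g' : weak_derivative Omega s f g ->
  weak_derivative Omega s f' g' ->
  weak_derivative Omega s (fun x => f x - f' x) (fun x => g x - g' x).
Proof.
move=> [lf lg fg] [lf' lg' fg']; split; [exact: loc_integrableB|exact: loc_integrableB|].
move=> phi tphi.
under eq_Rintegral do rewrite mulrBl.
under [in RHS]eq_Rintegral do rewrite mulrBl.
have i1 := integrable_test s lf tphi; have i2 := integrable_test s lf' tphi.
have i3 := integrable_test [::] lg tphi; have i4 := integrable_test [::] lg' tphi.
by rewrite !RintegralB// mulrBr fg// fg'.
Qed.

Lemma weak_partialP s f g : weak_derivative Omega s f g ->
  weak_derivative Omega s f (weak_partial Omega s f).
Proof.
by move=> fg; apply: (@xgetPex _ (cst 0) [set g | weak_derivative Omega s f g]); exists g.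
Qed.

Lemma weak_partial_ae s f g : weak_derivative Omega s f g ->
  {ae mu, forall x, Omega x -> weak_partial Omega s f x = g x}.
Proof. by move=> fg; exact: weak_derivative_unique oO (weak_partialP fg) fg. Qed.

Lemma patch_ae_eq f g : {ae mu, forall x, Omega x -> f x = g x} ->
  {ae mu, forall x, (f \_ Omega) x = (g \_ Omega) x}.
Proof.
move=> fg; apply: (ae_imp fg) => x fgx; rewrite /patch.
by case: ifPn => // /set_mem /fgx.
Qed.

Lemma patchB f g : (fun x => f x - g x) \_ Omega = (fun x => (f \_ Omega) x - (g \_ Omega) x).
Proof. by apply/funext => x; rewrite /patch; case: ifP; rewrite ?subr0. Qed.

Local Notation field := ('rV[R]_n -> 'cV[R]_3).
Local Notation wp s v j := (weak_partial Omega s (fun y => v y j ord0)).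

Lemma fieldBE (v w : field) j :
  (fun x => (v \- w) x j ord0) = (fun x => v x j ord0 - w x j ord0).
Proof. by apply/funext => x /=; rewrite !mxE. Qed.

Lemma wDE s (v : field) j : (fun x => wD Omega s v x j ord0) = wp s v j.
Proof. by apply/funext => x; rewrite mxE. Qed.

(** The derivative selected by [weak_partial] need not be the square integrable one provided by
    [Hk]; uniqueness almost everywhere transfers the integrability. *)
Lemma Hk_weak_partial k (v : field) s j : Hk Omega k v -> (size s <= k)%N ->
  weak_derivative Omega s (fun x => v x j ord0) (wp s v j) /\
  sqi mu (wp s v j \_ Omega).
Proof.
move=> [_ Hv] /Hv[g Lg vg]; have vw := weak_partialP (vg j); split => //.
have [_ lw _] := vw.
apply: (sqi_ae (loc_integrable_measurable lw) _ (Lfun2P (Lg j))).1.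
exact/patch_ae_eq/weak_partial_ae.
Qed.

Lemma sqi_Lfun f : sqi mu f -> f \in Lfun mu 2%:E.
Proof.
move=> sf; apply/andP; split; rewrite inE /=; first exact: sf.1.
by rewrite /finite_norm Lnorm2E// ltry.
Qed.

Lemma HkB k (v w : field) : Hk Omega k v -> Hk Omega k w -> Hk Omega k (v \- w).
Proof.
have LB (a b : field) : Lp Omega 2%:E a -> Lp Omega 2%:E b -> Lp Omega 2%:E (a \- b).
  move=> La Lb j; apply: sqi_Lfun.
  rewrite fieldBE patchB.
  by apply: sqiB; exact: Lfun2P.
move=> [Lv Hv] [Lw Hw]; split; first exact: LB.
move=> s sk; have [g Lg vg] := Hv s sk; have [h Lh wh] := Hw s sk.
exists (g \- h) => [|j]; first exact: LB.
rewrite !fieldBE.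
exact: weak_derivativeB.
Qed.

Lemma weak_partialB k (v w : field) s j : Hk Omega k v -> Hk Omega k w -> (size s <= k)%N ->
  {ae mu, forall x, Omega x -> wp s (v \- w) j x = wp s v j x - wp s w j x}.
Proof.
move=> Hv Hw sk; apply: weak_partial_ae.
rewrite fieldBE.
have [a _] := Hk_weak_partial j Hv sk; have [b _] := Hk_weak_partial j Hw sk.
exact: weak_derivativeB.
Qed.

Lemma weak_partial0 k (v : field) j : Hk Omega k v ->
  {ae mu, forall x, Omega x -> wp [::] v j x = v x j ord0}.
Proof.
move=> Hv; have [[lv _ _] _] := Hk_weak_partial j Hv (leq0n k : (size [::] <= k)%N).
exact/weak_partial_ae/weak_derivative_id.
Qed.

Lemma frob_cVE (a : 'cV[R]_3) : frob a a = \sum_j a j ord0 ^+ 2.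
Proof. by apply: eq_bigr => j _; rewrite big_ord1 expr2. Qed.

Lemma frob_norm_sqr (a : 'cV[R]_3) : frob_norm a ^+ 2 = \sum_j a j ord0 ^+ 2.
Proof. by rewrite sqr_sqrtr frob_cVE// sumr_ge0// => j _; exact: sqr_ge0. Qed.

Lemma sqi_frob_norm (v : field) : (forall j, sqi mu ((fun x => v x j ord0) \_ Omega)) ->
  sqi mu ((fun x => frob_norm (v x)) \_ Omega) /\
  norm2 mu ((fun x => frob_norm (v x)) \_ Omega) ^+ 2 =
    \sum_j norm2 mu ((fun x => v x j ord0) \_ Omega) ^+ 2.
Proof.
move=> sv; set F := _ \_ _.
have F2 x : F x ^+ 2 = \sum_j ((fun x => v x j ord0) \_ Omega) x ^+ 2.
  rewrite /F /patch; case: ifP => _; first exact: frob_norm_sqr.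
  by rewrite big1 ?expr0n// => j _; rewrite expr0n.
have mF2 : measurable_fun setT (fun x => F x ^+ 2).
  under eq_fun do rewrite F2.
  by apply: measurable_sum => j; apply: measurable_funX; case: (sv j).
have FE : F = fun x => Num.sqrt (F x ^+ 2).
  apply/funext => x; rewrite sqrtr_sqr ger0_norm// /F /patch; case: ifP => // _.
  exact: sqrtr_ge0.
have iF : mu.-integrable setT (EFin \o (fun x => F x ^+ 2)).
  rewrite (_ : EFin \o _ = (fun x => \sum_j (((fun x => v x j ord0) \_ Omega) x ^+ 2)%:E)%E).
    by apply: integrable_sum => // j; case: (sv j).
  by apply/funext => x /=; rewrite F2 sumEFin.
split.
  split => //; rewrite FE; apply: measurableT_comp mF2.
  by apply: continuous_measurable_fun; exact: sqrt_continuous.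
rewrite norm2_sqr; under eq_Rintegral do rewrite F2.
under eq_bigr do rewrite norm2_sqr.
rewrite /Rintegral (eq_integral (fun x =>
  \sum_j (((fun x => v x j ord0) \_ Omega) x ^+ 2)%:E)%E); last first.
  by move=> x _; rewrite sumEFin.
rewrite integral_sum//; last by move=> j; case: (sv j).
rewrite sum_fine// => j _; apply: integrable_fin_num => //; by case: (sv j).
Qed.

Lemma Lp_norm2E (v : field) : (forall j, sqi mu ((fun x => v x j ord0) \_ Omega)) ->
  Lp_norm Omega 2%:E v = (Num.sqrt (\sum_j norm2 mu ((fun x => v x j ord0) \_ Omega) ^+ 2))%:E.
Proof.
move=> sv; have [sF nF] := sqi_frob_norm sv.
by rewrite /Lp_norm Lnorm2E// -nF sqrtr_sqr ger0_norm ?norm2_ge0.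
Qed.

Lemma norm2_le_Hk_norm k (v : field) s j : Hk Omega k v -> (size s <= k)%N ->
  ((norm2 mu (wp s v j \_ Omega))%:E <= Hk_norm Omega k v)%E.
Proof.
move=> Hv sk.
have sw (r : seq 'I_n) : (size r <= k)%N ->
    forall i, sqi mu ((fun x => wD Omega r v x i ord0) \_ Omega).
  move=> rk i; rewrite wDE; by have [] := Hk_weak_partial i Hv rk.
have sizes : (size s < k.+1)%N by [].
rewrite /Hk_norm (bigD1 (Ordinal sizes))//= (bigD1 (in_tuple s))//=.
rewrite (Lp_norm2E (sw s sk)).
set a := norm2 _ _; set S := Num.sqrt _.
have a0 : 0 <= a by exact: norm2_ge0.
have aS : a <= S.
  rewrite -(@ler_pXn2r _ 2%N) ?nnegrE ?sqrtr_ge0// [in leRHS]sqr_sqrtr; last first.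
    by apply: sumr_ge0 => i _; exact: sqr_ge0.
  rewrite (bigD1 j)//=; rewrite wDE.
  by rewrite lerDl sumr_ge0// => i _; exact: sqr_ge0.
apply: (@le_trans _ _ ((S%:E ^+ 2) `^ 2^-1)%E).
  rewrite -EFin_expe poweR_EFin powR12_sqrt ?sqr_ge0// sqrtr_sqr lee_fin.
  exact: le_trans aS (ler_norm _).
have S0 : (0 <= S%:E ^+ 2)%E by rewrite -EFin_expe lee_fin sqr_ge0.
have sum0 (I : finType) (P : pred I) (F : I -> \bar R) :
    (forall i, 0 <= F i)%E -> (0 <= \sum_(i | P i) F i)%E.
  by move=> F0; apply: sume_ge0.
set A := (\sum_(i | i != in_tuple s) _)%E; set B := (\sum_(i | i != Ordinal sizes) _)%E.
have A0 : (0 <= A)%E by apply: sum0 => i; exact: sqre_ge0.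
have B0 : (0 <= B)%E by apply: (@sum0) => i; apply: (@sum0) => ?; exact: sqre_ge0.
apply: gt0_ler_poweR; rewrite ?invr_ge0// ?in_itv/= ?leey ?andbT//.
  by rewrite !adde_ge0.
by rewrite -addeA; apply: leeDl; exact: adde_ge0.
Qed.

End weak_partial_theory.

(** * Increments and the chain rule *)

Lemma Rintegral_sum (R : realType) d (T : measurableType d) (nu : {measure set T -> \bar R})
    (A : set T) m (F : 'I_m -> T -> R) : measurable A ->
  (forall k, nu.-integrable A (EFin \o F k)) ->
  nu.-integrable A (EFin \o (fun x => \sum_k F k x)) /\
  \int[nu]_(x in A) (\sum_k F k x) = \sum_k \int[nu]_(x in A) F k x.
Proof.
move=> mA iF.
have E : EFin \o (fun x => \sum_k F k x) = (fun x => \sum_k (F k x)%:E)%E.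
  by apply/funext => x /=; rewrite sumEFin.
split; first by rewrite E; apply: integrable_sum => // k _; exact: iF.
rewrite /Rintegral (eq_integral (fun x => \sum_k (F k x)%:E)%E); last first.
  by move=> x _; rewrite sumEFin.
rewrite integral_sum//.
by rewrite sum_fine// => k _; apply: integrable_fin_num => //; exact: iF.
Qed.

Section tent.
Context {R : realType}.
Local Notation leb := (@lebesgue_measure R).

(* [\int_0^h] of the indicator of [`]p + tau, q + tau]] at [t], in closed form *)
Definition tent (h p q t : R) := Num.max (t - p) 0 - Num.max (t - q) 0
  - Num.max (t - (p + h)) 0 + Num.max (t - (q + h)) 0.

(** The length of the overlap of [0, h[ with [t - q, t - p[, the set of those shifts that bring t
    into ]p, q]. *)
Lemma tentE (h p q t : R) : 0 < h -> p < q ->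
  tent h p q t = Num.max 0 (Num.min h (t - p) - Num.max 0 (t - q)).
Proof.
have mE r : Num.max (t - r) 0 = if r < t then t - r else 0.
  by case: ltP => ?; [rewrite max_l// subr_ge0 ltW|rewrite max_r// subr_le0].
move=> h0 pq; rewrite /tent !mE.
case: (ltP p t) => ?; case: (ltP q t) => ?; try lra.
all: case: (ltP (p + h) t) => ?; try lra.
all: case: (ltP (q + h) t) => ?; try lra.
all: case: (leP h (t - p)) => ?; try lra.
all: case: (leP 0 (t - q)) => ?; try lra.
all: match goal with |- context [Order.max 0 ?x] => case: (leP 0 x) => ? end; lra.
Qed.

Lemma tent_ge0 (h p q t : R) : 0 < h -> p < q -> 0 <= tent h p q t.
Proof. by move=> h0 pq; rewrite tentE// le_max lexx. Qed.

Lemma tent_le (h p q t : R) : 0 < h -> p < q -> tent h p q t <= h.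
Proof.
move=> h0 pq; rewrite tentE// ge_max ltW//=.
have : Num.min h (t - p) <= h by rewrite ge_min lexx.
by have : 0 <= Num.max 0 (t - q) by [rewrite le_max lexx]; lra.
Qed.

Lemma measurable_tent (h p q : R) : measurable_fun setT (tent h p q).
Proof.
have m r : measurable_fun setT (fun t : R => Num.max (t - r) 0).
  by apply: measurable_maxr => //; exact: measurable_funB.
by apply: measurable_funD; [apply: measurable_funB; [apply: measurable_funB|]|].
Qed.

Lemma integral_tent (h p q t : R) : 0 < h -> p < q ->
  (\int[leb]_(s in `[0%R, h[) (\1_`]p, q]%classic (t - s) : R)%:E = (tent h p q t)%:E)%E.
Proof.
move=> h0 pq.
pose a := Num.max 0 (t - q); pose c := Num.min h (t - p).
transitivity (\int[leb]_(s in `[0%R, h[) (\1_`[(t - q), (t - p)[%classic s : R)%:E)%E.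
  apply: eq_integral => s _; rewrite !indicE; congr ((nat_of_bool _)%:R%:E).
  by apply/idP/idP => /set_mem; rewrite /= !in_itv/= => /andP[? ?];
    apply/mem_set; rewrite /= in_itv/=; apply/andP; split; lra.
rewrite integral_indic//; try exact: measurable_itv.
rewrite (_ : _ `&` _ = `[a, c[%classic); last first.
  apply/seteqP; split => s; rewrite /= !in_itv/= /a /c ge_max lt_min.
    by move=> [/andP[-> ->] /andP[-> ->]].
  by move=> /andP[/andP[-> ->] /andP[-> ->]].
rewrite -[LHS]/(leb `[a, c[%classic) lebesgue_measure_itv/= lte_fin tentE// -/a -/c.
case: ltP => ac.
  by rewrite -EFinD max_r// subr_ge0 ltW.
by rewrite max_l// subr_le0.
Qed.

Lemma tent_cvg (h_ : nat -> R) (p q t : R) : (forall k, 0 < h_ k) -> p < q ->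
  h_ k @[k --> \oo] --> 0 ->
  (h_ k)^-1 * tent (h_ k) p q t @[k --> \oo] --> (\1_`]p, q]%classic t : R).
Proof.
move=> h0 pq h_0; apply: cvg_near_cst; rewrite indicE.
have [tp|pt] := leP t p.
  apply/nearW => k; rewrite memNset; last by rewrite /= in_itv/= ltNge tp.
  by rewrite /tent !max_r ?subrr ?addr0 ?mulr0//; have := h0 k; lra.
have [tq|qt] := leP t q.
  rewrite mem_set; last by rewrite /= in_itv/= pt.
  have tp : 0 < t - p by rewrite subr_gt0.
  near=> k; have hk : h_ k < t - p by near: k; exact: (cvgr_lt 0).
  rewrite tentE// min_l ?(ltW hk)// [Num.max 0 (t - q)]max_l ?subr_le0// subr0.
  by rewrite max_r ?ltW// mulVf ?gt_eqF.
rewrite memNset; last by rewrite /= in_itv/= pt/= leNgt qt.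
have tq : 0 < t - q by rewrite subr_gt0.
near=> k; have hk : h_ k < t - q by near: k; exact: (cvgr_lt 0).
have hk0 := h0 k; rewrite /tent !max_l; [|lra..].
by rewrite (_ : _ + _ = 0) ?mulr0//; lra.
Unshelve. all: by end_near. Qed.

Section smooth_tent.
Variables (th B : R -> R) (K : R).
Hypotheses (thB : der th B) (sth : smooth1 th) (K0 : 0 <= K)
  (th0 : forall t : R, t <= 1 -> th t = 0) (th1 : forall t : R, 2 <= t -> th t = t)
  (thK : forall t : R, `|th t - Num.max t 0| <= K).

Let ramp (s r t : R) := s * th (s^-1 * t + - (s^-1 * r)).

(** [tent] with max(., 0) replaced by its smooth version at scale s. The slopes 1, -1, -1, 1 cancel
    past the last ramp, and the derivative is a difference of two translated steps. *)
Definition smooth_tent (s h p q t : R) :=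
  ramp s p t + -1 * ramp s q t + -1 * ramp s (p + h) t + ramp s (q + h) t.

Lemma smooth1_tent s h p q : smooth1 (smooth_tent s h p q).
Proof.
have sr r k : Cn k (ramp s r) by apply: CnM; [exact: Cn_cst|exact: Cn_affine].
have nsr r k : Cn k (fun t => -1 * ramp s r t) by apply: CnM; [exact: Cn_cst|exact: sr].
by move=> k; do 3![apply: CnD; last by [exact: sr|exact: nsr]]; exact: sr.
Qed.

Lemma der_tent s h p q : s != 0 ->
  der (smooth_tent s h p q) (fun t => step B s p q t - step B s (p + h) (q + h) t).
Proof.
move=> s0.
have dr r : der (ramp s r) (fun t => B (s^-1 * t + - (s^-1 * r))).
  move=> t; apply: (is_derive_eq (derM (der_cst s) (der_affine s^-1 (- (s^-1 * r)) thB) t)).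
  by rewrite mulr0 addr0 mulrA divff// mul1r.
move=> t; apply: (is_derive_eq (derD (derD (derD (dr p) (derM (der_cst (-1)) (dr q)))
  (derM (der_cst (-1)) (dr (p + h)))) (dr (q + h)) t)).
by rewrite /step !mulr0; ring.
Qed.

Lemma ramp_approx s r t : 0 < s -> `|ramp s r t - Num.max (t - r) 0| <= s * K.
Proof.
move=> s0; rewrite /ramp -mulrBr.
have -> : Num.max (t - r) 0 = s * Num.max (s^-1 * (t - r)) 0.
  by rewrite maxr_pMr ?ltW// mulr0 mulrA divff ?gt_eqF// mul1r.
by rewrite -mulrBr normrM gtr0_norm// ler_wpM2l// ltW.
Qed.

Lemma smooth_tent_approx s h p q t : 0 < s ->
  `|smooth_tent s h p q t - tent h p q t| <= 4 * (s * K).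
Proof.
move=> s0; have a r := ramp_approx r t s0; rewrite /smooth_tent /tent.
have := a p; have := a q; have := a (p + h); have := a (q + h).
rewrite !ler_norml => /andP[? ?] /andP[? ?] /andP[? ?] /andP[? ?].
by apply/andP; split; lra.
Qed.

Lemma smooth_tent_supp s h p q t : 0 < s -> p < q -> 0 < h ->
  smooth_tent s h p q t != 0 -> p <= t <= q + h + 2 * s.
Proof.
move=> s0 pq h0; rewrite /smooth_tent /ramp -!mulrBr => nz.
have t0 (r : R) : t <= r + s -> th (s^-1 * (t - r)) = 0.
  by move=> tr; apply: th0; rewrite ler_pdivrMl//; lra.
have t1 (r : R) : r + 2 * s <= t -> s * th (s^-1 * (t - r)) = t - r.
  by move=> tr; rewrite th1 ?ler_pdivlMl//; [rewrite mulrA divff ?gt_eqF// mul1r|lra].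
apply/andP; split; rewrite leNgt; apply/negP => tp; case/eqP: nz.
  by rewrite !t0 ?mulr0 ?addr0//; lra.
by rewrite !t1; lra.
Qed.

Lemma smooth_tent_cvg (s_ : nat -> R) h p q t : (forall k, 0 < s_ k) ->
  s_ k @[k --> \oo] --> 0 ->
  smooth_tent (s_ k) h p q t @[k --> \oo] --> tent h p q t.
Proof.
move=> s0 s_0; apply/cvgrPdist_le => e e0; near=> k.
rewrite distrC; apply: (le_trans (smooth_tent_approx _ _ _ _ (s0 k))).
have : s_ k < e / (4 * (K + 1)).
  by near: k; apply: (cvgr_lt 0 s_0); rewrite divr_gt0// mulr_gt0// ltr_wpDl.
rewrite ltr_pdivlMr ?mulr_gt0 ?ltr_wpDl// => H.
have := s0 k; lra.
Unshelve. all: by end_near. Qed.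

End smooth_tent.
End tent.

Section increments.
Context {R : realType} {n : nat}.
Local Notation mu := (@lebesgue_row R n).
Local Notation leb := (@lebesgue_measure R).
Variables (i : 'I_n).
Implicit Types (P Q : 'I_n -> R) (Omega : set 'rV[R]_n) (f g : 'rV[R]_n -> R).

Local Notation ei := (delta_mx ord0 i : 'rV[R]_n).
Local Notation slab P Q a :=
  (tensor (upd (fun j => \1_`](P j), (Q j)]%classic : R -> R) i a)).

(** The definition of the weak derivative, tested with a smooth tent in direction i and smooth steps
    in the others, in the limit of vanishing smoothing width. *)
Lemma tent_identity Omega P Q (e h : R) f g : (forall j, P j < Q j) -> 0 < h < e ->
  cbox (fun j => P j - e) (fun j => Q j + e) `<=` Omega ->
  weak_derivative Omega [:: i] f g ->
  let D := cbox (fun j => P j - e) (fun j => Q j + e) in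
  \int[mu]_x ((g \_ D) x * slab P Q (tent h (P i) (Q i)) x) =
  - \int[mu]_x ((f \_ D) x * slab P Q (fun t => \1_`](P i), (Q i)]%classic t -
      \1_`](P i + h), (Q i + h)]%classic t) x).
Proof.
move=> PQ /andP[h0 he] DO fg D.
have [th [B [b [K [[thB Bb sth K1] [[th0 th1 B0 B1] [BK _ _ thK]]]]]]] := @exists_profile R.
have K0 : 0 <= K := le_trans ler01 K1.
have sB := der_smooth1 thB sth.
have [lf lg _] := fg.
have iD F : loc_integrable Omega F -> mu.-integrable setT (EFin \o (F \_ D)).
  move=> lF; apply: integrable_patch; first exact: measurable_cbox.
  by apply: lF => //; exact: compact_cube.
have eh0 : 0 < e - h by rewrite subr_gt0.
(* The tent already reaches h beyond the box, which leaves a margin e - h for the smoothing. *)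
pose s k := (e - h) / 2 / k.+1%:R.
have s0 k : 0 < s k by rewrite !divr_gt0.
have s_le k : 2 * s k <= e - h.
  rewrite /s mulrA [2 * _]mulrC divfK//.
  by rewrite ler_pdivrMr// ler_peMr ?ler1n// ltW.
have s_0 : s k @[k --> \oo] --> 0.
  rewrite -[X in _ --> X](mulr0 ((e - h) / 2)).
  by apply: cvgM; [exact: cvg_cst|exact: cvg_harmonic].
pose F k := upd (fun j => step B (s k) (P j) (Q j)) i (smooth_tent th (s k) h (P i) (Q i)).
pose F' k := upd (fun j => step B (s k) (P j) (Q j)) i
  (fun t => step B (s k) (P i) (Q i) t - step B (s k) (P i + h) (Q i + h) t).
have sF k j : smooth1 (F k j).
  rewrite /F /upd; case: ifP => _; first exact: smooth1_tent.
  exact: smooth1_step.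
have suppF k j t : F k j t != 0 -> P j - e <= t <= Q j + e.
  rewrite /F /upd; case: (j =P i) => [->|_].
    move=> /(smooth_tent_supp th0 th1 (s0 k) (PQ i) h0) /andP[? ?].
    by have sk := s_le k; apply/andP; split; lra.
  move=> /(step_supp B0 B1 (s0 k) (PQ j)) /andP[? ?].
  by have sk := s_le k; apply/andP; split; lra.
have suppF' k j t : F' k j t != 0 -> P j - e <= t <= Q j + e.
  have sk := s_le k.
  rewrite /F' /upd; case: (j =P i) => [->|_]; last first.
    by move=> /(step_supp B0 B1 (s0 k) (PQ j)) /andP[? ?]; apply/andP; split; lra.
  have [z|nz] := eqVneq (step B (s k) (P i) (Q i) t) 0.
    rewrite z sub0r oppr_eq0.
    move=> /(step_supp B0 B1 (s0 k)); rewrite ltrD2r => /(_ (PQ i)) /andP[? ?].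
    by apply/andP; split; lra.
  by have /andP[? ?] := step_supp B0 B1 (s0 k) (PQ i) nz; move=> _; apply/andP; split; lra.
have E k : \int[mu]_x ((f \_ D) x * tensor (F' k) x) = - \int[mu]_x ((g \_ D) x * tensor (F k) x).
  have dF : der (F k i) (fun t => step B (s k) (P i) (Q i) t - step B (s k) (P i + h) (Q i + h) t).
    rewrite /F /upd eqxx; apply: der_tent => //.
    by rewrite gt_eqF.
  have := weak_derivative1_tensor (sF k) (suppF k) DO fg dF.
  have -> : upd (F k) i (fun t => step B (s k) (P i) (Q i) t -
      step B (s k) (P i + h) (Q i + h) t) = F' k.
    by apply/funext => j; rewrite /F /F' /upd; case: (j == i).
  under eq_Rintegral do rewrite (patch_tensor _ _ (suppF' k) DO).
  by under [in X in _ = - X -> _]eq_Rintegral do rewrite (patch_tensor _ _ (suppF k) DO).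
have mi (p q : R) : measurable_fun setT (\1_`]p, q]%classic : R -> R).
  by apply: measurable_indic; exact: measurable_itv.
have cg : \int[mu]_x ((g \_ D) x * tensor (F k) x) @[k --> \oo] -->
    \int[mu]_x ((g \_ D) x * slab P Q (tent h (P i) (Q i)) x).
  apply: (@tensor_dominated_cvg _ _ _ _ _ (K + K + (h + 4 * ((e - h) * K)))) => //.
  - exact: iD.
  - by move=> k j; apply: continuous_measurable_fun; exact: (sF k j 0%N).
  - by move=> j; rewrite /upd; case: ifP => // _; exact: measurable_tent.
  - move=> k j t; rewrite /F /upd.
    have X0 : 0 <= (e - h) * K by rewrite mulr_ge0// ltW.
    case: ifP => _; last by apply: (le_trans (step_bound BK _ _ _ _)); lra.
    have := smooth_tent_approx thK h (P i) (Q i) t (s0 k).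
    have := tent_ge0 t h0 (PQ i); have := tent_le t h0 (PQ i).
    have : s k * K <= (e - h) * K.
      by rewrite ler_wpM2r//; have := s_le k; have := s0 k; lra.
    rewrite !ler_norml => ? ? ? /andP[? ?]; apply/andP; split; lra.
  - apply/nearW => x j; rewrite /F /upd; case: ifP => _; last exact: step_cvg.
    by apply: smooth_tent_cvg; [exact: K0|exact: thK|exact: s0|exact: s_0].
have cf : \int[mu]_x ((f \_ D) x * tensor (F' k) x) @[k --> \oo] -->
    \int[mu]_x ((f \_ D) x * slab P Q (fun t => \1_`](P i), (Q i)]%classic t -
      \1_`](P i + h), (Q i + h)]%classic t) x).
  apply: (@tensor_dominated_cvg _ _ _ _ _ (K + K + (K + K))) => //.
  - exact: iD.
  - move=> k j; apply: continuous_measurable_fun; rewrite /F' /upd; case: ifP => _.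
      move=> t; apply: cvgB; exact: (smooth1_step sB _ _ _ 0%N).
    exact: (smooth1_step sB _ _ _ 0%N).
  - by move=> j; rewrite /upd; case: ifP => // _; exact: measurable_funB.
  - move=> k j t; rewrite /F' /upd; case: ifP => _; last first.
      by apply: (le_trans (step_bound BK _ _ _ _)); lra.
    by apply: (le_trans (ler_normB _ _)); apply: lerD; exact: step_bound.
  - apply/nearW => x j; rewrite /F' /upd; case: ifP => _; last exact: step_cvg.
    by apply: cvgB; apply: step_cvg => //; rewrite ltrD2r.
apply: (cvg_unique _ cg); first exact: Rhausdorff.
apply: cvg_trans (cvgN cf); apply: near_eq_cvg.
by apply/nearW => k /=; rewrite fctE E opprK.
Qed.

Let hei (h : R) (x : 'rV[R]_n) j : (x + h *: ei) ord0 j = x ord0 j + (if j == i then h else 0).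
Proof. by rewrite !mxE eqxx /=; case: eqP => _; rewrite ?mulr1 ?mulr0. Qed.

Lemma slab_shift P Q (h : R) (x : 'rV[R]_n) :
  slab P Q (fun t => \1_`](P i), (Q i)]%classic (t - h)) x = \1_(box P Q) (x - h *: ei).
Proof.
rewrite -tensor_indic tensor_upd /tensor [in RHS](bigD1 i)//.
rewrite -scaleNr hei eqxx; congr (_ * _).
by apply: eq_bigr => j /negbTE ji; rewrite hei ji addr0.
Qed.

Lemma indic_shift (p q h t : R) :
  (\1_`](p + h), (q + h)]%classic t : R) = \1_`]p, q]%classic (t - h).
Proof.
rewrite !indicE; congr ((nat_of_bool _)%:R).
by apply/idP/idP => /set_mem; rewrite /= !in_itv/= => /andP[? ?];
  apply/mem_set; rewrite /= in_itv/=; apply/andP; split; lra.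
Qed.

Lemma slab_sub P Q (a b : R -> R) (x : 'rV[R]_n) :
  slab P Q (fun t => a t - b t) x = slab P Q a x - slab P Q b x.
Proof. by rewrite !tensor_upd mulrBl. Qed.

(** The formula f(x + h e_i) - f(x) = int_0^h g(x + s e_i) ds, integrated over a box. A translation
    of the first term turns the increment of [f] into the difference of two indicators that stands
    in [tent_identity]. *)
Lemma increment_identity Omega P Q (e h : R) f g : (forall j, P j < Q j) -> 0 < h < e ->
  cbox (fun j => P j - e) (fun j => Q j + e) `<=` Omega ->
  weak_derivative Omega [:: i] f g ->
  let D := cbox (fun j => P j - e) (fun j => Q j + e) in
  \int[mu]_(x in box P Q) ((f \_ D) (x + h *: ei) - (f \_ D) x) =
  \int[mu]_x ((g \_ D) x * slab P Q (tent h (P i) (Q i)) x).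
Proof.
move=> PQ h0e DO fg D; have /andP[h0 he] := h0e; rewrite (tent_identity PQ h0e DO fg) -/D.
have [lf _ _] := fg.
have iD : mu.-integrable setT (EFin \o (f \_ D)).
  apply: integrable_patch; first exact: measurable_cbox.
  by apply: lf => //; exact: compact_cube.
have mD : measurable_fun setT (f \_ D) by apply/measurable_EFinP; exact: measurable_int iD.
have mB : measurable (box P Q) by exact: measurable_box.
have m1 : measurable_fun setT (\1_(box P Q) : 'rV[R]_n -> R) by exact: measurable_indic.
have iS := integrable_row_shift (h *: ei) iD.
rewrite RintegralB//; [|exact: integrableS iS|exact: integrableS iD].
have iM (G : 'rV[R]_n -> R) : measurable_fun setT G -> (forall x, `|G x| <= 1) ->
    mu.-integrable setT (EFin \o (fun x => (f \_ D) x * G x)).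
  move=> mG G1; rewrite (_ : EFin \o _ = ((EFin \o (f \_ D)) \* (EFin \o G))%E)//.
  by apply: integrableMl => //; exists 1; split => // y y1 x _ /=; exact: le_trans (G1 x) (ltW y1).
have b1 (A : set 'rV[R]_n) x : `|\1_A x : R| <= 1.
  by rewrite indicE; case: (_ \in _); rewrite ?normr1 ?normr0.
have E F : \int[mu]_(x in box P Q) F x = \int[mu]_x (F x * \1_(box P Q) x).
  rewrite Rintegral_mkcond; apply: eq_Rintegral => x _.
  by rewrite /patch indicE; case: ifP => _; rewrite ?mulr1 ?mulr0.
have m2 : measurable_fun setT (fun x : 'rV[R]_n => (\1_(box P Q) (x - h *: ei) : R)).
  by apply: (measurableT_comp m1); exact: measurable_row_shift.
have A : \int[mu]_(x in box P Q) (f \_ D) (x + h *: ei) =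
    \int[mu]_x ((f \_ D) x * \1_(box P Q) (x - h *: ei)).
  rewrite E -[RHS](Rintegral_row_shift (h *: ei)); last exact: measurable_funM.
  by apply: eq_Rintegral => x _; rewrite addrK.
rewrite A E -opprB; congr (- _).
rewrite -RintegralB//; [|exact: iM|exact: iM].
apply: eq_Rintegral => x _; rewrite -mulrBr; congr (_ * _).
have -> : (\1_(box P Q) x : R) = slab P Q (\1_`](P i), (Q i)]%classic) x.
  by rewrite -tensor_indic; congr (tensor _ x); apply/funext => j; rewrite /upd; case: (j =P i) => [->|].
by rewrite slab_sub -slab_shift !tensor_upd indic_shift.
Qed.

Lemma measurable_line : measurable_fun setT
  (fun z : ('rV[R]_n * measurableTypeR R)%type => z.1 + (z.2 : R) *: ei).
Proof.
apply: measurable_rowP => j; under eq_fun do rewrite hei.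
apply: measurable_funD; first by apply: (measurableT_comp (measurable_coor j)); exact: measurable_fst.
by case: (j == i); [exact: measurable_snd|exact: measurable_cst].
Qed.

(** Tonelli's theorem, followed by the translation of x by s e_i: integrating the translated
    indicators in s produces the tent. *)
Lemma tonelli_slab P Q (h : R) (G : 'rV[R]_n -> R) : (forall j, P j < Q j) -> 0 < h ->
  measurable_fun setT G -> (forall x, 0 <= G x) ->
  (\int[mu]_(x in box P Q) \int[leb]_(s in `[0%R, h[) (G (x + s *: ei))%:E =
   \int[mu]_x (G x * slab P Q (tent h (P i) (Q i)) x)%:E)%E.
Proof.
move=> PQ h0 mG G0.
have mB : measurable (box P Q) by exact: measurable_box.
have mI : measurable (`[0, h[%classic : set R) by exact: measurable_itv.
have m1 : measurable_fun setT (\1_(box P Q) : 'rV[R]_n -> R) by exact: measurable_indic.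
have m2 : measurable_fun setT (\1_`[0, h[%classic : R -> R) by exact: measurable_indic.
pose H1 (z : ('rV[R]_n * measurableTypeR R)%type) : \bar R :=
  (\1_(box P Q) z.1 * \1_`[0, h[%classic (z.2 : R) * G (z.1 + (z.2 : R) *: ei))%:E.
pose H2 (z : ('rV[R]_n * measurableTypeR R)%type) : \bar R :=
  (\1_(box P Q) (z.1 - (z.2 : R) *: ei) * \1_`[0, h[%classic (z.2 : R) * G z.1)%:E.
have ind0 (T : Type) (A : set T) x : 0 <= \1_A x :> R by rewrite indicE.
have H10 z : (0 <= H1 z)%E by rewrite lee_fin !mulr_ge0.
have H20 z : (0 <= H2 z)%E by rewrite lee_fin !mulr_ge0.
have mH1 : measurable_fun setT H1.
  apply/measurable_EFinP; apply: measurable_funM; first apply: measurable_funM.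
  - exact: (measurableT_comp m1 measurable_fst).
  - exact: (measurableT_comp m2 measurable_snd).
  - exact: (measurableT_comp mG measurable_line).
have mlineN : measurable_fun setT
    (fun z : ('rV[R]_n * measurableTypeR R)%type => z.1 - (z.2 : R) *: ei).
  apply: measurable_rowP => j; under eq_fun do rewrite -scaleNr hei.
  apply: measurable_funD; first by apply: (measurableT_comp (measurable_coor j)); exact: measurable_fst.
  case: (j == i); last exact: measurable_cst.
  by apply: measurable_funN; exact: measurable_snd.
have mH2 : measurable_fun setT H2.
  apply/measurable_EFinP; apply: measurable_funM; first apply: measurable_funM.
  - exact: (measurableT_comp m1 mlineN).
  - exact: (measurableT_comp m2 measurable_snd).
  - exact: (measurableT_comp mG measurable_fst).
transitivity (\int[mu]_x \int[leb]_s H1 (x, s))%E.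
  rewrite integral_mkcond; apply: eq_integral => x _; rewrite /patch.
  rewrite /H1 /= indicE; case: ifP => xPQ; last first.
    by rewrite integral0_eq// => s _; rewrite !mul0r.
  rewrite integral_mkcond; apply: eq_integral => s _; rewrite /patch indicE mul1r.
  by case: ifP => _; rewrite ?mul1r ?mul0r.
rewrite (@fubini_tonelli _ _ _ _ _ mu leb H1 mH1 H10).
transitivity (\int[leb]_s \int[mu]_x H2 (x, s))%E.
  apply: eq_integral => s _.
  rewrite -[RHS](ge0_integral_row_shift (s *: ei)) => [||x //].
    by apply: eq_integral => x _; rewrite /H1 /H2 /= addrK.
  exact: (measurable_fun_pair1 s mH2).
rewrite -(@fubini_tonelli _ _ _ _ _ mu leb H2 mH2 H20).
apply: eq_integral => x _.
set c := \prod_(j | j != i) \1_`](P j), (Q j)]%classic (x ord0 j) : R.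
have c0 : 0 <= c by apply: prodr_ge0.
transitivity (\int[leb]_(s in `[0%R, h[)
    ((G x * c)%:E * (\1_`](P i), (Q i)]%classic (x ord0 i - s))%:E))%E.
  rewrite [RHS]integral_mkcond; apply: eq_integral => s _.
  rewrite /H2 /= -slab_shift tensor_upd -/c /patch [X in _ * X * _]indicE.
  by case: ifP => _; [rewrite -EFinM mulr1; congr _%:E; ring|rewrite mulr0 mul0r].
rewrite ge0_integralZl//; last 2 first.
- apply: measurable_funTS; apply/measurable_EFinP; apply: measurableT_comp.
    by apply: measurable_indic; exact: measurable_itv.
  exact: measurable_funB.
- by rewrite lee_fin mulr_ge0.
by rewrite integral_tent// -EFinM tensor_upd -/c; congr _%:E; ring.
Qed.

Lemma slab_tent_bound P Q (h : R) x : (forall j, P j < Q j) -> 0 < h ->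
  0 <= slab P Q (tent h (P i) (Q i)) x <= h.
Proof.
move=> PQ h0; rewrite tensor_upd mulr_ge0 ?tent_ge0//=; last first.
  by apply: prodr_ge0 => j _; rewrite indicE.
rewrite -[leRHS]mulr1 ler_pM ?tent_ge0 ?tent_le//; first by apply: prodr_ge0 => j _; rewrite indicE.
by apply: prodr_ile1 => j; rewrite indicE; case: (_ \in _); rewrite /= ?lexx ?ler01.
Qed.

Lemma integrable_slab_tent P Q (h : R) (F : 'rV[R]_n -> R) : (forall j, P j < Q j) -> 0 < h ->
  mu.-integrable setT (EFin \o F) ->
  mu.-integrable setT (EFin \o (fun x => F x * slab P Q (tent h (P i) (Q i)) x)).
Proof.
move=> PQ h0 iF; set U := slab _ _ _.
rewrite (_ : EFin \o _ = ((EFin \o F) \* (EFin \o U))%E)//.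
apply: integrableMl => //.
  apply: measurable_tensor => j; rewrite /upd; case: ifP => _; first exact: measurable_tent.
  by apply: measurable_indic; exact: measurable_itv.
exists h; split; first exact: num_real.
move=> y hy x _ /=; have /andP[u0 uh] := slab_tent_bound x PQ h0.
by rewrite ger0_norm// (le_trans uh)// ltW.
Qed.

(** Both sides see only the enlarged box inside [D]; hence a single [D] serves for all sub-boxes of
    a rational box. *)
Lemma increment_identity_on Omega P Q (e h : R) f g D : (forall j, P j < Q j) -> 0 < h < e ->
  cbox (fun j => P j - e) (fun j => Q j + e) `<=` D -> D `<=` Omega ->
  weak_derivative Omega [:: i] f g ->
  \int[mu]_(x in box P Q) ((f \_ D) (x + h *: ei) - (f \_ D) x) =
  \int[mu]_x ((g \_ D) x * slab P Q (tent h (P i) (Q i)) x).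
Proof.
move=> PQ h0e D'D DO fg; have /andP[h0 he] := h0e.
have := increment_identity PQ h0e (subset_trans D'D DO) fg.
set D' := cbox _ _ in D'D * => E.
transitivity (\int[mu]_(x in box P Q) ((f \_ D') (x + h *: ei) - (f \_ D') x)).
  apply: eq_Rintegral => x /set_mem xPQ.
  have x1 : D' x.
    by move=> j; have := xPQ j; rewrite /= !in_itv/= => /andP[? ?]; apply/andP; split; lra.
  have x2 : D' (x + h *: ei).
    move=> j; have := xPQ j; rewrite /= !in_itv/= hei => /andP[? ?].
    by case: (j == i); apply/andP; split; lra.
  by rewrite /patch !mem_set//; exact: D'D.
rewrite E; apply: eq_Rintegral => x _; apply/esym/patch_tensor => // j t.
rewrite /upd; case: (j =P i) => [->|_].
  rewrite tentE// => nz; have m0 : 0 < Num.min h (t - P i) - Num.max 0 (t - Q i).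
    by rewrite ltNge; apply: contra nz => /max_l ->.
  have m1 : Num.min h (t - P i) <= h by rewrite ge_min lexx.
  have m2 : Num.min h (t - P i) <= t - P i by rewrite ge_min lexx orbT.
  have m3 : 0 <= Num.max 0 (t - Q i) by rewrite le_max lexx.
  have m4 : t - Q i <= Num.max 0 (t - Q i) by rewrite le_max lexx orbT.
  by apply/andP; split; lra.
rewrite indicE; case: (boolP (_ \in _)) => [/set_mem|_]; last by rewrite eqxx.
by rewrite /= in_itv/= => /andP[? ?] _; apply/andP; split; lra.
Qed.

Section chain_rule.
Variables (Omega : set 'rV[R]_n) (m : nat).
Hypothesis oO : open Omega.

Let loc_int_patch P Q f : cbox P Q `<=` Omega -> loc_integrable Omega f ->
  mu.-integrable setT (EFin \o (f \_ (cbox P Q))).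
Proof.
move=> PQO lf; apply: integrable_patch; first exact: measurable_cbox.
by apply: lf => //; exact: compact_cube.
Qed.

(** Despite the name it is not divided by [h]. Where the integral is infinite, on a null set for
    integrable [g], [fine] gives the value 0. *)
Definition line_average (g : 'rV[R]_n -> R) (h : R) (x : 'rV[R]_n) : R :=
  fine (\int[leb]_(s in `[0%R, h[) (`|g (x + s *: ei)|)%:E)%E.

Lemma line_averageP (g : 'rV[R]_n -> R) P Q (h : R) : mu.-integrable setT (EFin \o g) ->
  (forall j, P j < Q j) -> 0 < h ->
  mu.-integrable (box P Q) (EFin \o line_average g h) /\
  \int[mu]_(x in box P Q) line_average g h x =
  \int[mu]_x (`|g x| * slab P Q (tent h (P i) (Q i)) x).
Proof.
move=> ig PQ h0; have mB : measurable (box P Q) by exact: measurable_box.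
have mg : measurable_fun setT g by apply/measurable_EFinP; exact: measurable_int ig.
have mag : measurable_fun setT (fun x => `|g x|) by exact: measurableT_comp.
pose F x := (\int[leb]_(s in `[0%R, h[) (`|g (x + s *: ei)|)%:E)%E.
have F0 x : (0 <= F x)%E by exact: integral_ge0.
have FE := tonelli_slab PQ h0 mag (fun x => normr_ge0 _).
have mF : measurable_fun setT F.
  pose H (z : ('rV[R]_n * measurableTypeR R)%type) : \bar R :=
    (\1_`[0, h[%classic (z.2 : R) * `|g (z.1 + (z.2 : R) *: ei)|)%:E.
  have mH : measurable_fun setT H.
    apply/measurable_EFinP; apply: measurable_funM.
      by apply: (measurableT_comp _ measurable_snd); apply: measurable_indic; exact: measurable_itv.
    exact: (measurableT_comp mag measurable_line).
  have H0 z : (0 <= H z)%E by rewrite lee_fin mulr_ge0// indicE.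
  rewrite (_ : F = fun x => (\int[leb]_s H (x, s))%E).
    exact: (@measurable_fun_fubini_tonelli_F _ _ _ _ _ _ _ mH).
  apply/funext => x; rewrite /F integral_mkcond; apply: eq_integral => s _.
  by rewrite /H /patch/= indicE; case: ifP => _; rewrite ?mul1r ?mul0r.
have sl0 x := slab_tent_bound x PQ h0.
have iU : mu.-integrable setT (EFin \o (fun x => `|g x| * slab P Q (tent h (P i) (Q i)) x)).
  by apply: integrable_slab_tent => //; exact: (integrable_abse ig).
have FE' : (\int[mu]_(x in box P Q) F x = \int[mu]_x (`|g x| * slab P Q (tent h (P i) (Q i)) x)%:E)%E.
  exact: FE.
have iF : mu.-integrable (box P Q) F.
  apply/integrableP; split; first exact: measurable_funTS.
  under eq_integral do rewrite gee0_abs//.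
  rewrite FE'; have := integrable_fin_num measurableT iU.
  by rewrite ge0_fin_numE// integral_ge0// => x _; rewrite lee_fin mulr_ge0//; case/andP: (sl0 x).
have iF' := (integrable_mkcond F mB).1 iF.
have [i1 e1] := integrable_fine iF'.
have pE : fine \o (F \_ (box P Q)) = line_average g h \_ (box P Q).
  by apply/funext => x; rewrite /patch /=; case: ifP.
split.
  by apply/(integrable_mkcond _ mB); rewrite restrict_EFin -pE.
rewrite Rintegral_mkcond -pE [LHS]e1 /Rintegral -FE' [in RHS]integral_mkcond.
by congr fine; apply: eq_integral.
Qed.

(** Over each sub-box, [increment_identity_on] and [line_averageP] write both sides as integrals
    against the same nonnegative tent product, of g and of |g|. The signs c = 1 and c = -1 give the
    two halves of the absolute value. *)
Lemma increment_bound (p q : {ffun 'I_n -> rat}) (e h : R) f g :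
  let D := cbox (fun j => ratr (p j) - e) (fun j => ratr (q j) + e) in
  0 < h < e -> D `<=` Omega -> weak_derivative Omega [:: i] f g ->
  {ae mu, forall x, ratbox p q x ->
    `|(f \_ D) (x + h *: ei) - (f \_ D) x| <= line_average (g \_ D) h x}.
Proof.
move=> D h0e DO fg; have /andP[h0 he] := h0e; have [lf lg _] := fg.
have iF := loc_int_patch DO lf; have iG := loc_int_patch DO lg.
have [/forallP pq|] := boolP [forall j, (ratr (p j) : R) < ratr (q j)]; last first.
  rewrite negb_forall => /existsP[j]; rewrite -leNgt => qp.
  apply/nearW => x /(_ j); rewrite /= in_itv/= => /andP[a b].
  by have := lt_le_trans a b; rewrite ltNge qp.
have iS := integrable_row_shift (h *: ei) iF.
have mpq : measurable (ratbox p q : set 'rV[R]_n) by exact: measurable_ratbox.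
have [iL _] := @line_averageP _ (fun j => ratr (p j)) (fun j => ratr (q j)) h iG pq h0.
pose incr x := (f \_ D) (x + h *: ei) - (f \_ D) x.
have iI : mu.-integrable setT (EFin \o incr).
  rewrite (_ : EFin \o _ = (fun x => ((f \_ D) (x + h *: ei)%R)%:E - ((f \_ D) x)%:E)%E)//.
  exact: integrableB.
have key (c : R) : `|c| <= 1 ->
    {ae mu, forall x, ratbox p q x -> 0 <= line_average (g \_ D) h x - c * incr x}.
  move=> c1; have icI : mu.-integrable setT (EFin \o (fun x => c * incr x)) by exact: integrable_EFinZ.
  apply: ae_ge0_on_ratbox.
    rewrite (_ : EFin \o _ = (fun x => (line_average (g \_ D) h x)%:E - ((c * incr x)%R)%:E)%E)//.
    by apply: integrableB => //; exact: integrableS icI.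
  move=> P Q pP PQ Qq; have mB := measurable_box P Q.
  have [iL' EL] := line_averageP iG PQ h0.
  rewrite RintegralB//; last exact: integrableS icI.
  rewrite RintegralZl//; last exact: integrableS iI.
  have D'D : cbox (fun j => P j - e) (fun j => Q j + e) `<=` D.
    move=> x hx j; have := hx j; have := pP j; have := Qq j; rewrite /= !in_itv/= => ? ? /andP[? ?].
    by apply/andP; split; lra.
  rewrite EL (increment_identity_on PQ h0e D'D DO fg) subr_ge0 -RintegralZl//; last first.
    exact: integrable_slab_tent.
  apply: le_trans (ler_norm _) _; apply: ae_le_normr_Rintegral => //.
    apply: integrable_slab_tent => //; exact: (integrable_abse iG).
  apply/nearW => x _; have /andP[u0 _] := slab_tent_bound x PQ h0.
  by rewrite !normrM (ger0_norm u0) mulrA ler_wpM2r// ler_piMl.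
have k1 : `|1 : R| <= 1 by rewrite normr1.
have k2 : `|-1 : R| <= 1 by rewrite normrN1.
apply: (ae_imp2 (key 1 k1) (key (-1) k2)) => x h1 h2 xpq.
have := h1 xpq; have := h2 xpq; rewrite mul1r mulN1r opprK -/(incr x) => ? ?.
by rewrite ler_norml; apply/andP; split; lra.
Qed.

(* The difference quotients of c are controlled by those of the f k, hence by line
   averages of the g k, which tend to the g k in the mean over boxes. *)
Lemma lipschitz_weak_derivative (f g : 'I_m -> 'rV[R]_n -> R) (c G : 'rV[R]_n -> R)
    (S : set 'rV[R]_n) (L : R) : 0 <= L ->
  (forall k, weak_derivative Omega [:: i] (f k) (g k)) -> weak_derivative Omega [:: i] c G ->
  {ae mu, forall x, Omega x -> S x} ->
  (forall x y, S x -> S y -> `|c x - c y| <= L * \sum_k `|f k x - f k y|) ->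
  {ae mu, forall x, Omega x -> `|G x| <= L * \sum_k `|g k x|}.
Proof.
move=> L0 fg cG OS cf; apply: ae_inner_ratbox => // p q [e e0 DO].
set D := cube _ in DO.
have [lc lG _] := cG; have iG := loc_int_patch DO lG; have iC := loc_int_patch DO lc.
have ig k : mu.-integrable setT (EFin \o (g k \_ D)) by have [_ lg _] := fg k; exact: loc_int_patch.
pose gD x := \sum_k `|(g k \_ D) x|.
have igD : mu.-integrable setT (EFin \o gD).
  by apply: (Rintegral_sum _ _).1 => // k; exact: (integrable_abse (ig k)).
have key P Q h : (forall j, ratr (p j) <= P j) -> (forall j, P j < Q j) ->
    (forall j, Q j <= ratr (q j)) -> 0 < h < e ->
    `|\int[mu]_x ((G \_ D) x * slab P Q (tent h (P i) (Q i)) x)| <=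
    L * \int[mu]_x (gD x * slab P Q (tent h (P i) (Q i)) x).
  move=> pP PQ Qq h0e; have /andP[h0 he] := h0e; have mB := measurable_box P Q.
  have D'D : cbox (fun j => P j - e) (fun j => Q j + e) `<=` D.
    move=> x hx j; have := hx j; have := pP j; have := Qq j; rewrite /= !in_itv/= => ? ? /andP[? ?].
    by apply/andP; split; lra.
  rewrite -(increment_identity_on PQ h0e D'D DO cG).
  have iL k := (line_averageP (ig k) PQ h0).1.
  have [isL EL] := Rintegral_sum mB iL.
  have -> : L * \int[mu]_x (gD x * slab P Q (tent h (P i) (Q i)) x) =
      \int[mu]_(x in box P Q) (L * \sum_k line_average (g k \_ D) h x).
    rewrite RintegralZl//; congr (_ * _); rewrite EL.
    under [in RHS]eq_bigr do rewrite (line_averageP (ig _) PQ h0).2.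
    under eq_Rintegral do rewrite mulr_suml.
    apply: (Rintegral_sum _ _).2 => // k.
    by apply: integrable_slab_tent => //; exact: (integrable_abse (ig k)).
  apply: ae_le_normr_Rintegral => //.
    rewrite (_ : EFin \o _ = (fun x => L%:E * ((\sum_k line_average (g k \_ D) h x)%R)%:E)%E)//.
    exact: integrableZl.
  have incr : {ae mu, forall x, forall k, ratbox p q x ->
      `|(f k \_ D) (x + h *: ei) - (f k \_ D) x| <= line_average (g k \_ D) h x}.
    by apply: filter_forall => k; exact: increment_bound h0e DO (fg k).
  (* The translated point must lie in [S] too; null sets are invariant under translations. *)
  have OSh := @ae_row_shift _ _ (fun x => Omega x -> S x) (h *: ei) OS.
  apply: (ae_imp2 incr (ae_imp2 OS OSh (fun x a b => conj a b))) => x incrx [Sx Sxh] xPQ.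
  have xpq : ratbox p q x.
    move=> j; have := xPQ j; have := pP j; have := Qq j; rewrite /= !in_itv/= => ? ? /andP[? ?].
    by apply/andP; split; lra.
  have Dx : D x.
    by apply: D'D => j; have := xPQ j; rewrite /= !in_itv/= => /andP[? ?]; apply/andP; split; lra.
  have Dxh : D (x + h *: ei).
    apply: D'D => j; have := xPQ j; rewrite /= !in_itv/= hei => /andP[? ?].
    by case: (j == i); apply/andP; split; lra.
  have pE (F : 'rV[R]_n -> R) : (F \_ D) x = F x /\ (F \_ D) (x + h *: ei) = F (x + h *: ei).
    by rewrite /patch !mem_set.
  have [-> ->] := pE c; apply: (le_trans (cf _ _ (Sxh (DO _ Dxh)) (Sx (DO _ Dx)))).
  rewrite ler_wpM2l//; apply: ler_sum => k _.
  by have := incrx k xpq; rewrite -/D; have [-> ->] := pE (f k).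
have pos P Q (s : R) : `|s| <= 1 -> (forall j, ratr (p j) <= P j) -> (forall j, P j < Q j) ->
    (forall j, Q j <= ratr (q j)) -> 0 <= \int[mu]_(x in box P Q) (L * gD x - s * (G \_ D) x).
  move=> s1 pP PQ Qq; pose psi x := L * gD x - s * (G \_ D) x.
  have ipsi : mu.-integrable setT (EFin \o psi).
    rewrite (_ : EFin \o _ = (fun x => ((L * gD x)%R)%:E - ((s * (G \_ D) x)%R)%:E)%E)//.
    by apply: integrableB => //; exact: integrable_EFinZ.
  pose h k := e / 2 / k.+1%:R.
  have h0 k : 0 < h k by rewrite !divr_gt0.
  have he k : h k < e.
    rewrite /h ltr_pdivrMr// (@lt_le_trans _ _ e)//; first by lra.
    by rewrite ler_peMr ?ler1n// ltW.
  have h_0 : h k @[k --> \oo] --> 0.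
    rewrite -[X in _ --> X](mulr0 (e / 2)).
    by apply: cvgM; [exact: cvg_cst|exact: cvg_harmonic].
  (* Dividing [key] by h: the scaled tents stay between 0 and 1 and converge to the indicator of ]P
     i, Q i]. *)
  pose F k := upd (fun j => \1_`](P j), (Q j)]%classic : R -> R) i
    (fun t => (h k)^-1 * tent (h k) (P i) (Q i) t).
  have cv : \int[mu]_x (psi x * tensor (F k) x) @[k --> \oo] -->
      \int[mu]_x (psi x * tensor (fun j => \1_`](P j), (Q j)]%classic : R -> R) x).
    apply: (@tensor_dominated_cvg _ _ _ _ _ 1) => //.
    - move=> k j; rewrite /F /upd; case: ifP => _.
        by apply: measurable_funM => //; exact: measurable_tent.
      by apply: measurable_indic; exact: measurable_itv.
    - move=> k j t; rewrite /F /upd; case: ifP => _; last first.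
        by rewrite indicE; case: (_ \in _); rewrite ?normr1 ?normr0.
      rewrite ger0_norm; last by rewrite mulr_ge0 ?invr_ge0 ?tent_ge0// ltW.
      by rewrite ler_pdivrMl// mulr1 tent_le.
    - apply/nearW => x j; rewrite /F /upd; case: (j =P i) => [->|_]; last exact: cvg_cst.
      exact: tent_cvg.
  have -> : \int[mu]_(x in box P Q) psi x =
      \int[mu]_x (psi x * tensor (fun j => \1_`](P j), (Q j)]%classic : R -> R) x).
    rewrite Rintegral_mkcond; apply: eq_Rintegral => x _.
    by rewrite tensor_indic /patch indicE; case: ifP => _; rewrite ?mulr1 ?mulr0.
  apply: (ler_cvg_to (cvg_cst _) cv); apply/nearW => k.
  have hk : 0 < h k < e by rewrite h0 he.
  set U := slab P Q (tent (h k) (P i) (Q i)).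
  have iU H : mu.-integrable setT (EFin \o H) ->
      mu.-integrable setT (EFin \o (fun x => H x * U x)).
    by move=> iH; exact: integrable_slab_tent.
  have -> : \int[mu]_x (psi x * tensor (F k) x) = (h k)^-1 * \int[mu]_x (psi x * U x).
    rewrite -RintegralZl//; last exact: iU.
    by apply: eq_Rintegral => x _; rewrite /U /F !tensor_upd; ring.
  apply: mulr_ge0; first by rewrite invr_ge0 ltW.
  have -> : \int[mu]_x (psi x * U x) =
      L * \int[mu]_x (gD x * U x) - s * \int[mu]_x ((G \_ D) x * U x).
    rewrite -!RintegralZl//; [|exact: iU|exact: iU].
    rewrite -RintegralB//; [|by apply: integrable_EFinZ; exact: iU|by apply: integrable_EFinZ; exact: iU].
    by apply: eq_Rintegral => x _; rewrite /psi; ring.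
  rewrite subr_ge0; apply: le_trans (key P Q (h k) pP PQ Qq hk).
  by apply: (le_trans (ler_norm _)); rewrite normrM ler_piMl.
have ae s : `|s| <= 1 -> {ae mu, forall x, ratbox p q x -> 0 <= L * gD x - s * (G \_ D) x}.
  move=> s1; apply: ae_ge0_on_ratbox => [|P Q pP PQ Qq]; last exact: pos.
  apply: integrableS (subsetT _) _ => //; first exact: measurable_ratbox.
  rewrite (_ : EFin \o _ = (fun x => ((L * gD x)%R)%:E - ((s * (G \_ D) x)%R)%:E)%E)//.
  by apply: integrableB => //; exact: integrable_EFinZ.
have k1 : `|1 : R| <= 1 by rewrite normr1.
have k2 : `|-1 : R| <= 1 by rewrite normrN1.
apply: (ae_imp2 (ae 1 k1) (ae (-1) k2)) => x h1 h2 xpq.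
have Dx : D x.
  by move=> j; have := xpq j; rewrite /= !in_itv/= => /andP[? ?]; apply/andP; split; lra.
have := h1 xpq; have := h2 xpq; rewrite mul1r mulN1r opprK /gD.
under eq_bigr do rewrite /patch mem_set//; rewrite /patch mem_set// => ? ?.
by rewrite ler_norml; apply/andP; split; lra.
Qed.

End chain_rule.

End increments.

(** * Bounds uniform in time *)

Section norm2_extra.
Context d (T : measurableType d) (R : realType) (mu : {measure set T -> \bar R}).

Lemma norm2_sum (I : Type) (r : seq I) (F : I -> T -> R) : (forall k, sqi mu (F k)) ->
  sqi mu (fun x => \sum_(k <- r) F k x) /\
  norm2 mu (fun x => \sum_(k <- r) F k x) <= \sum_(k <- r) norm2 mu (F k).
Proof.
move=> sF; elim: r => [|k r [sr nr]].
  under eq_fun do rewrite big_nil.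
  have m0 : measurable_fun setT (cst 0 : T -> R) by [].
  have [||s0 n0] := @sqi_indic _ _ _ mu 0 set0 (cst 0) measurable0 _ m0.
  - by rewrite measure0.
  - by move=> x; rewrite normr0 mul0r.
  by split => //; rewrite big_nil; apply: le_trans n0 _; rewrite mul0r.
under eq_fun do rewrite big_cons.
split; first exact: sqiD.
by rewrite big_cons; apply: (le_trans (norm2D (sF k) sr)); rewrite lerD2l.
Qed.

Lemma norm2_dist f g : sqi mu f -> sqi mu g ->
  `|norm2 mu f - norm2 mu g| <= norm2 mu (fun x => f x - g x).
Proof.
move=> sf sg.
have A (a b : T -> R) : sqi mu a -> sqi mu b -> norm2 mu a - norm2 mu b <= norm2 mu (fun x => a x - b x).
  move=> sa sb; rewrite lerBlDr; apply: le_trans (norm2D (sqiB sa sb) sb).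
  by rewrite (_ : (fun x => a x - b x + b x) = a)//; apply/funext => x; rewrite subrK.
rewrite ler_norml lerNl opprB A//= andbT; apply: (le_trans (A _ _ sg sf)).
rewrite -[leRHS](norm2N) (_ : (fun x => - (f x - g x)) = (fun x => g x - f x))//.
by apply/funext => x; rewrite opprB.
Qed.

Lemma norm2_scale_le (c : R) f : 0 <= c -> sqi mu f ->
  sqi mu (fun x => c * f x) /\ norm2 mu (fun x => c * f x) = c * norm2 mu f.
Proof.
move=> c0 [mf if2]; split.
  split; first exact: measurable_funM.
  under [X in EFin \o X]eq_fun do rewrite exprMn.
  exact: integrable_EFinZ.
rewrite /norm2; under eq_Rintegral do rewrite exprMn.
by rewrite RintegralZl// sqrtrM ?sqr_ge0// sqrtr_sqr ger0_norm.
Qed.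

End norm2_extra.

Section time_bounds.
Context {R : realType} {n : nat}.
Local Notation mu := (@lebesgue_row R n).
Variable Omega : set 'rV[R]_n.
Hypothesis oO : open Omega.
Local Notation field := ('rV[R]_n -> 'cV[R]_3).
Local Notation wp s v j := (weak_partial Omega s (fun y => v y j ord0)).

Let mO : measurable Omega. Proof. exact: open_measurable_row. Qed.

(** One square integrable majorant for the value, the first derivatives and the Laplacian, so that a
    single estimate treats all five terms of the weak formulation. The value is represented by the
    derivative of order 0, almost everywhere equal to it, whose norm is bounded like the others. *)
Definition dominant (v : field) (x : 'rV[R]_n) : R :=
  \sum_j (`|wp [::] v j x| + \sum_i `|wp [:: i] v j x| + \sum_i `|wp [:: i; i] v j x|).

Lemma dominant_ge (v : field) x j :
  [/\ `|wp [::] v j x| <= dominant v x, forall i, `|wp [:: i] v j x| <= dominant v x,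
      \sum_i `|wp [:: i] v j x| <= dominant v x & \sum_i `|wp [:: i; i] v j x| <= dominant v x].
Proof.
have s1 k : 0 <= \sum_i `|wp [:: i] v k x| by apply: sumr_ge0.
have s2 k : 0 <= \sum_i `|wp [:: i; i] v k x| by apply: sumr_ge0.
have le : `|wp [::] v j x| + \sum_i `|wp [:: i] v j x| + \sum_i `|wp [:: i; i] v j x| <=
    dominant v x.
  rewrite /dominant [leRHS](bigD1 j)//= lerDl; apply: sumr_ge0 => k _.
  by rewrite !addr_ge0.
have n0 := normr_ge0 (wp [::] v j x); have := s1 j; have := s2 j => s2j s1j.
split=> [|i||]; [lra| |lra|lra].
have : `|wp [:: i] v j x| <= \sum_i `|wp [:: i] v j x|.
  by rewrite [leRHS](bigD1 i)//= lerDl; apply: sumr_ge0.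
lra.
Qed.

Lemma dominant_norm2 (v : field) (H : R) : Hk Omega 2 v ->
  (forall s j, (size s <= 2)%N -> norm2 mu (wp s v j \_ Omega) <= H) ->
  sqi mu (dominant v \_ Omega) /\
  norm2 mu (dominant v \_ Omega) <= 3 * ((1 + 2 * n%:R) * H).
Proof.
move=> Hv HH.
have sw s j : (size s <= 2)%N -> sqi mu (fun x => `|(wp s v j \_ Omega) x|).
  by move=> s2; apply: sqi_norm; have [] := Hk_weak_partial oO j Hv s2.
have nw s j : (size s <= 2)%N -> norm2 mu (fun x => `|(wp s v j \_ Omega) x|) <= H.
  by move=> s2; rewrite norm2_norm; exact: HH.
have E : dominant v \_ Omega = fun x => \sum_j (`|(wp [::] v j \_ Omega) x| +
    \sum_i `|(wp [:: i] v j \_ Omega) x| + \sum_i `|(wp [:: i; i] v j \_ Omega) x|).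
  apply/funext => x; rewrite /patch /dominant; case: ifP => // _.
  apply/esym/big1 => j _; rewrite normr0 !big1 ?addr0// => i _; rewrite normr0//.
rewrite E.
have A (s : 'I_n -> seq 'I_n) : (forall i, size (s i) <= 2)%N -> forall j,
    sqi mu (fun x => \sum_i `|(wp (s i) v j \_ Omega) x|) /\
    norm2 mu (fun x => \sum_i `|(wp (s i) v j \_ Omega) x|) <= n%:R * H.
  move=> s2 j; have [i|a b] := @norm2_sum _ _ _ mu _ (index_enum 'I_n)
    (fun i x => `|(wp (s i) v j \_ Omega) x|); first exact: sw.
  split=> //; apply: (le_trans b); apply: (@le_trans _ _ (\sum_(i < n) H)).
    by apply: ler_sum => i _; exact: nw.
  by rewrite sumr_const card_ord mulr_natl.
have s1 j := (A (fun i => [:: i]) (fun=> isT) j).1.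
have n1 j := (A (fun i => [:: i]) (fun=> isT) j).2.
have s2 j := (A (fun i => [:: i; i]) (fun=> isT) j).1.
have n2 j := (A (fun i => [:: i; i]) (fun=> isT) j).2.
have s0 j := sw [::] j isT; have n0 j := nw [::] j isT.
have sj j := sqiD (sqiD (s0 j) (s1 j)) (s2 j).
have [sS nS] := @norm2_sum _ _ _ mu _ (index_enum 'I_3) _ sj.
split; first exact: sS.
apply: (le_trans nS); apply: (@le_trans _ _ (\sum_(j < 3) ((1 + 2 * n%:R) * H))).
  apply: ler_sum => j _; apply: (le_trans (norm2D (sqiD (s0 j) (s1 j)) (s2 j))).
  have := norm2D (s0 j) (s1 j); have := n0 j; have := n1 j; have := n2 j; lra.
by rewrite sumr_const card_ord -[leLHS]mulr_natl.
Qed.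

Lemma L2_dot_bound k l (A B : 'rV[R]_n -> 'M[R]_(k, l)) (p q : 'rV[R]_n -> R) :
  sqi mu (p \_ Omega) -> sqi mu (q \_ Omega) ->
  {ae mu, forall x, Omega x -> forall i j, `|A x i j| <= p x} ->
  {ae mu, forall x, Omega x -> forall i j, `|B x i j| <= q x} ->
  `|L2_dot Omega A B| <= (k * l)%:R * (norm2 mu (p \_ Omega) * norm2 mu (q \_ Omega)).
Proof.
move=> sp sq Ap Bq.
have ipq := sqi_integrableM sp sq.
have pqE : (fun x => (p \_ Omega) x * (q \_ Omega) x) = (fun x => p x * q x) \_ Omega.
  by apply/funext => x; rewrite /patch; case: ifP; rewrite ?mulr0.
have iO : mu.-integrable Omega (EFin \o (fun x => p x * q x)).
  by apply/(integrable_mkcond _ mO); rewrite restrict_EFin -pqE.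
apply: (@le_trans _ _ (\int[mu]_(x in Omega) ((k * l)%:R * (p x * q x)))).
  apply: ae_le_normr_Rintegral => //.
    rewrite (_ : EFin \o _ = (fun x => ((k * l)%:R)%:E * ((p x * q x)%R)%:E)%E)//.
    exact: integrableZl.
  apply: (ae_imp2 Ap Bq) => x hA hB Ox; have {}hA := hA Ox; have {}hB := hB Ox.
  rewrite /frob; apply: (le_trans (ler_norm_sum _ _ _)).
  apply: (@le_trans _ _ (\sum_(i < k) \sum_(j < l) (p x * q x))).
    apply: ler_sum => i _; apply: (le_trans (ler_norm_sum _ _ _)); apply: ler_sum => j _.
    by rewrite normrM ler_pM.
  by rewrite !sumr_const !card_ord -mulrnA mulr_natl mulnC.
rewrite RintegralZl// ler_wpM2l//.
rewrite Rintegral_mkcond -pqE; apply: le_trans (ler_norm _) _.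
exact: norm_Rintegral_le.
Qed.

Variables (T : R) (u : R -> field).
Hypothesis T0 : 0 < T.
Hypothesis uc : continuous_in_time T (Hk Omega 2) (Hk_norm Omega 2) u.

Let Hu t : t \in `[0, T] -> Hk Omega 2 (u t).
Proof. by move=> /uc[]. Qed.

Lemma norm2_weak_partialB (v w : field) s j : Hk Omega 2 v -> Hk Omega 2 w -> (size s <= 2)%N ->
  norm2 mu (wp s (v \- w) j \_ Omega) =
  norm2 mu (fun x => (wp s v j \_ Omega) x - (wp s w j \_ Omega) x).
Proof.
move=> Hv Hw s2.
have [_ sv] := Hk_weak_partial oO j Hv s2; have [_ sw] := Hk_weak_partial oO j Hw s2.
have [_ svw] := Hk_weak_partial oO j (HkB oO Hv Hw) s2.
apply: (sqi_ae svw.1 _ (sqiB sv sw)).2.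
by apply: (ae_imp (patch_ae_eq (weak_partialB oO j Hv Hw s2))) => x ->; rewrite patchB.
Qed.

Lemma weak_partial_continuous s j : (size s <= 2)%N ->
  {within `[0, T], continuous (fun t => norm2 mu (wp s (u t) j \_ Omega))}.
Proof.
move=> s2; apply/subspace_continuousP => t0 /= t0T.
have [Ht0 ut0] := uc t0T; apply/cvgrPdist_lt => e e0.
have : \forall t \near within `[0, T]%classic (nbhs t0), (Hk_norm Omega 2 (u t \- u t0)%R < e%:E)%E.
  have nb : nbhs (0%E : \bar R) [set y | (y < e%:E)%E].
    by apply: open_nbhs_nbhs; split; [exact: open_ereal_lt_ereal|rewrite /= lte_fin].
  exact: (ut0 _ nb).
rewrite !near_withinE; apply: filterS => t h tT.
have Ht := Hu tT; have := h tT => {}h.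
have [_ sv] := Hk_weak_partial oO j Ht s2; have [_ sw] := Hk_weak_partial oO j Ht0 s2.
rewrite distrC; apply: (le_lt_trans (norm2_dist sv sw)).
rewrite -norm2_weak_partialB// -lte_fin; apply: le_lt_trans h.
exact: norm2_le_Hk_norm (HkB oO Ht Ht0) s2.
Qed.

Lemma weak_partial_bounded : exists2 H : R, 0 <= H & forall t s j, t \in `[0, T] ->
  (size s <= 2)%N -> norm2 mu (wp s (u t) j \_ Omega) <= H.
Proof.
have B s : exists F : 'I_3 -> R, (size s <= 2)%N -> forall j t, t \in `[0, T] ->
    norm2 mu (wp s (u t) j \_ Omega) <= F j.
  have [s2|] := boolP (size s <= 2)%N; last by exists (fun=> 0).
  have Bj j : exists M, forall t, t \in `[0, T] -> norm2 mu (wp s (u t) j \_ Omega) <= M.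
    have [c _ hc] := EVT_max (ltW T0) (@weak_partial_continuous s j s2).
    by exists (norm2 mu (wp s (u c) j \_ Omega)).
  by have [F hF] := choice Bj; exists F.
have [F hF] := choice B.
(* A sum instead of a maximum over the finitely many derivatives; the orders k are 0, 1 and 2. *)
exists (\sum_(k < 3) \sum_(s : k.-tuple 'I_n) \sum_j `|F s j|).
  by apply: sumr_ge0 => k _; apply: sumr_ge0 => s _; apply: sumr_ge0.
move=> t s j tT s2; apply: (le_trans (hF s s2 j t tT)); apply: (le_trans (ler_norm _)).
have s3 : (size s < 3)%N by [].
rewrite [leRHS](bigD1 (Ordinal s3))//= [in leRHS](bigD1 (in_tuple s))//= [in leRHS](bigD1 j)//=.
rewrite -!addrA lerDl !addr_ge0//; first by apply: sumr_ge0.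
  by apply: sumr_ge0 => i _; apply: sumr_ge0.
by apply: sumr_ge0 => i _; apply: sumr_ge0 => k _; apply: sumr_ge0.
Qed.

Lemma time_integral_bound (F : R -> R) (K s t : R) : 0 <= s -> s <= t -> t <= T ->
  (forall r, r \in `[0, T] -> `|F r| <= K) ->
  `|\int[lebesgue_measure]_(r in `[0, t]) F r - \int[lebesgue_measure]_(r in `[0, s]) F r|
  <= K * (t - s).
Proof.
move=> s0 st tT FK.
have E : `[0, t]%classic = `[0, s]%classic `|` `]s, t]%classic :> set R.
  apply/seteqP; split => x /=; rewrite !in_itv/=.
    by move=> /andP[x0 xt]; case: (leP x s) => xs; [left|right]; rewrite ?x0 ?xs ?xt.
  by case=> /andP[a b]; apply/andP; split; lra.
have fin (a b : bool) (x y : R) : (lebesgue_measure ([set` Interval (BSide a x) (BSide b y)] : set R) < +oo)%E.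
  by rewrite lebesgue_measure_itv/=; case: ifP => _; rewrite ?ltry// -EFinD ltry.
rewrite E; apply: (le_trans (Rintegral_setU_bound (K := K) _ _ _ (fin _ _ _ _) (fin _ _ _ _) _)).
- exact: measurable_itv.
- exact: measurable_itv.
- rewrite disj_set2E; apply/eqP/seteqP; split => // x /=; rewrite !in_itv/= => -[/andP[_ xs] /andP[sx _]].
  by move: (lt_le_trans sx xs); rewrite ltxx.
- move=> x; rewrite -E /= in_itv/= => /andP[x0 xt]; apply: FK.
  by rewrite in_itv/= x0 (le_trans xt).
rewrite -[X in fine X]/(lebesgue_measure `]s, t]%classic) lebesgue_measure_itv/= lte_fin.
case: ltP => // ts.
  by rewrite (_ : s = t) ?subrr//; apply/eqP; rewrite eq_le st ts.
Qed.

End time_bounds.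

(** * The cubic nonlinearity and scalar inequalities *)

Section cubic.
Context {R : realType}.

Lemma cubicE n (v : 'rV[R]_n -> 'cV[R]_3) x j :
  cubic v x j ord0 = (\sum_k v x k ord0 ^+ 2) * v x j ord0.
Proof. by rewrite /cubic mxE frob_norm_sqr. Qed.

(** Split |a|^2 a - |b|^2 b as (|a|^2 - |b|^2) a + |b|^2 (a - b); the two parts contribute 2 M^2 and
    3 M^2. *)
Lemma cubic_lipschitz (M : R) (a b : 'cV[R]_3) j :
  (forall k, `|a k ord0| <= M) -> (forall k, `|b k ord0| <= M) ->
  `|(\sum_k a k ord0 ^+ 2) * a j ord0 - (\sum_k b k ord0 ^+ 2) * b j ord0| <=
  5 * M ^+ 2 * \sum_k `|a k ord0 - b k ord0|.
Proof.
move=> aM bM; have M0 : 0 <= M := le_trans (normr_ge0 _) (aM j).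
set D := \sum_k `|_ - _|.
have D0 : 0 <= D by apply: sumr_ge0.
have -> : (\sum_k a k ord0 ^+ 2) * a j ord0 - (\sum_k b k ord0 ^+ 2) * b j ord0 =
    (\sum_k a k ord0 ^+ 2 - \sum_k b k ord0 ^+ 2) * a j ord0 +
    (\sum_k b k ord0 ^+ 2) * (a j ord0 - b j ord0) by ring.
have h1 : `|\sum_k a k ord0 ^+ 2 - \sum_k b k ord0 ^+ 2| <= 2 * M * D.
  rewrite -sumrB mulr_sumr; apply: (le_trans (ler_norm_sum _ _ _)).
  apply: ler_sum => k _; rewrite subr_sqr normrM mulrC ler_wpM2r//.
  by apply: (le_trans (ler_normD _ _)); have := aM k; have := bM k; lra.
have h2 : `|\sum_k b k ord0 ^+ 2| <= 3 * M ^+ 2.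
  apply: (le_trans (ler_norm_sum _ _ _)); apply: (@le_trans _ _ (\sum_(k < 3) M ^+ 2)).
    by apply: ler_sum => k _; rewrite normrX lerXn2r ?nnegrE.
  by rewrite sumr_const card_ord -[leLHS]mulr_natl.
have h3 : `|a j ord0 - b j ord0| <= D.
  by rewrite /D [leRHS](bigD1 j)//= lerDl; apply: sumr_ge0.
apply: (le_trans (ler_normD _ _)); rewrite !normrM.
have e1 : `|\sum_k a k ord0 ^+ 2 - \sum_k b k ord0 ^+ 2| * `|a j ord0| <= 2 * M * D * M by apply: ler_pM.
have e2 : `|\sum_k b k ord0 ^+ 2| * `|a j ord0 - b j ord0| <= 3 * M ^+ 2 * D by apply: ler_pM.
have -> : 5 * M ^+ 2 * D = 2 * M * D * M + 3 * M ^+ 2 * D by ring.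
exact: lerD.
Qed.

(** Subtraction of the weak formulations at two times: the [p] and the [q] are the five time
    integrals with their coefficients, and [z] is the pairing with the initial datum, which
    cancels. *)
Lemma balance_le (v w z p1 p2 p3 p4 p5 q1 q2 q3 q4 q5 k1 k2 k3 k4 k5 d : R) :
  `|p1 - q1| <= k1 * d -> `|p2 - q2| <= k2 * d -> `|p3 - q3| <= k3 * d ->
  `|p4 - q4| <= k4 * d -> `|p5 - q5| <= k5 * d ->
  v + p1 + p2 = z + p3 + p4 - p5 -> w + q1 + q2 = z + q3 + q4 - q5 ->
  v - w <= (k1 + k2 + k3 + k4 + k5) * d.
Proof.
rewrite !ler_norml => /andP[? ?] /andP[? ?] /andP[? ?] /andP[? ?] /andP[? ?] ? ?.
rewrite !mulrDl; lra.
Qed.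

(** On a bounded time interval a Hölder exponent may be lowered, at the cost of a power of [T]. *)
Lemma powR_interpolation (T x a c : R) : 0 <= x <= T -> 0 < a <= c ->
  x `^ c <= T `^ (c - a) * x `^ a.
Proof.
move=> /andP[x0 xT] /andP[a0 ac]; have [->|xn] := eqVneq x 0.
  by rewrite !powR0 ?mulr0 ?gt_eqF// (lt_le_trans a0).
have -> : x `^ c = x `^ (c - a) * x `^ a.
  by rewrite -powRD ?subrK//; apply/implyP.
rewrite ler_wpM2r ?powR_ge0// ge0_ler_powR ?nnegrE ?subr_ge0//.
exact: le_trans xT.
Qed.

End cubic.

(** * The five terms of the weak formulation and the increment in L^2 *)

Section regularity.
Context {R : realType} {n : nat}.
Local Notation mu := (@lebesgue_row R n).
Variable Omega : set 'rV[R]_n.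
Hypothesis oO : open Omega.
Local Notation field := ('rV[R]_n -> 'cV[R]_3).
Local Notation wp s v j := (weak_partial Omega s (fun y => v y j ord0)).
Local Notation dom := (dominant Omega).

Let mO : measurable Omega. Proof. exact: open_measurable_row. Qed.

(** Almost everywhere the values of [v] lie in a cube on which the cubic map is Lipschitz with
    constant 5 M^2, so [lipschitz_weak_derivative] bounds the weak derivative if it exists. *)
Lemma weak_partial_cubic (v : field) (M : R) i j : Hk Omega 2 v ->
  {ae mu, forall x, Omega x -> forall k, `|v x k ord0| <= M} -> 0 <= M ->
  {ae mu, forall x, Omega x -> `|wp [:: i] (cubic v) j x| <= 5 * M ^+ 2 * dom v x}.
Proof.
move=> Hv vM M0.
have dom0 x : 0 <= dom v x by have [h _ _ _] := dominant_ge Omega v x j; exact: le_trans h.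
have [[G cG]|ncG] := pselect (exists G, weak_derivative Omega [:: i] (fun y => cubic v y j ord0) G).
  have cw := weak_partialP cG.
  have fg k := (Hk_weak_partial oO k Hv (isT : (size [:: i] <= 2)%N)).1.
  have L0 : 0 <= 5 * M ^+ 2 by rewrite mulr_ge0 ?sqr_ge0.
  have := @lipschitz_weak_derivative _ _ i Omega 3 oO _ _ _ _ _ _ L0 fg cw vM.
  move=> /(_ _); have H : forall x y : 'rV[R]_n, (forall k, `|v x k ord0| <= M) ->
     (forall k, `|v y k ord0| <= M) -> `|cubic v x j ord0 - cubic v y j ord0| <=
     5 * M ^+ 2 * \sum_k `|v x k ord0 - v y k ord0|.
    by move=> x y vx vy; rewrite !cubicE; exact: cubic_lipschitz.
  move=> /(_ H) ae; apply: (ae_imp ae) => x h Ox; apply: (le_trans (h Ox)).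
  rewrite ler_wpM2l// /dominant; apply: ler_sum => k _.
  have h1 : `|wp [:: i] v k x| <= \sum_l `|wp [:: l] v k x|.
    by rewrite [leRHS](bigD1 i)//= lerDl; apply: sumr_ge0.
  have h2 : 0 <= \sum_l `|wp [:: l; l] v k x| by apply: sumr_ge0.
  by have h3 := normr_ge0 (wp [::] v k x); lra.
(* [weak_partial] is 0 by convention when there is no weak derivative *)
have -> : wp [:: i] (cubic v) j = cst 0.
  rewrite /weak_partial; case: xgetP => // G _ hG.
  by case: ncG; exists G.
by apply/nearW => x _; rewrite normr0 mulr_ge0// mulr_ge0 ?sqr_ge0.
Qed.

Lemma norm2_value (v : field) j : Hk Omega 2 v ->
  sqi mu ((fun x => v x j ord0) \_ Omega) /\
  norm2 mu ((fun x => v x j ord0) \_ Omega) = norm2 mu (wp [::] v j \_ Omega).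
Proof.
move=> Hv; have [w0 s0] := Hk_weak_partial oO j Hv (isT : (size (@nil 'I_n) <= 2)%N).
apply: sqi_ae => //; first by apply: loc_integrable_measurable => //; case: w0.
by apply: (ae_imp (patch_ae_eq (weak_partial0 oO j Hv))) => x ->.
Qed.

Section bounds.
Variables (C T H : R) (u : R -> field).
Hypothesis C0 : 0 <= C.
Hypothesis agmonC : agmon_on Omega Omega C.
Hypothesis Hu : forall t, t \in `[0, T] -> Hk Omega 2 (u t).
Hypothesis H0 : 0 <= H.
Hypothesis uH : forall t s j, t \in `[0, T] -> (size s <= 2)%N ->
  norm2 mu (wp s (u t) j \_ Omega) <= H.

(** The interpolation bound at rho = 1, with every norm replaced by [H]. *)
Definition sup_bound := C * (H + n%:R * H).

Lemma agmon_field (v : field) (j : 'I_3) (rho a c : R) : Hk Omega 2 v -> 0 < rho <= 1 ->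
  norm2 mu ((fun x => v x j ord0) \_ Omega) <= a ->
  (forall m, norm2 mu (wp [:: m; m] v j \_ Omega) <= c) ->
  {ae mu, forall x, Omega x -> `|v x j ord0| <= C / Num.sqrt (rho ^+ n) * (a + rho ^+ 2 * (n%:R * c))}.
Proof.
move=> Hv r01 va vc.
have sg m := (Hk_weak_partial oO j Hv (isT : (size [:: m; m] <= 2)%N)).2.
have fg m := (Hk_weak_partial oO j Hv (isT : (size [:: m; m] <= 2)%N)).1.
have [sv _] := norm2_value j Hv.
apply: (ae_imp (agmonC sv sg fg r01)) => x h Ox; apply: (le_trans (h Ox)).
have /andP[r0 _] := r01.
rewrite ler_wpM2l ?divr_ge0 ?sqrtr_ge0// lerD// ler_wpM2l ?sqr_ge0//.
apply: (@le_trans _ _ (\sum_(m < n) c)); first by apply: ler_sum => m _.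
by rewrite sumr_const card_ord mulr_natl.
Qed.

Lemma sup_boundP t : t \in `[0, T] ->
  {ae mu, forall x, Omega x -> forall j, `|u t x j ord0| <= sup_bound}.
Proof.
move=> tT; have r01 : 0 < (1 : R) <= 1 by rewrite ltr01 lexx.
have v0 j : norm2 mu ((fun x => u t x j ord0) \_ Omega) <= H.
  by rewrite (norm2_value j (Hu tT)).2; exact: uH.
have ae j := agmon_field (Hu tT) r01 (v0 j) (fun m => uH (s := [:: m; m]) j tT isT).
have : {ae mu, forall x, forall j, Omega x -> `|u t x j ord0| <= sup_bound}.
  apply: filter_forall => j; apply: (ae_imp (ae j)) => x h Ox.
  by have := h Ox; rewrite !expr1n sqrtr1 divr1 mul1r.
by move=> h; apply: (ae_imp h) => x hx Ox j; exact: hx.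
Qed.

Let M := sup_bound.
Let M0 : 0 <= M. Proof. by rewrite /M /sup_bound mulr_ge0// addr_ge0// mulr_ge0. Qed.
Let cdom := 3 * ((1 + 2 * n%:R) * H).
Let cdom0 : 0 <= cdom.
Proof. by rewrite /cdom !mulr_ge0// addr_ge0// mulr_ge0. Qed.

(** Majorant of the test function and its derivatives. No smallness of the increment is used here: a
    bound uniform in t and s is enough, the factor |t - s| coming from the length of the time
    interval. *)
Let phi_dom t s x := dom (u t) x + dom (u s) x.

Lemma phi_domP t s : t \in `[0, T] -> s \in `[0, T] ->
  sqi mu (phi_dom t s \_ Omega) /\ norm2 mu (phi_dom t s \_ Omega) <= cdom + cdom.
Proof.
move=> tT sT.
have [st nt] := dominant_norm2 oO (Hu tT) (fun r j => uH j tT).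
have [ss ns] := dominant_norm2 oO (Hu sT) (fun r j => uH j sT).
have -> : phi_dom t s \_ Omega = fun x => (dom (u t) \_ Omega) x + (dom (u s) \_ Omega) x.
  by apply/funext => x; rewrite /phi_dom /patch; case: ifP => //; rewrite addr0.
split; first exact: sqiD.
exact: le_trans (norm2D st ss) (lerD nt ns).
Qed.

Lemma form_bound l (A B : 'rV[R]_n -> 'M[R]_(3, l)) (L r t s : R) : 0 <= L ->
  r \in `[0, T] -> t \in `[0, T] -> s \in `[0, T] ->
  {ae mu, forall x, Omega x -> forall j i, `|A x j i| <= L * dom (u r) x} ->
  {ae mu, forall x, Omega x -> forall j i, `|B x j i| <= phi_dom t s x} ->
  `|L2_dot Omega A B| <= (3 * l)%:R * (L * cdom * (cdom + cdom)).
Proof.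
move=> L0 rT tT sT hA hB.
have [sq nq] := phi_domP tT sT.
have [sp np] := dominant_norm2 oO (Hu rT) (fun r j => uH j rT).
have [sLp nLp] := norm2_scale_le L0 sp.
have pE : (fun x => L * dom (u r) x) \_ Omega = fun x => L * (dom (u r) \_ Omega) x.
  by apply/funext => x; rewrite /patch; case: ifP => //; rewrite mulr0.
have sLp' : sqi mu ((fun x => L * dom (u r) x) \_ Omega) by rewrite pE.
apply: (le_trans (L2_dot_bound oO sLp' sq hA hB)); rewrite ler_wpM2l//.
by apply: ler_pM; rewrite ?norm2_ge0// pE nLp ler_wpM2l.
Qed.

Let wpd (v : field) x j : [/\ `|wp [::] v j x| <= dom v x, forall i, `|wp [:: i] v j x| <= dom v x,
      \sum_i `|wp [:: i] v j x| <= dom v x & \sum_i `|wp [:: i; i] v j x| <= dom v x].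
Proof. exact: dominant_ge. Qed.

Let dom0 v x : 0 <= dom v x.
Proof. by have [h _ _ _] := wpd v x ord0; exact: le_trans h. Qed.

Section test.
Variables (t s : R).
Hypotheses (tT : t \in `[0, T]) (sT : s \in `[0, T]).
Local Notation phi := (u t \- u s).

Lemma test_value : {ae mu, forall x, Omega x -> forall (j : 'I_3) (i : 'I_1),
  `|phi x j i| <= phi_dom t s x}.
Proof.
have e v : Hk Omega 2 v -> {ae mu, forall x, forall j, Omega x -> wp [::] v j x = v x j ord0}.
  by move=> Hv; apply: filter_forall => j; exact: weak_partial0 Hv.
apply: (ae_imp2 (e _ (Hu tT)) (e _ (Hu sT))) => x et es Ox j i.
rewrite (ord1 i) /= !mxE -et// -es//; apply: (le_trans (ler_normB _ _)).
by apply: lerD; [have [] := wpd (u t) x j|have [] := wpd (u s) x j].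
Qed.

Lemma test_gradient : {ae mu, forall x, Omega x -> forall j i,
  `|wgrad Omega phi x j i| <= phi_dom t s x}.
Proof.
have e : {ae mu, forall x, forall j, forall i, Omega x ->
    wp [:: i] phi j x = wp [:: i] (u t) j x - wp [:: i] (u s) j x}.
  apply: filter_forall => j; apply: filter_forall => i.
  exact: (weak_partialB oO j (Hu tT) (Hu sT) (isT : (size [:: i] <= 2)%N)).
apply: (ae_imp e) => x ex Ox j i; rewrite !mxE ex//; apply: (le_trans (ler_normB _ _)).
by apply: lerD; [have [_ h _ _] := wpd (u t) x j|have [_ h _ _] := wpd (u s) x j].
Qed.

Lemma wlapE (v : field) x j (i : 'I_1) : wlap Omega v x j i = \sum_l wp [:: l; l] v j x.
Proof. by rewrite (ord1 i) /wlap summxE; apply: eq_bigr => l _; rewrite mxE. Qed.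

Lemma test_laplacian : {ae mu, forall x, Omega x -> forall j i,
  `|wlap Omega phi x j i| <= phi_dom t s x}.
Proof.
have e : {ae mu, forall x, forall j, forall i, Omega x ->
    wp [:: i; i] phi j x = wp [:: i; i] (u t) j x - wp [:: i; i] (u s) j x}.
  apply: filter_forall => j; apply: filter_forall => i.
  exact: (weak_partialB oO j (Hu tT) (Hu sT) (isT : (size [:: i; i] <= 2)%N)).
apply: (ae_imp e) => x ex Ox j i; rewrite wlapE.
under eq_bigr do rewrite ex//; rewrite sumrB; apply: (le_trans (ler_normB _ _)).
apply: lerD; apply: (le_trans (ler_norm_sum _ _ _)).
  by have [_ _ _ h] := wpd (u t) x j.
by have [_ _ _ h] := wpd (u s) x j.
Qed.

End test.

Section forms.
Variable r : R.
Hypothesis rT : r \in `[0, T].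

Lemma gradient_value : {ae mu, forall x, Omega x -> forall j i,
  `|wgrad Omega (u r) x j i| <= 1 * dom (u r) x}.
Proof.
by apply/nearW => x _ j i; rewrite !mxE mul1r; have [_ h _ _] := wpd (u r) x j.
Qed.

Lemma laplacian_value : {ae mu, forall x, Omega x -> forall j i,
  `|wlap Omega (u r) x j i| <= 1 * dom (u r) x}.
Proof.
apply/nearW => x _ j i; rewrite wlapE mul1r; apply: (le_trans (ler_norm_sum _ _ _)).
by have [_ _ _ h] := wpd (u r) x j.
Qed.

Let valueE : {ae mu, forall x, Omega x -> forall j, `|u r x j ord0| <= M /\
  `|u r x j ord0| <= dom (u r) x}.
Proof.
have e : {ae mu, forall x, forall j, Omega x -> wp [::] (u r) j x = u r x j ord0}.
  by apply: filter_forall => j; exact: weak_partial0 (Hu rT).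
apply: (ae_imp2 (sup_boundP rT) e) => x hM ex Ox j; split; first exact: hM.
by rewrite -ex//; have [] := wpd (u r) x j.
Qed.

Lemma reaction_value : {ae mu, forall x, Omega x -> forall j (i : 'I_1),
  `|((1 - frob_norm (u r x) ^+ 2) *: u r x) j i| <= (1 + 3 * M ^+ 2) * dom (u r) x}.
Proof.
apply: (ae_imp valueE) => x hx Ox j i; have {}hx := hx Ox.
rewrite (ord1 i) mxE normrM ler_pM//; last by have [] := hx j.
rewrite frob_norm_sqr; apply: (le_trans (ler_normB _ _)); rewrite normr1 lerD2l.
apply: (le_trans (ler_norm_sum _ _ _)); apply: (@le_trans _ _ (\sum_(k < 3) M ^+ 2)).
  by apply: ler_sum => k _; rewrite normrX lerXn2r ?nnegrE//; have [] := hx k.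
by rewrite sumr_const card_ord -[leLHS]mulr_natl.
Qed.

Lemma precession_value : {ae mu, forall x, Omega x -> forall j i,
  `|cross_cols (u r x) (wgrad Omega (u r) x) j i| <= (2 * M) * dom (u r) x}.
Proof.
apply: (ae_imp valueE) => x hx Ox j i; have {}hx := hx Ox.
rewrite !mxE; apply: (le_trans (ler_normB _ _)).
have -> : 2 * M * dom (u r) x = M * dom (u r) x + M * dom (u r) x by ring.
apply: lerD; rewrite normrM ler_pM//; try by [have [] := hx (j + 1)|have [] := hx (j + 2)].
  by have [_ h _ _] := wpd (u r) x (j + 2).
by have [_ h _ _] := wpd (u r) x (j + 1).
Qed.

Lemma cubic_gradient_value : {ae mu, forall x, Omega x -> forall j i,
  `|wgrad Omega (cubic (u r)) x j i| <= 5 * M ^+ 2 * dom (u r) x}.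
Proof.
have e : {ae mu, forall x, forall j, forall i, Omega x ->
    `|wp [:: i] (cubic (u r)) j x| <= 5 * M ^+ 2 * dom (u r) x}.
  apply: filter_forall => j; apply: filter_forall => i.
  exact: weak_partial_cubic (Hu rT) (sup_boundP rT) M0.
by apply: (ae_imp e) => x ex Ox j i; rewrite !mxE; exact: ex.
Qed.

End forms.

Lemma frob_integral (v w : field) : (forall j, sqi mu ((fun x => v x j ord0) \_ Omega)) ->
  (forall j, sqi mu ((fun x => w x j ord0) \_ Omega)) ->
  mu.-integrable Omega (EFin \o (fun x => frob (v x) (w x))) /\
  L2_dot Omega v w = \sum_j \int[mu]_x
    (((fun x => v x j ord0) \_ Omega) x * ((fun x => w x j ord0) \_ Omega) x).
Proof.
move=> sv sw.
have E j : (fun x => ((fun x => v x j ord0) \_ Omega) x * ((fun x => w x j ord0) \_ Omega) x) =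
    (fun x => v x j ord0 * w x j ord0) \_ Omega.
  by apply/funext => x; rewrite /patch; case: ifP; rewrite ?mulr0.
have i1 j : mu.-integrable Omega (EFin \o (fun x => v x j ord0 * w x j ord0)).
  by apply/(integrable_mkcond _ mO); rewrite restrict_EFin -E; exact: sqi_integrableM.
have [i2 e2] := Rintegral_sum mO i1.
have F x : frob (v x) (w x) = \sum_j v x j ord0 * w x j ord0.
  by apply: eq_bigr => j _; rewrite big_ord1.
rewrite /L2_dot; under eq_Rintegral do rewrite F.
under [X in EFin \o X]eq_fun do rewrite F.
split => //; rewrite e2; apply: eq_bigr => j _.
by rewrite Rintegral_mkcond -E.
Qed.

Variables (b1 b2 b3 b4 b5 : R) (u0 : field).
Hypothesis T0 : 0 < T.
Hypothesis uw : forall phi, Hk Omega 2 phi -> forall t, t \in `[0, T] ->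
  L2_dot Omega (u t) phi
  + b1 * (\int[lebesgue_measure]_(s in `[0, t]) L2_dot Omega (wgrad Omega (u s)) (wgrad Omega phi))
  + b2 * (\int[lebesgue_measure]_(s in `[0, t]) L2_dot Omega (wlap Omega (u s)) (wlap Omega phi))
  = L2_dot Omega u0 phi
  + b3 * (\int[lebesgue_measure]_(s in `[0, t])
      L2_dot Omega (fun x => (1 - frob_norm (u s x) ^+ 2) *: u s x) phi)
  + b4 * (\int[lebesgue_measure]_(s in `[0, t])
      L2_dot Omega (fun x => cross_cols (u s x) (wgrad Omega (u s) x)) (wgrad Omega phi))
  - b5 * (\int[lebesgue_measure]_(s in `[0, t])
      L2_dot Omega (wgrad Omega (cubic (u s))) (wgrad Omega phi)).

(** The same [phi] is tested at the times t and s, so the left-hand pairings differ by its squared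
    norm, and each time integral is reduced to its increment between s and t. *)
Lemma energy_increment : exists2 K, 0 <= K & forall t s, t \in `[0, T] -> s \in `[0, T] ->
  \sum_j norm2 mu ((fun x => (u t \- u s) x j ord0) \_ Omega) ^+ 2 <= K * `|t - s|.
Proof.
pose KL (l : nat) L := (3 * l)%:R * (L * cdom * (cdom + cdom)).
have KL0 l L : 0 <= L -> 0 <= KL l L.
  by move=> L0; rewrite /KL mulr_ge0// mulr_ge0// ?addr_ge0// mulr_ge0.
pose K1 := KL n 1; pose K2 := KL 1 1; pose K3 := KL 1 (1 + 3 * M ^+ 2).
pose K4 := KL n (2 * M); pose K5 := KL n (5 * M ^+ 2).
have M20 : 0 <= M ^+ 2 by exact: sqr_ge0.
have p3 : 0 <= 1 + 3 * M ^+ 2 by lra.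
have p4 : 0 <= 2 * M by rewrite mulr_ge0.
have p5 : 0 <= 5 * M ^+ 2 by rewrite mulr_ge0.
exists (`|b1| * K1 + `|b2| * K2 + `|b3| * K3 + `|b4| * K4 + `|b5| * K5).
  by rewrite !addr_ge0// mulr_ge0// KL0.
move=> t s; wlog st : t s / s <= t.
  move=> hw tT sT; have [st|/ltW ts] := leP s t; first exact: hw.
  have E j : norm2 mu ((fun x => (u t \- u s) x j ord0) \_ Omega) =
      norm2 mu ((fun x => (u s \- u t) x j ord0) \_ Omega).
    rewrite -norm2N; have -> // : (fun x => - ((fun x => (u t \- u s) x j ord0) \_ Omega) x) =
      (fun x => (u s \- u t) x j ord0) \_ Omega.
    apply/funext => x; rewrite /patch; case: ifP => _; last by rewrite oppr0.
    by rewrite /= !mxE opprB.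
  rewrite distrC (eq_bigr _ (fun j _ => congr1 (fun z => z ^+ 2) (E j))).
  exact: hw.
move=> tT sT; set phi := u t \- u s.
have Hp : Hk Omega 2 phi by exact: (HkB oO (Hu tT) (Hu sT)).
have /andP[s0 _] : 0 <= s <= T by move: sT; rewrite in_itv.
have /andP[_ tT'] : 0 <= t <= T by move: tT; rewrite in_itv.
have sv (v : field) : Hk Omega 2 v -> forall j, sqi mu ((fun x => v x j ord0) \_ Omega).
  by move=> Hv j; have [] := norm2_value j Hv.
have E : \sum_j norm2 mu ((fun x => phi x j ord0) \_ Omega) ^+ 2 =
    L2_dot Omega (u t) phi - L2_dot Omega (u s) phi.
  rewrite (frob_integral (sv _ (Hu tT)) (sv _ Hp)).2 (frob_integral (sv _ (Hu sT)) (sv _ Hp)).2.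
  rewrite -sumrB; apply: eq_bigr => j _; rewrite norm2_sqr.
  rewrite -RintegralB//; [|exact: sqi_integrableM (sv _ (Hu tT) j) (sv _ Hp j)
    |exact: sqi_integrableM (sv _ (Hu sT) j) (sv _ Hp j)].
  apply: eq_Rintegral => x _; rewrite -mulrBl expr2; congr (_ * _).
  by rewrite /phi /patch /=; case: ifP => _; rewrite ?mxE ?subr0.
have tg := test_gradient tT sT; have tl := test_laplacian tT sT; have tv := test_value tT sT.
have bd (b : R) (F : R -> R) K : (forall r, r \in `[0, T] -> `|F r| <= K) ->
    `|b * (\int[lebesgue_measure]_(r in `[0, t]) F r) -
      b * (\int[lebesgue_measure]_(r in `[0, s]) F r)| <= `|b| * K * (t - s).
  move=> FK; rewrite -mulrBr normrM -mulrA ler_wpM2l//.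
  exact: time_integral_bound FK.
have i1 := bd b1 _ K1 (fun r rT => form_bound ler01 rT tT sT (gradient_value r) tg).
have i2 := bd b2 _ K2 (fun r rT => form_bound ler01 rT tT sT (laplacian_value r) tl).
have i3 := bd b3 _ K3 (fun r rT => form_bound p3 rT tT sT (reaction_value rT) tv).
have i4 := bd b4 _ K4 (fun r rT => form_bound p4 rT tT sT (precession_value rT) tg).
have i5 := bd b5 _ K5 (fun r rT => form_bound p5 rT tT sT (cubic_gradient_value rT) tg).
rewrite E (ger0_norm (_ : 0 <= t - s)) ?subr_ge0//.
exact: (balance_le i1 i2 i3 i4 i5 (uw Hp tT) (uw Hp sT)).
Qed.

End bounds.
End regularity.

(** * The increment in L^oo *)

Section sup_norm.
Context {R : realType} {n : nat}.
Local Notation mu := (@lebesgue_row R n).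
Variable Omega : set 'rV[R]_n.
Hypothesis oO : open Omega.
Local Notation field := ('rV[R]_n -> 'cV[R]_3).
Local Notation wp s v j := (weak_partial Omega s (fun y => v y j ord0)).

Lemma Lnorm_oo_le (f : 'rV[R]_n -> R) (B : R) : 0 <= B ->
  {ae mu, forall x, Omega x -> `|f x| <= B} ->
  ('N[mu]_+oo[EFin \o (f \_ Omega)] <= B%:E)%E.
Proof.
(* The second branch is a convention for a space of measure 0, where the norm is 0. *)
move=> B0 fB; rewrite unlock /Lnorm; case: ifP => _; last by rewrite lee_fin.
apply/ess_supP; apply: (ae_imp fB) => x h; rewrite /= lee_fin /patch.
by case: ifPn => [/set_mem/h//|_]; rewrite normr0.
Qed.

Lemma Lp_oo (v : field) (B : R) : 0 <= B -> Hk Omega 2 v ->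
  {ae mu, forall x, Omega x -> forall j, `|v x j ord0| <= B} -> Lp Omega +oo%E v.
Proof.
move=> B0 Hv vB j; apply/andP; split; rewrite inE /=.
  by have [[]] := norm2_value oO j Hv.
rewrite /finite_norm; apply: (@le_lt_trans _ _ B%:E); last exact: ltry.
by apply: Lnorm_oo_le => //; apply: (ae_imp vB) => x h Ox; exact: h.
Qed.

Lemma Lp_norm_oo_le (v : field) (B : R) : 0 <= B ->
  {ae mu, forall x, Omega x -> forall j, `|v x j ord0| <= B} ->
  (Lp_norm Omega +oo%E v <= (3 * B)%:E)%E.
Proof.
move=> B0 vB; apply: Lnorm_oo_le; first by rewrite mulr_ge0.
apply: (ae_imp vB) => x h Ox; have {}h := h Ox.
rewrite ger0_norm ?sqrtr_ge0// -(@ler_pXn2r _ 2%N) ?nnegrE ?sqrtr_ge0 ?mulr_ge0//.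
rewrite frob_norm_sqr; apply: (@le_trans _ _ (\sum_(j < 3) B ^+ 2)).
  by apply: ler_sum => j _; rewrite -(real_normK (num_real _)) lerXn2r ?nnegrE.
rewrite sumr_const card_ord -[leLHS]mulr_natl exprMn ler_wpM2r ?sqr_ge0//.
by rewrite expr2 ler_peMr// ler1n.
Qed.

Section bounds.
Variables (C T H K : R) (u : R -> field).
Hypothesis C0 : 0 <= C.
Hypothesis agmonC : agmon_on Omega Omega C.
Hypothesis Hu : forall t, t \in `[0, T] -> Hk Omega 2 (u t).
Hypothesis H0 : 0 <= H.
Hypothesis uH : forall t s j, t \in `[0, T] -> (size s <= 2)%N ->
  norm2 mu (wp s (u t) j \_ Omega) <= H.
Hypothesis T0 : 0 < T.
Hypothesis K0 : 0 <= K.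
Hypothesis uK : forall t s, t \in `[0, T] -> s \in `[0, T] ->
  \sum_j norm2 mu ((fun x => (u t \- u s) x j ord0) \_ Omega) ^+ 2 <= K * `|t - s|.

Lemma sup_increment : exists2 L, 0 <= L & forall t s, t \in `[0, T] -> s \in `[0, T] ->
  {ae mu, forall x, Omega x -> forall j,
    `|(u t \- u s) x j ord0| <= L * `|t - s| `^ (1 / 2 - n%:R / 8)}.
Proof.
(* The coefficients of the two terms, which carry the same power of |t - s| once rho is chosen. *)
pose S := Num.sqrt (K * T) + n%:R * (2 * H).
have S0 : 0 <= S by rewrite addr_ge0 ?sqrtr_ge0// mulr_ge0// mulr_ge0.
pose gam : R := 1 / 2 - n%:R / 8.
exists (C * S * T^-1 `^ gam).
  by rewrite mulr_ge0 ?powR_ge0// mulr_ge0.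
(* Equal times are set apart because rho would be 0. *)
move=> t s tT sT; have [->|ts] := eqVneq t s.
  apply/nearW => x _ j; rewrite /= !mxE subrr normr0.
  by rewrite mulr_ge0 ?powR_ge0// mulr_ge0 ?powR_ge0// mulr_ge0.
set tau := `|t - s|; have tau0 : 0 < tau by rewrite normr_gt0 subr_eq0.
have tauT : tau <= T.
  move: tT sT; rewrite !in_itv/= => /andP[? ?] /andP[? ?].
  by rewrite /tau ler_norml; apply/andP; split; lra.
(* The division by [T] ensures rho <= 1. *)
pose sig := tau / T; have sig0 : 0 < sig by rewrite divr_gt0.
have sig1 : sig <= 1 by rewrite ler_pdivrMr// mul1r.
pose rho := sig `^ (1 / 4).
have r01 : 0 < rho <= 1.
  rewrite powR_gt0//=; have := @ge0_ler_powR _ (1 / 4 : R) _ sig 1.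
  by rewrite powR1; apply => //; rewrite ?nnegrE// ?ltW.
have Hp : Hk Omega 2 (u t \- u s) by exact: (HkB oO (Hu tT) (Hu sT)).
have v0 j : norm2 mu ((fun x => (u t \- u s) x j ord0) \_ Omega) <= Num.sqrt (K * T) * sig `^ (1 / 2).
  have KT0 : 0 <= K * T by rewrite mulr_ge0// ltW.
  rewrite mul1r powR12_sqrt ?(ltW sig0)// -sqrtrM//.
  rewrite (_ : K * T * sig = K * tau); last by rewrite /sig; field; rewrite gt_eqF.
  rewrite -[leLHS]ger0_norm ?norm2_ge0// -sqrtr_sqr ler_sqrt; last by rewrite mulr_ge0// ltW.
  apply: le_trans (uK tT sT); rewrite [leRHS](bigD1 j)//= lerDl.
  by apply: sumr_ge0 => k _; exact: sqr_ge0.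
have v2 j m : norm2 mu (wp [:: m; m] (u t \- u s) j \_ Omega) <= 2 * H.
  rewrite norm2_weak_partialB//; [|exact: Hu|exact: Hu].
  have [_ st] := Hk_weak_partial oO j (Hu tT) (isT : (size [:: m; m] <= 2)%N).
  have [_ ss] := Hk_weak_partial oO j (Hu sT) (isT : (size [:: m; m] <= 2)%N).
  apply: (le_trans (norm2D st (sqiN ss))); rewrite norm2N.
  by rewrite mulr_natl mulr2n; apply: lerD; exact: uH.
have key : {ae mu, forall x, forall j, Omega x -> `|(u t \- u s) x j ord0| <=
    C / Num.sqrt (rho ^+ n) * (Num.sqrt (K * T) * sig `^ (1 / 2) + rho ^+ 2 * (n%:R * (2 * H)))}.
  by apply: filter_forall => j; exact: (agmon_field oO C0 agmonC Hp r01 (v0 j) (v2 j)).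
apply: (ae_imp key) => x h Ox j; apply: (le_trans (h j Ox)).
have rhon : Num.sqrt (rho ^+ n) = sig `^ (n%:R / 8).
  rewrite -powR12_sqrt ?exprn_ge0 ?powR_ge0// -powR_mulrn ?powR_ge0// /rho -!powRrM.
  by congr (_ `^ _); field.
have rho2 : rho ^+ 2 = sig `^ (1 / 2).
  rewrite -powR_mulrn ?powR_ge0// /rho -powRrM; congr (_ `^ _); by field.
have E : C / Num.sqrt (rho ^+ n) * (Num.sqrt (K * T) * sig `^ (1 / 2) + rho ^+ 2 * (n%:R * (2 * H)))
    = C * S * sig `^ gam.
  rewrite rhon rho2 /gam powRB; last by apply/implyP => _; rewrite gt_eqF.
  by rewrite /S; ring.
rewrite E /sig mulrC [tau / T]mulrC powRM ?invr_ge0 ?(ltW T0) ?(ltW tau0)// -/gam.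
rewrite le_eqVlt; apply/orP; left; apply/eqP; ring.
Qed.

End bounds.
End sup_norm.

Theorem theorem2p3 (R : realType) (d : nat) (hd : (1 <= d <= 3)%N)
    (Omega : set 'rV[R]_d) (hOmega : smooth_bounded_domain Omega)
    (beta1 beta2 beta3 beta4 beta5 : R)
    (hbeta2 : 0 < beta2) (hbeta3 : 0 < beta3)
    (hbeta4 : 0 < beta4) (hbeta5 : 0 < beta5)
    (T : R) (hT : 0 < T)
    (u0 : 'rV[R]_d -> 'cV[R]_3) (hu0 : Hk Omega 2 u0)
    (u : R -> 'rV[R]_d -> 'cV[R]_3)
    (hu : strong_solution Omega beta1 beta2 beta3 beta4 beta5 T u0 u)
    (alpha : R) (halpha : 0 < alpha <= 1 / 2)
    (beta : R) (hbeta : 0 < beta <= 1 / 2 - d%:R / 8) :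
  holder_in_time T (Lp Omega 2%:E) (Lp_norm Omega 2%:E) alpha u /\
  holder_in_time T (Lp Omega +oo%E) (Lp_norm Omega +oo%E) beta u.
Proof.
have [_ oO _ bO sO] := hOmega; have /andP[_ d3] := hd.
have [[Hu _ _ uw] uc _] := hu.
have [C C0 agmonC] := agmon d3 oO bO sO.
have [H H0 uH] := weak_partial_bounded oO hT uc.
have [K K0 uK] := energy_increment oO C0 agmonC Hu H0 uH uw.
have dist t s : t \in `[0, T] -> s \in `[0, T] -> 0 <= `|t - s| <= T.
  rewrite !in_itv/= => /andP[? ?] /andP[? ?].
  by rewrite normr_ge0 ler_norml; apply/andP; split; lra.
split; split.
- by move=> t /Hu[].
(* The power of [T] is the cost of lowering the exponent from 1 / 2 to [alpha]. *)
- exists (Num.sqrt K * T `^ (1 / 2 - alpha)) => s t sT tT.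
  rewrite Lp_norm2E; last by move=> j; have [] := norm2_value oO j (HkB oO (Hu _ tT) (Hu _ sT)).
  rewrite lee_fin; apply: (@le_trans _ _ (Num.sqrt (K * `|t - s|))).
    by rewrite ler_sqrt ?mulr_ge0//; exact: uK.
  rewrite sqrtrM// -mulrA ler_wpM2l ?sqrtr_ge0// -powR12_sqrt//.
  by have := powR_interpolation (dist _ _ tT sT) halpha; rewrite !mul1r.
- move=> t tT; apply: (@Lp_oo _ _ _ oO _ (sup_bound C H)).
  + by rewrite /sup_bound mulr_ge0// addr_ge0// mulr_ge0.
  + exact: Hu.
  + exact: (sup_boundP oO C0 agmonC Hu uH tT).
- have [L L0 uL] := sup_increment oO C0 agmonC Hu H0 uH hT K0 uK.
  (* The 3 passes from the components to the Euclidean norm; the power of [T] lowers the exponent to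
     [beta]. *)
  exists (3 * L * T `^ (1 / 2 - d%:R / 8 - beta)) => s t sT tT.
  apply: le_trans (Lp_norm_oo_le _ (uL _ _ tT sT)) _.
    by rewrite mulr_ge0// powR_ge0.
  rewrite lee_fin mulrA -[leRHS]mulrA ler_wpM2l ?mulr_ge0//.
  exact: powR_interpolation (dist _ _ tT sT) hbeta.
Qed.
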